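(* For any integer $d \ge 2$ there exists a constant $c_d>0$ (depending only on $d$) such that for any convex body $K \subseteq \mathbb{R}^d$ whose boundary is $C^2$, there exists $\varepsilon_0>0$ depending on $K$ such that for every $0<\varepsilon\le\varepsilon_0$ there exists a polytope $P$ with $K\subseteq P$ and Hausdorff distance between $K$ and $P$ at most $\varepsilon$, whose number of facets is at most \[ \left(\frac{c_d\,\Delta_{d-1}}{\varepsilon}\right)^{\frac{d-1}{2}}, \] where $\Delta_{d-1}$ is the surface diameter of $K$.
   Context: A convex body is a compact convex set with nonempty interior. The surface diameter $\Delta_{d-1}$ of $K$ is the diameter of a Euclidean ball in $\mathbb{R}^d$ whose surface area equals the surface area of $K$. *)

(* Defs.v *)
From HB Require Import structures.
From mathcomp Require Import all_boot all_order all_algebra.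
From mathcomp Require Import all_classical all_reals all_analysis.
Set Implicit Arguments. Unset Strict Implicit. Unset Printing Implicit Defensive.
Import Order.TTheory GRing.Theory Num.Theory.
Import numFieldNormedType.Exports.
Local Open Scope classical_set_scope.
Local Open Scope ring_scope.

Section Defs.
Variables (R : realType) (d : nat).
Notation V := 'rV[R]_d.

(* Euclidean norm on R^d (the library norm on 'rV is the max norm) *)
Definition enorm (x : V) : R := Num.sqrt (\sum_(i < d) x ord0 i ^+ 2).

Definition eball (c : V) (r : R) : set V := [set x | enorm (x - c) <= r].

Definition convex_set (K : set V) : Prop :=
  forall x y, K x -> K y -> forall l : R, 0 <= l -> l <= 1 ->
    K (l *: x + (1 - l) *: y).

Definition convex_body (K : set V) : Prop :=
  compact K /\ convex_set K /\ (K°) !=set0.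

Definition evec (i : 'I_d) : V := delta_mx ord0 i.

Definition partial (i : 'I_d) (f : V -> R) : V -> R := fun x => 'D_(evec i) f x.

Definition C2_on (U : set V) (f : V -> R) : Prop :=
  {within U, continuous f} /\
  (forall i, (forall x, U x -> derivable f x (evec i)) /\
             {within U, continuous (partial i f)}) /\
  (forall i j, (forall x, U x -> derivable (partial i f) x (evec j)) /\
               {within U, continuous (partial j (partial i f))}).

Definition C2_boundary (K : set V) : Prop :=
  forall x, K x -> ~ (K°) x ->
    exists (U : set V) (f : V -> R),
      [/\ open U, U x, C2_on U f, (exists i, partial i f x != 0) &
          K `&` U = [set y | U y /\ f y <= 0]].

Definition box (a b : V) : set V := [set x | forall i, a ord0 i <= x ord0 i <= b ord0 i].
Definition boxvol (a b : V) : R := \prod_(i < d) (b ord0 i - a ord0 i).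

Definition leb_outer (A : set V) : \bar R :=
  ereal_inf [set s | exists (a b : nat -> V),
    [/\ (forall k i, a k ord0 i <= b k ord0 i),
        A `<=` \bigcup_k box (a k) (b k) &
        s = (\sum_(0 <= k <oo) (boxvol (a k) (b k))%:E)%E]].

Definition volume (A : set V) : R := fine (leb_outer A).

Definition parallel_body (K : set V) (t : R) : set V :=
  [set x | exists2 y, K y & enorm (x - y) <= t].

(* surface area of a convex body (Minkowski):
   S(K) = lim_{t -> 0+} (vol(K + tB) - vol(K)) / t *)
Definition has_surface_area (K : set V) (S : R) : Prop :=
  (fun t => (volume (parallel_body K t) - volume K) / t) x @[x --> 0^'+] --> S.

Definition surface_diameter (K : set V) (D : R) : Prop :=
  0 < D /\ exists S, has_surface_area K S /\ has_surface_area (eball 0 (D / 2)) S.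

Definition edist (x : V) (A : set V) : \bar R :=
  ereal_inf [set (enorm (x - a))%:E | a in A].
Definition hausdorff_dist (A B : set V) : \bar R :=
  maxe (ereal_sup [set edist a B | a in A]) (ereal_sup [set edist b A | b in B]).

Definition halfspaces_inter (m : nat) (a : 'I_m -> V) (b : 'I_m -> R) : set V :=
  [set x | forall k, \sum_(i < d) a k ord0 i * x ord0 i <= b k].

Definition bounded_set (A : set V) : Prop :=
  exists M : R, forall x, A x -> enorm x <= M.

Definition polytope_with_le_facets (P : set V) (m : nat) : Prop :=
  exists (a : 'I_m -> V) (b : 'I_m -> R),
    P = halfspaces_inter a b /\ bounded_set P.

End Defs.

(* Main.v *)
Require Import Defs.
From HB Require Import structures.
From mathcomp Require Import all_boot all_order all_algebra.
From mathcomp Require Import all_classical all_reals all_analysis measurable_realfun.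
From mathcomp Require Import ring lra zify.
Set Implicit Arguments.
Unset Strict Implicit.
Unset Printing Implicit Defensive.
Import Order.TTheory GRing.Theory Num.Theory.
Import numFieldNormedType.Exports.
Local Open Scope classical_set_scope.
Local Open Scope ring_scope.

(* Locally, the boundary of [K] is a graph over a coordinate hyperplane; let [u]
   be the projection of a boundary point and [nu] its normal, scaled so that
   the coordinate along the chosen axis is [1] or [-1].  If [x] and [y] are
   boundary points with [<x - y, nu_x - nu_y>] of order [eps], the tangent
   half-space at [y] cuts off every point at distance more than [O(eps)] from [K]
   whose nearest point is [x]; so facets are counted by covering the boundary
   with cells on which this form is at most [eps].  By [C^2] regularity and
   compactness, on small patches the form is at most [v (M + eta) v^T], where
   [v] is the difference of the projections, [M] the (positive semidefinite)
   curvature matrix and [eta] a small constant.  An LDL factorisation of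
   [M + eta] cuts a patch into triangular cells of volume
   [eps^(n/2) / sqrt (det (M + eta))], where [n = d - 1], whose images
   under the strongly monotone map [x |-> eta u + nu] have volume
   [eps^(n/2) * sqrt (det (M + eta))].  The cells have bounded overlap in a
   region of volume comparable to the surface area, and their images have bounded
   overlap in a fixed cube, so by AM-GM their number is
   [O(sqrt (area) / eps^(n/2))].  Volumes of triangular cells are compared by
   integrating out one coordinate at a time. *)

(** Boundary points are handled as pairs of a point and a supporting normal, sorted into 2d classes
    by a coordinate [j] where the normal has largest absolute value and by its sign there. Within a
    class the projection forgetting [j] has a Lipschitz inverse, and no implicit function theorem is
    invoked. The obstacle is that curvature may vanish or be large, so cell volumes alone give no
    count. The volumes of a cell and of its image multiply to eps^n whatever the curvature, so AM-GM
    cancels the determinant; [eta] only keeps the cells bounded where curvature degenerates. The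
    image cube has a fixed size because [eta] times a coordinate of [K] and the entries of the
    normals are at most 1. Thus [K] enters the count only through its surface area, while [eta], the
    patch size and the number of patches affect only the threshold for eps. The linearisation
    tolerance [tau] is eta / (8 n), small enough for strong monotonicity to separate the images of
    distant patches. Since surface area comes from [leb_outer], volumes are compared through
    pointwise inequalities between indicators of cells and of covering boxes. *)

Section Packing.
Variable R : realType.

Lemma integral_weighted_itv (w a b : R) (i0 i1 : bool) : 0 <= w -> a <= b ->
  (\int[lebesgue_measure]_x
     (w * (x \in Interval (BSide i0 a) (BSide i1 b))%:R)%:E = (w * (b - a))%:E)%E.
Proof.
move=> w0 ab; pose A : set R := [set` Interval (BSide i0 a) (BSide i1 b)].
transitivity (\int[lebesgue_measure]_x (w%:E * (\1_A x)%:E))%E.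
  by apply: eq_integral => x _; rewrite -EFinM indicE mem_setE.
rewrite ge0_integralZl_EFin//; last first.
  by apply/measurable_EFinP; apply: measurable_indic; exact: measurable_itv.
rewrite integral_indic; [|exact: measurableT|exact: measurable_itv].
rewrite setIT EFinM; congr (_ * _)%E.
apply: (eq_trans (lebesgue_measure_itv (Interval (BSide i0 a) (BSide i1 b)))); rewrite /= lte_fin; case: ltP => // ba.
have -> : a = b by (apply/eqP; rewrite eq_le ab).
by rewrite subrr.
Qed.

Lemma prod_bool_ge0 n (b : 'I_n -> bool) : 0 <= \prod_(i < n) (b i)%:R :> R.
Proof. by apply: prodr_ge0 => i _; rewrite ler0n. Qed.

(** With the earlier coordinates fixed, the last coordinate of a cell runs over an interval of
    length [ga c n]. Integrating the pointwise inequality over that coordinate turns the length, and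
    [hi k n - lo k n] on the right, into factors of the weights; hence the general [w] and [w']. The
    right side is a countable sum so that the coverings in [leb_outer] fit. *)
Lemma triangular_packing (T : finType) (n : nat) (w : T -> R)
    (al : T -> nat -> (nat -> R) -> R) (ga : T -> nat -> R)
    (w' : nat -> R) (lo hi : nat -> nat -> R) :
  (forall c, 0 <= w c) -> (forall c i, 0 <= ga c i) ->
  (forall k, 0 <= w' k) -> (forall k i, lo k i <= hi k i) ->
  (forall c i x y, (forall j, (j < i)%N -> x j = y j) -> al c i x = al c i y) ->
  (forall x : nat -> R,
    ((\sum_c w c * \prod_(i < n) (al c i x <= x i < al c i x + ga c i)%R%:R)%:E <=
     \sum_(0 <= k <oo) (w' k * \prod_(i < n) (lo k i <= x i <= hi k i)%R%:R)%:E)%E) ->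
  ((\sum_c w c * \prod_(i < n) ga c i)%:E <=
   \sum_(0 <= k <oo) (w' k * \prod_(i < n) (hi k i - lo k i))%:E)%E.
Proof.
elim: n w w' => [|n IH] w w' w0 ga0 w'0 lohi aldep H.
  have := H (fun=> 0); under eq_bigr do rewrite big_ord0.
  under eq_eseriesr do rewrite big_ord0.
  by under [X in _ -> (X%:E <= _)%E]eq_bigr do rewrite big_ord0;
     under [X in _ -> (_ <= X)%E]eq_eseriesr do rewrite big_ord0.
have -> : \sum_c w c * \prod_(i < n.+1) ga c i =
    \sum_c (w c * ga c n) * \prod_(i < n) ga c i.
  by apply: eq_bigr => c _; rewrite big_ord_recr/= mulrAC mulrA.
under eq_eseriesr do rewrite big_ord_recr/= [X in _ * X]mulrC mulrA.
apply: IH => // [c|k|x]; first exact: mulr_ge0.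
  by rewrite mulr_ge0// subr_ge0.
pose X (r : R) := fun i : nat => if i == n then r else x i.
have Xn r : X r n = r by rewrite /X eqxx.
have Xl r (i : 'I_n) : X r i = x i by rewrite /X ltn_eqF.
pose a c := w c * \prod_(i < n) (al c i x <= x i < al c i x + ga c i)%R%:R.
pose b k := w' k * \prod_(i < n) (lo k i <= x i <= hi k i)%R%:R.
have a0 c : 0 <= a c by rewrite mulr_ge0// prod_bool_ge0.
have b0 k : 0 <= b k by rewrite mulr_ge0// prod_bool_ge0.
(* This is the hypothesis at [x] with coordinate [n] replaced by [r]. The end points [al c i] with i
   <= n do not see that coordinate, so only the last factor varies with [r]. *)
have HX (r : R) : ((\sum_c (a c * (r \in `[al c n x, al c n x + ga c n[)%:R)%:E) <=
    \sum_(0 <= k <oo) (b k * (r \in `[lo k n, hi k n])%:R)%:E)%E.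
  have := H (X r); rewrite sumEFin.
  have alX c (i : nat) : (i <= n)%N -> al c i (X r) = al c i x.
    move=> ile; apply: aldep => j ji; rewrite /X ltn_eqF//.
    exact: leq_trans ji ile.
  have -> : \sum_c w c * \prod_(i < n.+1)
      (al c i (X r) <= X r i < al c i (X r) + ga c i)%R%:R =
     \sum_c a c * (r \in `[al c n x, al c n x + ga c n[)%:R.
    apply: eq_bigr => c _; rewrite big_ord_recr/= /a -mulrA; congr (_ * (_ * _)).
      by apply: eq_bigr => i _; rewrite Xl alX// ltnW.
    by rewrite Xn alX// in_itv.
  under eq_eseriesr do rewrite big_ord_recr/=.
  move=> /le_trans; apply; apply: lee_nneseries => [k _ _|k _].
    by rewrite lee_fin mulr_ge0// mulr_ge0 ?prod_bool_ge0.
  rewrite lee_fin /b -mulrA Xn in_itv/=.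
  by under eq_bigr do rewrite Xl.
have mf (i0 i1 : bool) (u v w1 : R) : measurable_fun setT
   (fun r : R => (w1 * (r \in Interval (BSide i0 u) (BSide i1 v))%:R)%:E).
  apply/measurable_EFinP; apply: measurable_funM => //.
  rewrite (_ : (fun r => _) = \1_([set` Interval (BSide i0 u) (BSide i1 v)])).
    apply: measurable_indic; exact: measurable_itv.
  by apply/funext => r; rewrite indicE mem_setE.
pose L r := (\sum_c (a c * (r \in `[al c n x, al c n x + ga c n[)%:R)%:E)%E.
pose Q r := (\sum_(0 <= k <oo) (b k * (r \in `[lo k n, hi k n])%:R)%:E)%E.
have EL : (\int[lebesgue_measure]_r L r = (\sum_c a c * ga c n)%:E)%E.
  rewrite ge0_integral_sum//; [|by move=> c; exact: mf|].
    2: by move=> c r _; rewrite lee_fin mulr_ge0.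
  rewrite -sumEFin; apply: eq_bigr => c _.
  by rewrite integral_weighted_itv ?lerDl// addrAC subrr add0r.
have EQ : (\int[lebesgue_measure]_r Q r =
    \sum_(0 <= k <oo) (b k * (hi k n - lo k n))%:E)%E.
  rewrite integral_nneseries//; [|by move=> c; exact: mf|].
    2: by move=> c r _; rewrite lee_fin mulr_ge0.
  by apply: eq_eseriesr => k _; rewrite integral_weighted_itv.
under eq_bigr do rewrite mulrAC -/(a _).
under eq_eseriesr do rewrite mulrAC -/(b _).
rewrite -EL -EQ; apply: ge0_le_integral => //.
- by move=> r _; apply: sume_ge0 => c _; rewrite lee_fin mulr_ge0.
- by apply: emeasurable_sum => c; exact: mf.
- apply: ge0_emeasurable_sum => [k r _ _|k _]; last exact: mf.
  by rewrite lee_fin mulr_ge0.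
- by move=> r _; exact: HX.
Qed.

Lemma prod_bool n (b : 'I_n -> bool) :
  \prod_(i < n) (b i)%:R = [forall i, b i]%:R :> R.
Proof.
have [/forallP h|/forallPn[i /negbTE bi]] := boolP [forall i, b i].
  by apply: big1 => i _; rewrite h.
by rewrite (bigD1 i)//= bi mul0r.
Qed.

Lemma nneseries_finite (f : nat -> \bar R) (N : nat) :
  (forall k, 0 <= f k)%E -> (forall k, (N <= k)%N -> f k = 0%E) ->
  (\sum_(0 <= k <oo) f k = \sum_(0 <= k < N) f k)%E.
Proof.
move=> f0 fN; rewrite (@nneseries_split _ f 0 N)// add0n eseries0 ?adde0//.
by move=> k Nk _; exact: fN.
Qed.

(** Padding by 0 turns row vectors into sequences over [nat], the form in which the induction of
    [triangular_packing] drops a coordinate without recasting indices. *)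
Definition ext n (v : 'rV[R]_n) (i : nat) : R := oapp (v ord0) 0 (insub i).

Lemma extE n (v : 'rV[R]_n) (i : 'I_n) : ext v i = v ord0 i.
Proof. by rewrite /ext valK. Qed.

(** At most [W] cells meet at a point and all lie in the box, so their indicators add up to at most
    [W] times that of the box; [w'] writes this as a series with one nonzero term. *)
Lemma triangular_packing_box (T : finType) (n W : nat)
    (al : T -> 'I_n -> 'rV[R]_n -> R) (ga : T -> 'I_n -> R)
    (lo hi : 'rV[R]_n) :
  (forall c i, 0 <= ga c i) -> (forall i, lo ord0 i <= hi ord0 i) ->
  (forall c (i : 'I_n) (x y : 'rV_n), (forall j : 'I_n, (j < i)%N -> x ord0 j = y ord0 j) ->
     al c i x = al c i y) ->
  (forall (x : 'rV_n) c, (forall i, al c i x <= x ord0 i < al c i x + ga c i) ->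
     forall i, lo ord0 i <= x ord0 i <= hi ord0 i) ->
  (forall (x : 'rV_n) (A : {set T}),
     (forall c, c \in A -> forall i, al c i x <= x ord0 i < al c i x + ga c i) ->
     (#|A| <= W)%N) ->
  \sum_c \prod_i ga c i <= W%:R * \prod_i (hi ord0 i - lo ord0 i).
Proof.
move=> ga0 lohi aldep inbox mult.
pose tr (x : nat -> R) : 'rV[R]_n := \row_i x i.
pose al' c (i : nat) (x : nat -> R) := oapp (fun j => al c j (tr x)) 0 (insub i).
pose ga' c (i : nat) := oapp (ga c) 0 (insub i).
pose w' (k : nat) : R := if k == 0%N then W%:R else 0.
have w'0 k : 0 <= w' k by rewrite /w'; case: ifP; rewrite ?ler0n.
have seriesE (z : R) : 0 <= z -> (\sum_(0 <= k <oo) (w' k * z)%:E = (W%:R * z)%:E)%E.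
  move=> z0; rewrite (@nneseries_finite _ 1).
  - by rewrite big_nat1 /w' eqxx.
  - by move=> k; rewrite lee_fin mulr_ge0.
  - by move=> [//|k] _; rewrite /w'/= mul0r.
have al'E c (i : 'I_n) x : al' c i x = al c i (tr x) by rewrite /al' valK.
have ga'E c (i : 'I_n) : ga' c i = ga c i by rewrite /ga' valK.
have -> : \sum_c \prod_i ga c i = \sum_c 1 * \prod_(i < n) ga' c i.
  by apply: eq_bigr => c _; rewrite mul1r; apply: eq_bigr => i _; rewrite ga'E.
have -> : \prod_i (hi ord0 i - lo ord0 i) = \prod_(i < n) (ext hi i - ext lo i).
  by apply: eq_bigr => i _; rewrite !extE.
rewrite -lee_fin -seriesE; last first.
  by apply: prodr_ge0 => i _; rewrite !extE subr_ge0.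
apply: (@triangular_packing T n (fun=> 1) al' ga' w' (fun=> ext lo) (fun=> ext hi)) => //.
- by move=> c i; rewrite /ga'; case: insub => //=.
- by move=> _ i; rewrite /ext; case: insub => //=.
- move=> c i x y xy; rewrite /al'; case: insubP => //= j _ ji.
  by apply: aldep => k kj; rewrite !mxE xy// -ji.
- move=> x; rewrite seriesE; last exact: prod_bool_ge0.
  rewrite lee_fin.
  pose P c := [forall i : 'I_n, al c i (tr x) <= x i < al c i (tr x) + ga c i].
  have -> : \sum_(c : T) 1 * \prod_(i < n)
      (al' c i x <= x i < al' c i x + ga' c i)%R%:R = #|[set c | P c]%SET|%:R :> R.
    rewrite cardsE -sum1_card natr_sum [RHS]big_mkcond/=; apply: eq_bigr => c _.
    rewrite mul1r prod_bool /P unfold_in/=; case: ifPn => [/forallP h|/forallPn[i h]].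
      by rewrite (_ : [forall i, _] = true)//; apply/forallP => i; rewrite al'E ga'E h.
    rewrite (_ : [forall i, _] = false)//; apply/negbTE/forallPn; exists i.
    by rewrite al'E ga'E.
  have Pin c : P c -> forall i, al c i (tr x) <= tr x ord0 i < al c i (tr x) + ga c i.
    by move=> /forallP h i; rewrite mxE.
  rewrite prod_bool; have [->|[c]] := set_0Vmem [set c | P c]%SET.
    by rewrite cards0 mulr_ge0.
  rewrite inE => /Pin/inbox h.
  rewrite (_ : [forall i, _] = true) ?mulr1 ?ler_nat; last first.
    by apply/forallP => i; rewrite !extE; have := h i; rewrite mxE.
  by apply: (mult (tr x)) => c'; rewrite inE => /Pin.
Qed.

(* Reversing the coordinates turns upper into lower triangular families. *)
Lemma triangular_packing_box_rev (T : finType) (n W : nat)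
    (al : T -> 'I_n -> 'rV[R]_n -> R) (ga : T -> 'I_n -> R)
    (lo hi : 'rV[R]_n) :
  (forall c i, 0 <= ga c i) -> (forall i, lo ord0 i <= hi ord0 i) ->
  (forall c (i : 'I_n) (x y : 'rV_n), (forall j : 'I_n, (i < j)%N -> x ord0 j = y ord0 j) ->
     al c i x = al c i y) ->
  (forall (x : 'rV_n) c, (forall i, al c i x <= x ord0 i < al c i x + ga c i) ->
     forall i, lo ord0 i <= x ord0 i <= hi ord0 i) ->
  (forall (x : 'rV_n) (A : {set T}),
     (forall c, c \in A -> forall i, al c i x <= x ord0 i < al c i x + ga c i) ->
     (#|A| <= W)%N) ->
  \sum_c \prod_i ga c i <= W%:R * \prod_i (hi ord0 i - lo ord0 i).
Proof.
move=> ga0 lohi aldep inbox mult.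
pose rv (x : 'rV[R]_n) : 'rV[R]_n := \row_i x ord0 (rev_ord i).
have rvE x i : rv x ord0 i = x ord0 (rev_ord i) by rewrite mxE.
have E (F : 'I_n -> R) : \prod_i F i = \prod_i F (rev_ord i).
  exact: (reindex_inj rev_ord_inj).
have -> : \sum_c \prod_i ga c i = \sum_c \prod_i ga c (rev_ord i).
  by apply: eq_bigr => c _; rewrite -E.
have -> : \prod_i (hi ord0 i - lo ord0 i) = \prod_i (rv hi ord0 i - rv lo ord0 i).
  by rewrite E; apply: eq_bigr => i _; rewrite !rvE.
apply: (@triangular_packing_box T n W (fun c i x => al c (rev_ord i) (rv x))
  (fun c i => ga c (rev_ord i)) (rv lo) (rv hi)) => //.
- by move=> i; rewrite !rvE.
- move=> c i x y xy; apply: aldep => j ij; rewrite !rvE; apply: xy.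
  by move: ij; rewrite /=; have := ltn_ord i; have := ltn_ord j; lia.
- move=> x c h i; rewrite !rvE.
  have := inbox (rv x) c _ (rev_ord i); rewrite [rv x ord0 _]rvE rev_ordK; apply=> j.
  by have := h (rev_ord j); rewrite rev_ordK rvE.
- move=> x A h; apply: (mult (rv x)) => c cA j.
  by have := h c cA (rev_ord j); rewrite rev_ordK rvE.
Qed.

(** A lower bound on the outer measure obtained without additivity or measurability: for any
    covering of [X], disjointness bounds the sum of cell indicators by the sum of box indicators at
    every point, and [triangular_packing] with constant end points integrates this. *)
Lemma leb_outer_ge_packing (T : finType) (d : nat) (X : set 'rV[R]_d)
    (lo : T -> 'rV[R]_d) (ga : T -> 'I_d -> R) :
  (forall c i, 0 <= ga c i) ->
  (forall c (x : 'rV_d), (forall i, lo c ord0 i <= x ord0 i < lo c ord0 i + ga c i) ->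
     X x) ->
  (forall c c' (x : 'rV_d),
     (forall i, lo c ord0 i <= x ord0 i < lo c ord0 i + ga c i) ->
     (forall i, lo c' ord0 i <= x ord0 i < lo c' ord0 i + ga c' i) -> c = c') ->
  ((\sum_c \prod_i ga c i)%:E <= leb_outer X)%E.
Proof.
move=> ga0 inX disj; apply: le_ereal_inf_tmp => _ [a [b [ab Xab ->]]].
pose tr (x : nat -> R) : 'rV[R]_d := \row_i x i.
pose ga' c (i : nat) := oapp (ga c) 0 (insub i).
have ga'E c (i : 'I_d) : ga' c i = ga c i by rewrite /ga' valK.
have -> : \sum_c \prod_i ga c i = \sum_c 1 * \prod_(i < d) ga' c i.
  by apply: eq_bigr => c _; rewrite mul1r; apply: eq_bigr => i _; rewrite ga'E.
rewrite (eq_eseriesr (g := fun k => (1 * \prod_(i < d) (ext (b k) i - ext (a k) i))%:E)).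
  2: by move=> k _; rewrite mul1r; congr EFin; apply: eq_bigr => i _; rewrite !extE.
apply: (@triangular_packing T d (fun=> 1) (fun c i _ => ext (lo c) i) ga' (fun=> 1)
  (fun k => ext (a k)) (fun k => ext (b k))) => //.
- by move=> c i; rewrite /ga'; case: insub => //=.
- by move=> k i; rewrite /ext; case: insub => //=.
- move=> x.
  pose P c := [forall i : 'I_d, lo c ord0 i <= x i < lo c ord0 i + ga c i].
  have Pin c : P c -> forall i, lo c ord0 i <= tr x ord0 i < lo c ord0 i + ga c i.
    by move=> /forallP h i; rewrite mxE.
  have -> : \sum_(c : T) 1 * \prod_(i < d)
      (ext (lo c) i <= x i < ext (lo c) i + ga' c i)%R%:R = #|[set c | P c]%SET|%:R :> R.
    rewrite cardsE -sum1_card natr_sum [RHS]big_mkcond/=; apply: eq_bigr => c _.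
    rewrite mul1r prod_bool /P unfold_in/=; case: ifPn => [/forallP h|/forallPn[i h]].
      by rewrite (_ : [forall i, _] = true)//; apply/forallP => i; rewrite extE ga'E h.
    rewrite (_ : [forall i, _] = false)//; apply/negbTE/forallPn; exists i.
    by rewrite extE ga'E.
  have t0 k : (0 <= (1 * \prod_(i < d) (ext (a k) i <= x i <= ext (b k) i)%R%:R : R)%:E)%E.
    by rewrite lee_fin mul1r prod_bool_ge0.
  have [->|[c]] := set_0Vmem [set c | P c]%SET.
    by rewrite cards0; apply: nneseries_ge0 => k _ _; exact: t0.
  rewrite inE => Pc.
  have -> : #|[set c | P c]%SET| = 1%N.
    apply/eqP/cards1P; exists c; apply/setP => c'; rewrite !inE.
    apply/idP/eqP => [Pc'|->//]; exact: disj (Pin _ Pc') (Pin _ Pc).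
  (* The point lies in exactly one cell, hence in some covering box [k], whose term alone is already
     1. *)
  have [k _ xk] := Xab _ (inX _ _ (Pin _ Pc)).
  apply: (@le_trans _ _ (\sum_(0 <= j < k.+1)
      (1 * \prod_(i < d) (ext (a j) i <= x i <= ext (b j) i)%R%:R : R)%:E)%E).
    rewrite big_nat_recr//= mul1r prod_bool.
    rewrite (_ : [forall i, _] = true).
      by rewrite leeDr// sume_ge0.
    by apply/forallP => i; rewrite !extE; have := xk i; rewrite mxE.
  by apply: nneseries_lim_ge => j _ _; exact: t0.
Qed.

End Packing.

(** * Euclidean norm *)

Section EuclideanNorm.
Variables (R : realType) (d : nat).
Implicit Types x y : 'rV[R]_d.

Lemma enorm_ge0 x : 0 <= enorm x.
Proof. exact: sqrtr_ge0. Qed.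

Lemma enorm_sqr x : enorm x ^+ 2 = \sum_(i < d) x ord0 i ^+ 2.
Proof. by rewrite sqr_sqrtr// sumr_ge0// => i _; rewrite sqr_ge0. Qed.

Lemma coord_le_enorm x i : `|x ord0 i| <= enorm x.
Proof.
rewrite -sqrtr_sqr ler_sqrt; last by rewrite sumr_ge0// => k _; rewrite sqr_ge0.
by rewrite (bigD1 i)//= lerDl sumr_ge0// => k _; rewrite sqr_ge0.
Qed.

Lemma enorm_le_sum x : enorm x <= \sum_(i < d) `|x ord0 i|.
Proof.
have s0 : 0 <= \sum_(i < d) `|x ord0 i| by exact: sumr_ge0.
rewrite -(ger0_norm s0) -sqrtr_sqr ler_sqrt ?sqr_ge0//.
rewrite expr2 mulr_suml ler_sum// => i _.
rewrite -[x ord0 i ^+ 2]real_normK ?num_real// expr2 ler_wpM2l// (bigD1 i)//= lerDl.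
exact: sumr_ge0.
Qed.

(** Cauchy-Schwarz: expand the sum of the squares of [x ord0 i * b - y ord0 i * a] and divide by
    [a * b]. *)
Lemma sum_mul_le_enorm x y : \sum_(i < d) x ord0 i * y ord0 i <= enorm x * enorm y.
Proof.
set a := enorm x; set b := enorm y.
have [x0|x0] := eqVneq a 0.
  rewrite x0 mul0r big1// => i _; have := coord_le_enorm x i.
  by rewrite -/a x0 normr_le0 => /eqP ->; rewrite mul0r.
have [y0|y0] := eqVneq b 0.
  rewrite y0 mulr0 big1// => i _; have := coord_le_enorm y i.
  by rewrite -/b y0 normr_le0 => /eqP ->; rewrite mulr0.
have ab : 0 < a * b by rewrite mulr_gt0// lt0r ?x0 ?y0 enorm_ge0.
have : 0 <= \sum_(i < d) (x ord0 i * b - y ord0 i * a) ^+ 2.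
  by apply: sumr_ge0 => i _; exact: sqr_ge0.
have -> : \sum_(i < d) (x ord0 i * b - y ord0 i * a) ^+ 2 =
    (\sum_(i < d) x ord0 i ^+ 2) * b ^+ 2 + (\sum_(i < d) y ord0 i ^+ 2) * a ^+ 2
    - 2 * (a * b) * \sum_(i < d) x ord0 i * y ord0 i.
  rewrite !mulr_suml mulr_sumr -big_split/= -sumrB; apply: eq_bigr => i _; ring.
rewrite -!enorm_sqr -/a -/b => h.
rewrite -(ler_pM2l ab).
have -> : a * b * (a * b) = (a ^+ 2 * b ^+ 2 + b ^+ 2 * a ^+ 2) / 2 by field.
by lra.
Qed.

Lemma enormD x y : enorm (x + y) <= enorm x + enorm y.
Proof.
have s0 : 0 <= enorm x + enorm y by rewrite addr_ge0 ?enorm_ge0.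
rewrite -(ger0_norm s0) -sqrtr_sqr ler_sqrt ?sqr_ge0//.
rewrite sqrrD !enorm_sqr.
have -> : \sum_(i < d) (x + y) ord0 i ^+ 2 = \sum_(i < d) x ord0 i ^+ 2 +
    (\sum_(i < d) x ord0 i * y ord0 i) *+ 2 + \sum_(i < d) y ord0 i ^+ 2.
  by rewrite -sumrMnl -!big_split/=; apply: eq_bigr => i _; rewrite mxE sqrrD.
by rewrite lerD2r lerD2l lerMn2r sum_mul_le_enorm.
Qed.

Lemma enormZ (s : R) x : 0 <= s -> enorm (s *: x) = s * enorm x.
Proof.
move=> s0; rewrite -{2}(ger0_norm s0) -sqrtr_sqr -sqrtrM ?sqr_ge0//.
by rewrite mulr_sumr; congr Num.sqrt; apply: eq_bigr => i _; rewrite mxE exprMn.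
Qed.

End EuclideanNorm.

(** * Outer volume, dilations, and shells around balls and around [K] *)

Section OuterVolume.
Variable R : realType.

Lemma leb_outer_ge0 d (A : set 'rV[R]_d) : (0 <= leb_outer A)%E.
Proof.
apply: le_ereal_inf_tmp => _ [a [b [ab _ ->]]]; apply: nneseries_ge0 => k _ _.
by rewrite lee_fin; apply: prodr_ge0 => i _; rewrite subr_ge0.
Qed.

Lemma le_leb_outer d (A B : set 'rV[R]_d) : A `<=` B -> (leb_outer A <= leb_outer B)%E.
Proof.
move=> AB; apply: ereal_inf_le_tmp => _ [a [b [ab Bab ->]]].
by exists a, b; split => //; exact: subset_trans Bab.
Qed.

Lemma leb_outer_le_boxes (T : finType) n (A : set 'rV[R]_n.+1)
    (lo : T -> 'rV[R]_n.+1) (ga : T -> 'I_n.+1 -> R) :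
  (forall c i, 0 <= ga c i) ->
  (forall x, A x -> exists c, forall i, lo c ord0 i <= x ord0 i <= lo c ord0 i + ga c i) ->
  (leb_outer A <= (\sum_c \prod_i ga c i)%:E)%E.
Proof.
move=> ga0 cov.
pose hi c : 'rV[R]_n.+1 := \row_i (lo c ord0 i + ga c i).
pose a (k : nat) : 'rV[R]_n.+1 := oapp (lo \o @enum_val T T) 0 (insub k).
pose b (k : nat) : 'rV[R]_n.+1 := oapp (hi \o @enum_val T T) 0 (insub k).
have ak (k : 'I_#|T|) : a k = lo (enum_val k) by rewrite /a valK.
have bk (k : 'I_#|T|) : b k = hi (enum_val k) by rewrite /b valK.
have ab k i : a k ord0 i <= b k ord0 i.
  by rewrite /a /b; case: insub => //= c; rewrite mxE lerDl.
apply: ge_ereal_inf; exists (\sum_(0 <= k <oo) (boxvol (a k) (b k))%:E)%E.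
  exists a, b; split => // x /cov[c h]; exists (enum_rank c) => // i.
  by rewrite ak bk enum_rankK mxE h.
rewrite (@nneseries_finite _ _ #|T|).
- rewrite sumEFin lee_fin big_mkord [leRHS]big_enum_val/= ler_sum// => k _.
  by rewrite /boxvol ler_prod// => i _; rewrite ak bk mxE addrAC subrr add0r lexx andbT.
- by move=> k; rewrite lee_fin prodr_ge0// => i _; rewrite subr_ge0.
(* Beyond [#|T|] the boxes degenerate to the origin. Their volume is 0 because at least one
   coordinate exists, whence the dimension [n.+1]. *)
- move=> k kT; rewrite /boxvol /a /b insubF ?ltnNge ?kT//=.
  by rewrite (bigD1 ord0)//= subrr mul0r.
Qed.

(** Scaling a covering of [A] by [s] gives a covering of [B] whose box volumes are multiplied by
    [s ^+ n]. *)
Lemma leb_outer_scale n (A B : set 'rV[R]_n) (s : R) : 0 < s ->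
  (forall x, B x -> A (s^-1 *: x)) ->
  ((s ^- n)%:E * leb_outer B <= leb_outer A)%E.
Proof.
move=> s0 BA; apply: le_ereal_inf_tmp => _ [a [b [ab Aab ->]]].
have sn0 : 0 < s ^+ n by rewrite exprn_gt0.
rewrite muleC lee_pdivrMr// muleC -nneseriesZl; last first.
  by move=> k _; rewrite lee_fin prodr_ge0// => i _; rewrite subr_ge0.
apply: ge_ereal_inf.
exists (\sum_(0 <= k <oo) (boxvol (s *: a k) (s *: b k))%:E)%E.
  exists (fun k => s *: a k), (fun k => s *: b k); split => //.
    by move=> k i; rewrite !mxE ler_pM2l.
  move=> x /BA/Aab[k _ xk]; exists k => // i; have := xk i.
  by rewrite !mxE mulrC ler_pdivlMr// ler_pdivrMr// ![_ * s]mulrC.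
rewrite le_eqVlt; apply/orP; left; apply/eqP; apply: eq_eseriesr => k _.
rewrite -EFinM /boxvol; congr EFin.
under eq_bigr do rewrite !mxE -mulrBr.
by rewrite big_split/= prodr_const card_ord.
Qed.

Lemma leb_outer_bounded_fin n (A : set 'rV[R]_n.+1) (M : R) : 0 <= M ->
  (forall x, A x -> forall i, `|x ord0 i| <= M) ->
  (leb_outer A <= ((2 * M) ^+ n.+1)%:E)%E.
Proof.
move=> M0 AM.
have := @leb_outer_le_boxes unit n A (fun=> const_mx (- M)) (fun _ _ => 2 * M).
rewrite big_const/= card_unit/= addr0 prodr_const card_ord; apply.
  by move=> _ _; rewrite mulr_ge0.
move=> x /AM h; exists tt => i; rewrite mxE.
by have := h i; rewrite ler_norml; lra.
Qed.

(** [volume] is [fine] of the outer measure, so inequalities pass to it only once finiteness is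
    known; boundedness provides it. *)
Lemma leb_outer_fin_num n (A : set 'rV[R]_n.+1) (M : R) :
  (forall x, A x -> forall i, `|x ord0 i| <= M) -> leb_outer A \is a fin_num.
Proof.
move=> AM; have AM' x : A x -> forall i, `|x ord0 i| <= Num.max M 0.
  by move=> Ax i; rewrite le_max AM.
rewrite ge0_fin_numE ?leb_outer_ge0//.
apply: le_lt_trans (leb_outer_bounded_fin _ AM') (ltry _).
by rewrite le_max lexx orbT.
Qed.

Lemma volume_eball_scale n (r s : R) : 0 < s ->
  volume (@eball R n.+1 0 (s * r)) <= s ^+ n.+1 * volume (@eball R n.+1 0 r).
Proof.
move=> s0.
have fin q : leb_outer (@eball R n.+1 0 q) \is a fin_num.
  apply: (@leb_outer_fin_num _ _ q) => x; rewrite /eball/= subr0 => xq i.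
  exact: le_trans (coord_le_enorm _ _) xq.
rewrite -ler_pdivrMl ?exprn_gt0// -lee_fin EFinM !fineK//.
apply: leb_outer_scale => // x; rewrite /eball/= !subr0 => h.
by rewrite enormZ ?invr_ge0 ?(ltW s0)// ler_pdivrMl.
Qed.

Lemma volume_le n (A B : set 'rV[R]_n.+1) (M : R) : A `<=` B ->
  (forall x, B x -> forall i, `|x ord0 i| <= M) -> volume A <= volume B.
Proof.
move=> AB BM; rewrite -lee_fin !fineK; last 2 first.
- exact: leb_outer_fin_num BM.
- by apply: (@leb_outer_fin_num _ _ M) => x /AB; exact: BM.
exact: le_leb_outer.
Qed.

Lemma exp1D_le (m : nat) (y : R) : 0 <= y <= 1 ->
  (1 + y) ^+ m - 1 <= m%:R * 2 ^+ m * y.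
Proof.
move=> /andP[y0 y1]; elim: m => [|m IH]; first by rewrite expr0 subrr !mul0r.
have h : (1 + y) ^+ m <= 2 ^+ m by rewrite lerXn2r ?nnegrE; lra.
rewrite exprS mulrDl mul1r -addrAC.
apply: le_trans (lerD IH (ler_wpM2l y0 h)) _.
have p0 : 0 <= 2 ^+ m * y :> R by rewrite mulr_ge0// exprn_ge0.
have m0 : 0 <= m%:R * (2 ^+ m * y) by rewrite mulr_ge0.
rewrite -[m.+1%:R]natr1 exprS; have -> : (m%:R + 1) * (2 * 2 ^+ m) * y =
  2 * (m%:R * (2 ^+ m * y)) + 2 * (2 ^+ m * y) by ring.
by rewrite -mulrA (mulrC y); lra.
Qed.

(** The thickened ball lies in the ball dilated by 1 + t/r. One factor 2^(n+1) comes from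
    linearising the power in [exp1D_le], the other from enclosing the ball in a cube; such a crude
    constant spares computing the area of the sphere. *)
Lemma volume_eball_shell n (r t : R) : 0 < t <= r ->
  volume (parallel_body (@eball R n.+1 0 r) t) - volume (@eball R n.+1 0 r) <=
  t * ((n.+1)%:R * 4 ^+ n.+1 * r ^+ n).
Proof.
move=> /andP[t0 tr]; have r0 : 0 < r by exact: lt_le_trans tr.
set v := volume (@eball R n.+1 0 r).
have v0 : 0 <= v by rewrite fine_ge0 ?leb_outer_ge0.
have sub : parallel_body (@eball R n.+1 0 r) t `<=` @eball R n.+1 0 (r + t).
  move=> x [y]; rewrite /eball/= !subr0 => yr xyt.
  by have := enormD y (x - y); rewrite addrC subrK; lra.
have bd x : @eball R n.+1 0 (r + t) x -> forall i, `|x ord0 i| <= r + t.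
  by rewrite /eball/= subr0 => xr i; exact: le_trans (coord_le_enorm _ _) xr.
have h1 := volume_le sub bd.
have y01 : 0 <= t / r <= 1 by rewrite divr_ge0 ?(ltW t0) ?(ltW r0)//= ler_pdivrMr// mul1r.
have := @volume_eball_scale n r (1 + t / r) ltac:(lra).
have -> : (1 + t / r) * r = r + t by field; rewrite gt_eqF.
have := ler_wpM2r v0 (exp1D_le n.+1 y01).
have vr : v <= (2 * r) ^+ n.+1.
  rewrite -lee_fin fineK; last first.
    apply: (@leb_outer_fin_num _ _ r) => x; rewrite /eball/= subr0 => xr i.
    exact: le_trans (coord_le_enorm _ _) xr.
  apply: leb_outer_bounded_fin; first exact: ltW.
  by move=> x; rewrite /eball/= subr0 => xr i; exact: le_trans (coord_le_enorm _ _) xr.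
rewrite -/v => h2 h3.
have h4 : n.+1%:R * 2 ^+ n.+1 * (t / r) * v <= n.+1%:R * 2 ^+ n.+1 * (t / r) * (2 * r) ^+ n.+1.
  by rewrite ler_wpM2l// !mulr_ge0 ?exprn_ge0 ?invr_ge0 ?(ltW t0) ?(ltW r0).
have -> : t * (n.+1%:R * 4 ^+ n.+1 * r ^+ n) =
    n.+1%:R * 2 ^+ n.+1 * (t / r) * (2 * r) ^+ n.+1.
  have -> : (4 : R) = 2 * 2 by ring.
  rewrite !exprMn [r ^+ n.+1]exprS; field; rewrite gt_eqF//.
by lra.
Qed.

(** The surface area of [K] equals that of a ball of radius D/2, which [volume_eball_shell] bounds
    in the limit. A single thickness [t0] is later fixed, so a limit statement is converted into an
    inequality for all small [t]. *)
Lemma shell_quotient n (K : set 'rV[R]_n.+1) (D : R) : surface_diameter K D ->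
  exists t0, 0 < t0 /\ forall t, 0 < t <= t0 ->
    volume (parallel_body K t) - volume K <= t * ((n.+1%:R * 4 ^+ n.+1 + 1) * D ^+ n).
Proof.
move=> [D0 [S [SK SB]]].
have D20 : 0 < D / 2 by rewrite divr_gt0.
have SD : S <= n.+1%:R * 4 ^+ n.+1 * D ^+ n.
  apply: (@le_trans _ _ (n.+1%:R * 4 ^+ n.+1 * (D / 2) ^+ n)); last first.
    rewrite ler_wpM2l ?mulr_ge0 ?exprn_ge0//.
    by rewrite lerXn2r ?nnegrE ?ltW// ltr_pdivrMr// ltr_pMr// ltr1n.
  apply: (cvgr_to_le SB); near=> t.
  rewrite ler_pdivrMr; last by near: t; exact: nbhs_right_gt.
  rewrite [leRHS]mulrC; apply: volume_eball_shell; apply/andP; split.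
    by near: t; exact: nbhs_right_gt.
  by near: t; exact: nbhs_right_le.
have Dn0 : 0 < D ^+ n by rewrite exprn_gt0.
(* The slack [D ^+ n] makes the bound strict in the limit; it accounts for the [+ 1] in the
   constant. *)
have : \forall t \near 0^'+, (volume (parallel_body K t) - volume K) / t <= S + D ^+ n.
  by apply: (cvgr_le S SK); rewrite ltrDl.
move=> [t0 /= t00 H]; exists (t0 / 2); split; first by rewrite divr_gt0.
move=> t /andP[tp tt0].
have /H : ball_ Num.norm 0 t0 t.
  by rewrite /ball_/= sub0r normrN gtr0_norm//; lra.
move=> /(_ tp); rewrite ler_pdivrMr// => /le_trans; apply.
by rewrite [leLHS]mulrC ler_wpM2l ?(ltW tp)// mulrDl mul1r lerD2r.
Unshelve. all: by end_near. Qed.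

End OuterVolume.

(** * LDL factorisation of positive definite matrices *)

Section LDL.
Variable R : realFieldType.

(** Induction through the Schur complement of the corner entry. The inverse [G] of [B] is built
    alongside because domain cells are cut out by [B] and image cells by [G], and both must be unit
    upper triangular. *)
Lemma pos_def_LDL n (A : 'M[R]_n) : A^T = A ->
  (forall v : 'rV[R]_n, v != 0 -> 0 < (v *m A *m v^T) ord0 ord0) ->
  exists (B G : 'M[R]_n) (D : 'rV[R]_n),
    [/\ A = B^T *m diag_mx D *m B, B *m G = 1%:M,
        forall i : 'I_n, 0 < D ord0 i,
        forall i j : 'I_n, (j < i)%N -> B i j = 0 /\ G i j = 0 &
        forall i : 'I_n, B i i = 1 /\ G i i = 1].
Proof.
elim: n A => [|n IH] A Asym Apos.
  by exists 0, 0, 0; split; try (by apply/matrixP => -[]); case.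
pose a := @ulsubmx R 1 n 1 n A; pose b := @ursubmx R 1 n 1 n A.
pose b' := @dlsubmx R 1 n 1 n A; pose C := @drsubmx R 1 n 1 n A.
have AE : A = block_mx a b b' C by rewrite [RHS](@submxK _ 1 n 1 n).
move: Asym Apos; rewrite {}AE => Asym Apos.
have [_ b'b _ Csym] := eq_block_mx (etrans (esym (tr_block_mx a b b' C)) Asym).
have {}Apos : forall v : 'rV[R]_(1 + n), v != 0 ->
  0 < (v *m block_mx a b b' C *m v^T) ord0 ord0 := Apos.
have {}b'b : b' = b^T by rewrite -b'b trmxK.
pose al := a ord0 ord0.
have aE : a = al%:M by rewrite [LHS]mx11_scalar.
have al0 : 0 < al.
  have /Apos : row_mx 1 0 != 0 :> 'rV[R]_(1 + n).
    by apply/eqP => /matrixP/(_ ord0 (lshift n ord0))/eqP; rewrite row_mxEl !mxE oner_eq0.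
  rewrite mul_row_block tr_row_mx mul_row_col !mul1mx !mul0mx trmx0 mulmx0 !addr0.
  by rewrite trmx1 mulmx1.
pose C' : 'M[R]_n := C - al^-1 *: (b^T *m b).
have C'sym : C'^T = C'.
  by rewrite /C' linearB/= linearZ/= trmx_mul trmxK Csym.
have C'pos (v : 'rV[R]_n) : v != 0 -> 0 < (v *m C' *m v^T) ord0 ord0.
  (* [w] minimises the form over the first coordinate with [v] fixed; there the form of [A] equals
     that of the Schur complement. *)
  move=> v0; pose w : 'rV[R]_1 := - al^-1 *: (v *m b^T).
  have /Apos : row_mx w v != 0 :> 'rV[R]_(1 + n).
    by apply: contra_neq v0 => /eqP; rewrite -row_mx0 => /eqP/eq_row_mx[].
  rewrite mul_row_block tr_row_mx mul_row_col aE b'b.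
  rewrite mul_mx_scalar {1}/w scalerA mulrN divff ?gt_eqF// scaleN1r addNr mul0mx add0r.
  rewrite (_ : w *m b + v *m C = v *m C')// /w /C' mulmxBr addrC -scalemxAl -mulmxA.
  by rewrite scaleNr scalemxAr.
have [B [G [D [CE BG D0 tri diag]]]] := IH C' C'sym C'pos.
pose B1 : 'M[R]_(1 + n) := block_mx 1%:M (al^-1 *: b) 0 B.
pose G1 : 'M[R]_(1 + n) := block_mx 1%:M (- (al^-1 *: b *m G)) 0 G.
pose D1 : 'rV[R]_(1 + n) := row_mx al%:M D.
exists B1, G1, D1; change (n.+1) with (1 + n)%N; split.
- rewrite diag_mx_row tr_block_mx !mulmx_block.
  rewrite !(mulmx0, mul0mx, addr0, add0r, trmx0, trmx1, mul1mx, mulmx1).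
  have -> : diag_mx (al%:M : 'rV_1) = al%:M by apply/matrixP => i j; rewrite !ord1 !mxE.
  have e1 : al%:M *m (al^-1 *: b) = b.
    by rewrite mul_scalar_mx scalerA divff ?gt_eqF// scale1r.
  have e2 : (al^-1 *: b)^T *m al%:M = b^T.
    by rewrite mul_mx_scalar linearZ/= scalerA divff ?gt_eqF// scale1r.
  by rewrite e1 e2 aE b'b -CE /C' -scalemxAr addrC subrK.
- rewrite mulmx_block !(mulmx0, mul0mx, addr0, add0r, mul1mx, mulmx1) BG.
  by rewrite addNr [RHS]scalar_mx_block.
- move=> i; rewrite -(splitK i); case: (fintype.split i) => k /=.
    by rewrite /D1 (row_mxEl (al%:M : 'rV_1)) mxE (ord1 k).
  by rewrite /D1 row_mxEr.
- move=> i j; rewrite -(splitK i) -(splitK j).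
  case: (fintype.split i) => k; case: (fintype.split j) => l //=.
  + by rewrite !ord1.
  + by rewrite ord1.
  + by move=> _; rewrite /B1 /G1 !block_mxEdl !mxE.
  + by rewrite ltn_add2l => /tri; rewrite /B1 /G1 !block_mxEdr.
- move=> i; rewrite -(splitK i); case: (fintype.split i) => k /=.
    by rewrite /B1 /G1 !block_mxEul !ord1 !mxE.
  by rewrite /B1 /G1 !block_mxEdr.
Qed.

End LDL.

(** * Mean value estimates and symmetry of second derivatives *)

Section Calculus.
Variable R : realType.

Lemma derivable_translate (V : normedModType R) (f : V -> R) (a z v : V) :
  derivable f (z + a) v -> derivable (fun y => f (y + a)) z v.
Proof.
move=> df; apply: (eq_ind _ (fun g => cvg (g @ 0^')) df); apply/funext => h /=.
by rewrite -!addrA.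
Qed.

Lemma derive_translate (V : normedModType R) (f : V -> R) (a z v : V) :
  'D_v (fun y => f (y + a)) z = 'D_v f (z + a).
Proof.
apply: (f_equal (fun g : R -> R => lim (g @ 0^'))); apply/funext => h /=.
by rewrite -!addrA.
Qed.

Lemma derivable_line (V : normedModType R) (f : V -> R) (z v : V) (s : R) :
  derivable f (z + s *: v) v -> derivable (fun t : R => f (z + t *: v)) s 1.
Proof.
move=> df; apply: (eq_ind _ (fun g => cvg (g @ 0^')) df); apply/funext => h /=.
by rewrite [h *: 1]mulr1 scalerDl addrCA.
Qed.

Lemma derive_line (V : normedModType R) (f : V -> R) (z v : V) (s : R) :
  'D_1 (fun t : R => f (z + t *: v)) s = 'D_v f (z + s *: v).
Proof.
apply: (f_equal (fun g : R -> R => lim (g @ 0^'))); apply/funext => h /=.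
by rewrite [h *: 1]mulr1 scalerDl addrCA.
Qed.

Lemma MVT_line (V : normedModType R) (f : V -> R) (z v : V) (h : R) :
  (forall s, `|s| <= `|h| -> derivable f (z + s *: v) v) ->
  exists2 s, `|s| <= `|h| & f (z + h *: v) - f z = h * 'D_v f (z + s *: v).
Proof.
move=> df; pose g (t : R) := f (z + t *: v).
have g0 : f z = g 0 by rewrite /g scale0r addr0.
have H a b : a <= b -> `|a| <= `|h| -> `|b| <= `|h| ->
    exists2 c, `|c| <= `|h| & g b - g a = 'D_v f (z + c *: v) * (b - a).
  move=> ab ah bh.
  have inh c : c \in `[a, b] -> `|c| <= `|h|.
    rewrite in_itv/= => /andP[ac cb]; move: ah bh; rewrite !ler_norml; lra.
  have dg c : c \in `[a, b] -> derivable g c 1.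
    by move=> /inh/df; exact: derivable_line.
  have ig x : x \in `]a, b[%R -> is_derive x 1 g ('D_v f (z + x *: v)).
    move=> xab; apply: DeriveDef; last exact: derive_line.
    by apply: dg; apply: subset_itv_oo_cc.
  have [c cab E] := MVT_segment ab ig (derivable_within_continuous dg).
  by exists c => //; exact: inh.
have n0 : `|0 : R| <= `|h| by rewrite normr0.
have [h0|/ltW h0] := leP 0 h.
  by have [c ch E] := H _ _ h0 n0 (lexx _); exists c => //; rewrite g0 -/(g h) E subr0 mulrC.
have [c ch E] := H _ _ h0 (lexx _) n0; exists c => //.
by rewrite g0 -/(g h) -opprB E sub0r mulrN opprK mulrC.
Qed.

Variable d : nat.
Notation V := 'rV[R]_d.

Lemma coord_le_norm (x : V) i : `|x ord0 i| <= `|x|.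
Proof.
by rewrite [leRHS]/Num.norm /= mx_normrE; apply/bigmax_geP; right => /=; exists (ord0, i).
Qed.

Lemma norm_le_coord (x : V) (e : R) : 0 <= e -> (forall i, `|x ord0 i| <= e) -> `|x| <= e.
Proof.
move=> e0 xe; rewrite [leLHS]/Num.norm /= mx_normrE; apply/bigmax_leP; split => //= i _.
by rewrite (ord1 i.1).
Qed.

Lemma norm_lt_coord (x : V) (e : R) : 0 < e -> (forall i, `|x ord0 i| < e) -> `|x| < e.
Proof.
move=> e0 xe; rewrite [ltLHS]/Num.norm /= mx_normrE; apply/bigmax_ltP; split => //= i _.
by rewrite (ord1 i.1).
Qed.

Lemma norm_evec (i : 'I_d) : `|evec R i| <= 1.
Proof.
apply: norm_le_coord => // k; rewrite mxE eqxx/=.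
by case: eqP; rewrite ?normr1 ?normr0.
Qed.

Lemma continuous_near (f : V -> R) (x : V) (e : R) : {for x, continuous f} -> 0 < e ->
  exists2 r, 0 < r & forall y, `|y - x| < r -> `|f y - f x| < e.
Proof.
move=> cf e0.
have : \forall y \near x, `|f x - f y| < e by move/cvgrPdist_lt: cf => /(_ e e0).
rewrite -nbhs_nearE -filter_from_ballE => -[r r0 H]; exists r => // y yx.
by rewrite distrC; apply: H; rewrite -ball_normE/= distrC.
Qed.

Lemma open_ball (U : set V) (x : V) : open U -> U x ->
  exists2 r : R, 0 < r & forall y, `|y - x| < r -> U y.
Proof.
move=> oU Ux; have := open_nbhs_nbhs (conj oU Ux).
rewrite -filter_from_ballE => -[r r0 H]; exists r => // y yx.
by apply: H; rewrite -ball_normE/= distrC.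
Qed.

Lemma strict_differentiability (U : set V) (f : V -> R) (x0 : V) (e : R) :
  open U -> U x0 -> (forall i x, U x -> derivable f x (evec R i)) ->
  (forall i, {for x0, continuous (partial i f)}) -> 0 < e ->
  exists2 r, 0 < r & forall x y, `|x - x0| < r -> `|y - x0| < r ->
    `|f x - f y - \sum_l partial l f x0 * (x - y) ord0 l| <=
    e * \sum_l `|(x - y) ord0 l|.
Proof.
move=> oU Ux0 df cf e0; have [r1 r10 r1U] := open_ball oU Ux0.
have /choice[rr rrP] (i : 'I_d) : exists r, 0 < r /\
    forall y, `|y - x0| < r -> `|partial i f y - partial i f x0| < e.
  by have [r r0 H] := continuous_near (cf i) e0; exists r.
pose r := \big[Num.min/r1]_i rr i.
have r0 : 0 < r.
  rewrite /r; elim/big_ind: _ => // [u v u0 v0|i _]; first by rewrite lt_min u0.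
  by have [] := rrP i.
have rr1 : r <= r1 by exact: bigmin_le_id.
have rri i : r <= rr i by exact: bigmin_le_cond.
have r30 : 0 < r / 3 by rewrite divr_gt0.
exists (r / 3) => // x y xr yr.
pose z (k : nat) : V := \row_i (if (i < k)%N then x ord0 i else y ord0 i).
(* The path from [y] to [x] replaces one coordinate at a time, so each increment is a mean value
   along an axis and only partial derivatives occur. With radius r/3 the intermediate points stay
   within [r] of [x0]. *)
have z0 : z 0%N = y by apply/rowP => i; rewrite mxE.
have zd : z d = x by apply/rowP => i; rewrite mxE ltn_ord.
have zS (k : 'I_d) : z k.+1 = z k + (x - y) ord0 k *: evec R k.
  apply/rowP => i; rewrite !mxE eqxx/= ltnS leq_eqVlt.
  have [->|ik] := eqVneq i k.
    by rewrite eqxx ltnn mulr1 addrC subrK.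
  by rewrite val_eqE (negbTE ik) mulr0 addr0 orFb.
have zr k : `|z k - x0| < r / 3.
  apply: norm_lt_coord => // i; rewrite !mxE; case: ifP => _.
    by apply: le_lt_trans xr; have := coord_le_norm (x - x0) i; rewrite !mxE.
  by apply: le_lt_trans yr; have := coord_le_norm (y - x0) i; rewrite !mxE.
have inr (k : 'I_d) s : `|s| <= `|(x - y) ord0 k| -> `|z k + s *: evec R k - x0| < r.
  move=> sxy; rewrite addrAC.
  have sr : `|s *: evec R k| <= `|x - x0| + `|y - x0|.
    rewrite normrZ; apply: le_trans (_ : `|s| * 1 <= _).
      by rewrite ler_wpM2l// norm_evec.
    rewrite mulr1; apply: le_trans sxy _; apply: le_trans (coord_le_norm _ _) _.
    have -> : x - y = (x - x0) - (y - x0) by rewrite opprB addrA subrK.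
    exact: ler_normB.
  have := ler_normD (z k - x0) (s *: evec R k); have := zr k; lra.
have step (k : 'I_d) : exists2 w, `|w - x0| < r &
    f (z k.+1) - f (z k) = (x - y) ord0 k * partial k f w.
  have [s sle E] := @MVT_line V f (z k) (evec R k) ((x - y) ord0 k)
    (fun s sle => df _ _ (r1U _ (lt_le_trans (inr k s sle) rr1))).
  by exists (z k + s *: evec R k); [exact: inr|rewrite zS].
have tel : f x - f y = \sum_(k < d) (f (z k.+1) - f (z k)).
  by rewrite -(big_mkord xpredT (fun k => f (z k.+1) - f (z k))) telescope_sumr// zd z0.
rewrite tel -sumrB mulr_sumr; apply: le_trans (ler_norm_sum _ _ _) _.
apply: ler_sum => k _; have [w wr ->] := step k.
rewrite (mulrC ((x - y) ord0 k)) -mulrBl normrM ler_wpM2r//.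
by have [_ H] := rrP k; apply/ltW/H; exact: lt_le_trans (rri k).
Qed.

(** The mean value theorem is applied along [i] to the increment [phi] of [f] in direction [j], then
    along [j] to the partial derivative [partial i f]. *)
Lemma second_difference (U : set V) (f : V -> R) (x : V) (i j : 'I_d) (s r : R) :
  (forall y, `|y - x| < r -> U y) ->
  (forall k y, U y -> derivable f y (evec R k)) ->
  (forall y, U y -> derivable (partial i f) y (evec R j)) ->
  0 < s -> 2 * s < r ->
  exists2 w, `|w - x| < r &
    (f (x + s *: evec R i + s *: evec R j) - f (x + s *: evec R i)) -
    (f (x + s *: evec R j) - f x) = s * (s * partial j (partial i f) w).
Proof.
move=> rU df ddf s0 sr.
have bd (t u : R) k l : `|t| <= s -> `|u| <= s ->
    `|x + t *: evec R k + u *: evec R l - x| < r.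
  move=> ts us.
  have -> (p q : V) : x + p + q - x = p + q by rewrite addrC !addrA addNr add0r.
  apply: le_lt_trans (ler_normD _ _) _; rewrite !normrZ.
  have := norm_evec k; have := norm_evec l => h1 h2.
  have : `|t| * `|evec R k| <= s * 1 by rewrite ler_pM.
  have : `|u| * `|evec R l| <= s * 1 by rewrite ler_pM.
  lra.
have ns : `|s| = s by rewrite gtr0_norm.
pose phi y := f (y + s *: evec R j) - f y.
have dphi t : `|t| <= `|s| -> derivable phi (x + t *: evec R i) (evec R i).
  rewrite ns => ts; apply: derivableB.
    by apply: derivable_translate; apply: df; apply: rU; apply: bd => //; rewrite ns.
  apply: df; apply: rU; have := bd t 0 i i ts; rewrite normr0 scale0r addr0; apply.
  exact: ltW.
have [t ts E] := MVT_line dphi.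
rewrite ns in ts.
have [u us E2] := @MVT_line V (partial i f) (x + t *: evec R i) (evec R j) s
  (fun u us => ddf _ (rU _ (bd t u i j ts (le_trans us (eq_ind_r (fun q => q <= s) (lexx s) ns))))).
exists (x + t *: evec R i + u *: evec R j).
  by apply: bd => //; rewrite -ns.
rewrite -/(phi _) -/(phi x) E; congr (_ * _).
rewrite deriveB.
- by rewrite derive_translate; exact: E2.
- by apply: derivable_translate; apply: df; apply: rU; apply: bd => //; rewrite ns.
- apply: df; apply: rU; have := bd t 0 i i ts; rewrite normr0 scale0r addr0; apply.
  exact: ltW.
Qed.

Lemma partial_sym (U : set V) (f : V -> R) (x : V) (i j : 'I_d) :
  open U -> U x -> C2_on U f ->
  partial j (partial i f) x = partial i (partial j f) x.
Proof.
move=> oU Ux [_ [C1 C2]].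
have [r r0 rU] := open_ball oU Ux.
have cont k l : {for x, continuous (partial l (partial k f))}.
  have [_] := C2 k l; rewrite continuous_open_subspace// => /(_ x); apply.
  exact: mem_set.
apply/eqP; rewrite -subr_eq0 -normr_le0; apply/ler_addgt0Pr => e e0; rewrite add0r.
have e20 : 0 < e / 2 by rewrite divr_gt0.
have [r1 r10 H1] := continuous_near (cont i j) e20.
have [r2 r20 H2] := continuous_near (cont j i) e20.
pose q := Num.min r (Num.min r1 r2).
have q0 : 0 < q by rewrite !lt_min r0 r10.
have qU y : `|y - x| < q -> U y.
  by move=> yq; apply: rU; apply: lt_le_trans yq _; rewrite ge_min lexx.
have s0 : 0 < q / 3 by rewrite divr_gt0.
have sq : 2 * (q / 3) < q by lra.
have df k y : U y -> derivable f y (evec R k) by have [H _] := C1 k; exact: H.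
have [w wq E] := second_difference qU df (C2 i j).1 s0 sq.
have [w' w'q E'] := second_difference qU df (C2 j i).1 s0 sq.
(* The second difference is symmetric in [i] and [j], so it equals both mixed derivatives, taken at
   two points near [x]; continuity then identifies them at [x]. *)
have : partial j (partial i f) w = partial i (partial j f) w'.
  apply: (mulfI (lt0r_neq0 s0)); apply: (mulfI (lt0r_neq0 s0)).
  have sw (a b c e' : R) : a - b - (c - e') = a - c - (b - e') by ring.
  refine (etrans (esym E) (etrans _ E')).
  rewrite [x + _ *: evec R i + _]addrAC; exact: sw.
have close (a b p t : R) : `|a - p| < e / 2 -> `|b - t| < e / 2 -> a = b ->
    `|p - t| <= e.
  by move=> + + ab; rewrite ab !ltr_norml ler_norml; lra.
by apply: close; [apply: H1; apply: lt_le_trans wq _|apply: H2; apply: lt_le_trans w'q _];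
  rewrite !ge_min !lexx !orbT.
Qed.

End Calculus.

Lemma half_scale_lt (R : realFieldType) (r a : R) : 0 < r -> 0 <= a ->
  r / (a + 1) / 2 * a < r.
Proof.
move=> r0 a0; rewrite -subr_gt0.
have -> : r - r / (a + 1) / 2 * a = r * (a + 2) / (2 * (a + 1)).
  by field; rewrite gt_eqF// ltr_wpDl.
by rewrite divr_gt0// mulr_gt0//; lra.
Qed.

(** * Inner product *)

Section Dot.
Variables (R : realType) (d : nat).
Implicit Types x y z : 'rV[R]_d.

Definition dot x y : R := \sum_(i < d) x ord0 i * y ord0 i.

Lemma dotC x y : dot x y = dot y x.
Proof. by apply: eq_bigr => i _; rewrite mulrC. Qed.

Lemma dotDl x y z : dot (x + y) z = dot x z + dot y z.
Proof. by rewrite -big_split; apply: eq_bigr => i _; rewrite mxE mulrDl. Qed.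

Lemma dotZl (s : R) x y : dot (s *: x) y = s * dot x y.
Proof. by rewrite mulr_sumr; apply: eq_bigr => i _; rewrite mxE mulrA. Qed.

Lemma dotNl x y : dot (- x) y = - dot x y.
Proof. by rewrite -scaleN1r dotZl mulN1r. Qed.

Lemma dotBl x y z : dot (x - y) z = dot x z - dot y z.
Proof. by rewrite dotDl dotNl. Qed.

Lemma dotZr (s : R) x y : dot x (s *: y) = s * dot x y.
Proof. by rewrite dotC dotZl dotC. Qed.

Lemma dotDr x y z : dot x (y + z) = dot x y + dot x z.
Proof. by rewrite dotC dotDl dotC (dotC z). Qed.

Lemma dotBr x y z : dot x (y - z) = dot x y - dot x z.
Proof. by rewrite dotC dotBl dotC (dotC z). Qed.

Lemma dot_ge0 x : 0 <= dot x x.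
Proof. by apply: sumr_ge0 => i _; rewrite -expr2 sqr_ge0. Qed.

Lemma dot_eq0 x : dot x x <= 0 -> x = 0.
Proof.
move=> x0; have /eqP : dot x x = 0 by apply/eqP; rewrite eq_le x0 dot_ge0.
rewrite psumr_eq0 => [|i _]; last by rewrite -expr2 sqr_ge0.
move=> /allP h; apply/rowP => i; rewrite mxE; apply/eqP.
by have := h i (mem_index_enum _); rewrite /= mulf_eq0 orbb.
Qed.

Lemma le_dot x y : `|dot x y| <= `|y| * \sum_l `|x ord0 l|.
Proof.
apply: le_trans (ler_norm_sum _ _ _) _; rewrite mulr_sumr; apply: ler_sum => i _.
by rewrite normrM mulrC ler_wpM2r// coord_le_norm.
Qed.

End Dot.

(** * Normal cone and gradient of a defining function *)

Section Normals.
Variables (R : realType) (n : nat).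
Notation V := 'rV[R]_n.+1.
Variable K : set V.

(** [q] is an element of the normal cone of [K] at [x]. Its scale is left free because each class of
    normals later fixes one coordinate instead of the length. *)
Definition supports (x q : V) : Prop := K x /\ forall z, K z -> dot (z - x) q <= 0.

Lemma supports_monotone x y p q : supports x p -> supports y q ->
  0 <= dot (x - y) (p - q).
Proof.
move=> [Kx hx] [Ky hy]; rewrite dotBr.
have := hx _ Ky; have := hy _ Kx; rewrite -[y - x]opprB dotNl; lra.
Qed.

Definition grad (f : V -> R) (x : V) : V := \row_i partial i f x.

Lemma C2_strict_differentiability (U : set V) (f : V -> R) (x : V) (e : R) :
  open U -> U x -> C2_on U f -> 0 < e ->
  exists2 r, 0 < r & forall y z, `|y - x| < r -> `|z - x| < r ->
    `|f y - f z - dot (grad f x) (y - z)| <= e * \sum_l `|(y - z) ord0 l|.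
Proof.
move=> oU Ux [_ [C1 _]] e0.
have [||r r0 H] := strict_differentiability oU Ux _ _ e0 (f := f).
- by move=> i y Uy; have [h _] := C1 i; exact: h.
- move=> i; have [_] := C1 i; rewrite continuous_open_subspace// => /(_ x); apply.
  exact: mem_set.
exists r => // y z yr zr; have := H y z yr zr.
have -> // : \sum_l partial l f x * (y - z) ord0 l = dot (grad f x) (y - z).
by apply: eq_bigr => l _; rewrite [grad f x _ _]mxE.
Qed.

Lemma C2_diff (U : set V) (f : V -> R) (x : V) (e : R) :
  open U -> U x -> C2_on U f -> 0 < e ->
  exists2 r, 0 < r & forall v, `|v| < r -> U (x + v) /\
    `|f (x + v) - f x - dot (grad f x) v| <= e * \sum_l `|v ord0 l|.
Proof.
move=> oU Ux cf e0; have [r r0 H] := C2_strict_differentiability oU Ux cf e0.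
have [r1 r10 H1] := open_ball oU Ux.
exists (Num.min r r1) => [|v]; first by rewrite lt_min r0.
rewrite lt_min => /andP[vr vr1].
have xv : x + v - x = v by rewrite addrC addKr.
split; first by apply: H1; rewrite xv.
by have := H (x + v) x; rewrite xv subrr normr0; exact.
Qed.

(** Every direction with negative slope along the gradient enters [K], so it pairs nonpositively
    with [q]. Applied to [q] minus suitable multiples of the gradient, this yields the reverse
    Cauchy-Schwarz inequality [bq], which forces proportionality. *)
Lemma normal_unique (U : set V) (f : V -> R) (x q : V) :
  open U -> U x -> C2_on U f -> K `&` U = [set y | U y /\ f y <= 0] ->
  supports x q -> grad f x != 0 -> exists2 c, 0 <= c & q = c *: grad f x.
Proof.
move=> oU Ux cf KU [Kx hq] g0; set g := grad f x.
have fx0 : f x <= 0 by have : (K `&` U) x by []; rewrite KU => -[].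
have G0 : 0 < dot g g.
  by rewrite lt0r dot_ge0 andbT; apply: contra g0 => /eqP h; apply/eqP/dot_eq0; rewrite -/g h.
have key w : dot g w < 0 -> dot w q <= 0.
  move=> gw; pose w1 := \sum_l `|w ord0 l|.
  have w10 : 0 <= w1 by exact: sumr_ge0.
  have e0 : 0 < - dot g w / (w1 + 1) by rewrite divr_gt0 ?oppr_gt0// ltr_wpDl.
  have [r r0 H] := C2_diff oU Ux cf e0.
  pose s := r / (`|w| + 1) / 2.
  have wp : 0 < `|w| + 1 by rewrite ltr_wpDl.
  have s0 : 0 < s by rewrite !divr_gt0.
  have sr : `|s *: w| < r.
    by rewrite normrZ gtr0_norm// half_scale_lt.
  have [Us] := H _ sr.
  have -> : \sum_l `|(s *: w) ord0 l| = s * w1.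
    by rewrite mulr_sumr; apply: eq_bigr => l _; rewrite mxE normrM gtr0_norm.
  rewrite dotZr -/g ler_norml => /andP[_ hf].
  have hs : s * dot g w + - dot g w / (w1 + 1) * (s * w1) <= 0.
    rewrite [X in X <= _](_ : _ = s * (dot g w / (w1 + 1))).
      by rewrite pmulr_rle0// pmulr_lle0 ?invr_gt0 ?ltr_wpDl// ltW.
    by field; rewrite gt_eqF// ltr_wpDl.
  have : (K `&` U) (x + s *: w) by rewrite KU; split => //; lra.
  move=> [/hq + _]; rewrite addrC addKr dotZl pmulr_rle0//.
pose b := dot q g.
have bq : dot g g * dot q q <= b ^+ 2.
  apply/ler_addgt0Pr => e e0.
  pose k := e / (`|b| + 1).
  have b1 : 0 < `|b| + 1 by rewrite ltr_wpDl.
  have k0 : 0 < k by rewrite divr_gt0.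
  (* This direction pairs with the gradient to [- k], which is negative, as [key] requires; letting
     [k] tend to 0 gives [bq]. *)
  have := key (q - ((b + k) / dot g g) *: g).
  rewrite dotBr dotZr dotBl dotZl -(dotC q g) -/b mulfVK ?gt_eqF//.
  rewrite opprD addrA subrr sub0r oppr_lt0 => /(_ k0).
  rewrite -(pmulr_rle0 _ G0) mulrBr.
  have -> : dot g g * ((b + k) / dot g g * b) = b ^+ 2 + k * b.
    by field; rewrite gt_eqF.
  have : k * b <= e.
    apply: le_trans (_ : k * (`|b| + 1) <= e); last by rewrite /k mulfVK ?gt_eqF.
    by rewrite ler_pM2l//; have := ler_norm b; lra.
  lra.
exists (b / dot g g).
  rewrite divr_ge0 ?dot_ge0//; have := key (- g).
  rewrite dotC !dotNl (dotC g q) -/b oppr_lt0 => /(_ G0); lra.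
apply/eqP; rewrite -subr_eq0; apply/eqP/dot_eq0.
rewrite !dotBl !dotBr !dotZl !dotZr (dotC g q) -/b.
have -> : dot q q - b / dot g g * b - (b / dot g g * b - b / dot g g * (b / dot g g * dot g g))
   = (dot g g * dot q q - b ^+ 2) / dot g g by field; rewrite gt_eqF.
by rewrite pmulr_lle0 ?invr_gt0// subr_le0.
Qed.

(** By convexity the segment towards [z] stays in [K], where [f] is nonpositive, so the slope of [f]
    in that direction cannot be positive. *)
Lemma grad_supports (U : set V) (f : V -> R) (x : V) :
  Defs.convex_set K -> open U -> U x -> C2_on U f ->
  K `&` U = [set y | U y /\ f y <= 0] -> f x = 0 -> supports x (grad f x).
Proof.
move=> cK oU Ux cf KU fx0.
have [Kx _] : (K `&` U) x by rewrite KU; split => //; rewrite fx0.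
split => // z Kz; set v := z - x; set g := grad f x.
pose v1 := \sum_l `|v ord0 l|.
have v10 : 0 <= v1 by exact: sumr_ge0.
apply/ler_addgt0Pr => e e0; rewrite add0r.
have e'0 : 0 < e / (v1 + 1) by rewrite divr_gt0// ltr_wpDl.
have [r r0 H] := C2_diff oU Ux cf e'0.
pose s := Num.min 1 (r / (`|v| + 1) / 2).
have vp : 0 < `|v| + 1 by rewrite ltr_wpDl.
have s0 : 0 < s by rewrite lt_min ltr01 !divr_gt0.
have s1 : s <= 1 by rewrite ge_min lexx.
have sr : `|s *: v| < r.
  rewrite normrZ gtr0_norm//.
  apply: le_lt_trans (_ : (r / (`|v| + 1) / 2) * `|v| < _).
    by rewrite ler_wpM2r// ge_min lexx orbT.
  exact: half_scale_lt.
have [Us] := H _ sr.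
have -> : \sum_l `|(s *: v) ord0 l| = s * v1.
  by rewrite mulr_sumr; apply: eq_bigr => l _; rewrite mxE normrM gtr0_norm.
have : K (x + s *: v).
  have -> : x + s *: v = s *: z + (1 - s) *: x.
    by rewrite /v scalerBr scalerBl scale1r addrCA addrA [_ + x]addrC -!addrA addrCA.
  exact: (cK z x Kz Kx s (ltW s0) s1).
move=> Ks; have [_ fs] : [set y | U y /\ f y <= 0] (x + s *: v) by rewrite -KU.
rewrite dotZr -/g fx0 subr0 ler_norml => /andP[h _].
have h2 : e / (v1 + 1) * (s * v1) <= s * e.
  have -> : e / (v1 + 1) * (s * v1) = (s * e) * (v1 / (v1 + 1)) by field; rewrite gt_eqF// ltr_wpDl.
  by rewrite ger_pMr ?mulr_gt0// ler_pdivrMr ?ltr_wpDl// mul1r lerDl.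
rewrite dotC -(ler_pM2l s0); lra.
Qed.

End Normals.

(** * First-order expansion of the normal along the boundary *)

Section Curvature.
Variables (R : realType) (n : nat).
Notation V := 'rV[R]_n.+1.
Variables (K : set V) (j : 'I_n.+1) (sg : R).
Hypothesis sg1 : sg = 1 \/ sg = -1.

(** The nonvanishing of a derivative is kept apart from the chart: the lemmas below fix the
    coordinate and sign through [0 < sg * partial j f x0]. *)
Definition chart (U : set V) (f : V -> R) (x : V) : Prop :=
  [/\ open U, U x, C2_on U f & K `&` U = [set y | U y /\ f y <= 0]].

Lemma sg_sqr : sg * sg = 1.
Proof. by case: sg1 => ->; rewrite ?mulr1// mulrNN mulr1. Qed.

Lemma sg_norm : `|sg| = 1.
Proof. by case: sg1 => ->; rewrite ?normrN normr1. Qed.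

Lemma sum_lift (F : 'I_n.+1 -> R) : \sum_i F i = F j + \sum_(k < n) F (lift j k).
Proof. exact: bigD1_ord. Qed.

Lemma sum_norm_le m (F : 'I_m -> R) (c : R) : (forall k, `|F k| <= c) ->
  `|\sum_k F k| <= m%:R * c.
Proof.
move=> h; apply: le_trans (ler_norm_sum _ _ _) _.
apply: le_trans (ler_sum _ (fun k _ => h k)) _.
by rewrite sumr_const card_ord mulr_natl.
Qed.

Lemma norm_le_sum (I : finType) (F : I -> R) i : `|F i| <= \sum_k `|F k|.
Proof. by rewrite (bigD1 i)//= lerDl sumr_ge0. Qed.

Lemma norm_le_sum2 (I J : finType) (F : I -> J -> R) i l :
  `|F i l| <= \sum_k \sum_m `|F k m|.
Proof.
apply: le_trans (norm_le_sum (F i) l) _; rewrite [leRHS](bigD1 i)//= lerDl.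
by apply: sumr_ge0 => k _; exact: sumr_ge0.
Qed.

Lemma continuous_near_all m (I : finType) (F : I -> 'rV[R]_m -> R) (x : 'rV[R]_m) (e : R) :
  (forall i, {for x, continuous (F i)}) -> 0 < e ->
  exists2 r, 0 < r & forall y i, `|y - x| < r -> `|F i y - F i x| < e.
Proof.
move=> cF e0; have /choice[rr rrP] i : exists r, 0 < r /\
    forall y, `|y - x| < r -> `|F i y - F i x| < e.
  by have [r r0 H] := continuous_near (cF i) e0; exists r.
exists (\big[Num.min/1]_i rr i).
  by elim/big_ind: _ => // [u v u0 v0|i _]; [rewrite lt_min u0|have [] := rrP i].
move=> y i yx; apply: (rrP i).2; apply: lt_le_trans yx _; exact: bigmin_le_cond.
Qed.

Lemma C2_partial_continuous U f x i : chart U f x -> {for x, continuous (partial i f)}.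
Proof.
move=> [oU Ux [_ [C1 _]] _].
have [_] := C1 i; rewrite continuous_open_subspace// => /(_ x); apply.
exact: mem_set.
Qed.

Lemma gradient_strict_differentiability U f x (e : R) : chart U f x -> 0 < e ->
  exists2 r, 0 < r & forall i y z, `|y - x| < r -> `|z - x| < r ->
    `|partial i f y - partial i f z -
      \sum_l partial l (partial i f) x * (y - z) ord0 l| <=
    e * \sum_l `|(y - z) ord0 l|.
Proof.
move=> [oU Ux [_ [_ C2]] _] e0.
have /choice[rr rrP] i : exists r, 0 < r /\
    forall y z, `|y - x| < r -> `|z - x| < r ->
    `|partial i f y - partial i f z -
      \sum_l partial l (partial i f) x * (y - z) ord0 l| <=
    e * \sum_l `|(y - z) ord0 l|.
  have [||r r0 H] := strict_differentiability oU Ux _ _ e0 (f := partial i f).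
  - by move=> l y Uy; have [h _] := C2 i l; exact: h.
  - move=> l; have [_] := C2 i l; rewrite continuous_open_subspace// => /(_ x); apply.
    exact: mem_set.
  by exists r.
exists (\big[Num.min/1]_i rr i).
  by elim/big_ind: _ => // [u v u0 v0|i _]; [rewrite lt_min u0|have [] := rrP i].
move=> i y z yx zx; apply: (rrP i).2.
  by apply: lt_le_trans yx _; exact: bigmin_le_cond.
by apply: lt_le_trans zx _; exact: bigmin_le_cond.
Qed.

(** By [normal_unique], the normal with [j]-th coordinate [sg] is the gradient divided by
    [sg * partial j f x], a continuous quotient as long as the denominator stays away from 0. *)
Lemma normal_near U f x0 (e : R) : chart U f x0 -> 0 < sg * partial j f x0 -> 0 < e ->
  exists2 r, 0 < r & forall x, `|x - x0| < r ->
    [/\ U x, `|sg * partial j f x - sg * partial j f x0| <= e,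
        sg * partial j f x0 / 2 <= sg * partial j f x &
        forall nu, supports K x nu -> nu ord0 j = sg ->
          (forall i, partial i f x = sg * partial j f x * nu ord0 i) /\
          (forall i, `|nu ord0 i - partial i f x0 / (sg * partial j f x0)| <= e)].
Proof.
move=> ch a0 e0; set a := sg * partial j f x0 in a0 *.
pose N := \sum_i `|partial i f x0 / a|.
have N0 : 0 <= N by exact: sumr_ge0.
have NN i : `|partial i f x0 / a| <= N.
  by rewrite /N (bigD1 i)//= lerDl sumr_ge0.
(* The bound [a / 2] keeps the denominator at least half its value at [x0]; the last bound absorbs
   the factor 1 + N from perturbing the quotient. *)
pose e' := Num.min e (Num.min (a / 2) (e * a / (2 * (1 + N)))).
have e'0 : 0 < e'.
  have N1 : 0 < 1 + N by lra.
  have h1 : 0 < e * a by exact: mulr_gt0.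
  have h2 : 0 < 2 * (1 + N) by exact: mulr_gt0.
  by rewrite !lt_min e0 divr_gt0//= divr_gt0.
have e'e : e' <= e by rewrite ge_min lexx.
have e'a : e' <= a / 2 by rewrite !ge_min lexx orbT.
have e'N : e' * (1 + N) <= e * a / 2.
  have : e' <= e * a / (2 * (1 + N)) by rewrite !ge_min lexx !orbT.
  rewrite ler_pdivlMr; last by lra.
  by move=> h; rewrite ler_pdivlMr//; apply: le_trans h; rewrite le_eqVlt; apply/orP; left; apply/eqP; ring.
have [r1 r10 H1] := continuous_near_all (fun i => @C2_partial_continuous U f x0 i ch) e'0.
have [oU Ux0 cf KU] := ch.
have [r2 r20 H2] := open_ball oU Ux0.
exists (Num.min r1 r2) => [|x]; first by rewrite lt_min r10.
rewrite lt_min => /andP[xr1 xr2]; have Ux := H2 _ xr2.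
set b := sg * partial j f x.
have ba : `|b - a| <= e'.
  by rewrite /b /a -mulrBr normrM sg_norm mul1r; exact/ltW/H1.
have ab : a / 2 <= b by move: ba; rewrite ler_norml; lra.
have b0 : 0 < b by lra.
split => //; first exact: le_trans e'e.
move=> nu snu nuj.
have g0 : grad f x != 0.
  apply/eqP => /rowP/(_ j); rewrite !mxE => h.
  by move: b0; rewrite /b h mulr0 ltxx.
have [c c0 nuE] := normal_unique oU Ux cf KU snu g0.
have nuiE i : nu ord0 i = c * partial i f x by rewrite nuE !mxE.
have cb : c * b = 1 by rewrite /b mulrCA -nuiE nuj sg_sqr.
have gi i : partial i f x = b * nu ord0 i.
  by rewrite nuiE mulrA (mulrC b) cb mul1r.
split => // i; set m := partial i f x0 / a.
have E : b * (nu ord0 i - m) = (partial i f x - partial i f x0) + (a - b) * m.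
  by rewrite mulrBr -gi /m; field; rewrite gt_eqF.
have : b * `|nu ord0 i - m| <= e' * (1 + N).
  rewrite -[X in X * _](gtr0_norm b0) -normrM E.
  apply: le_trans (ler_normD _ _) _; rewrite mulrDr mulr1 lerD//.
    exact/ltW/H1.
  by rewrite normrM distrC ler_pM// NN.
move=> h; have {}h := le_trans h e'N.
have : a / 2 * `|nu ord0 i - m| <= a / 2 * e.
  apply: le_trans (ler_wpM2r (normr_ge0 _) ab) _; apply: le_trans h _.
  by rewrite le_eqVlt; apply/orP; left; apply/eqP; field.
by rewrite ler_pM2l// divr_gt0.
Qed.

(** When [v j = sg], the vectors e_i - sg * v_i * e_j with [i] different from [j] are orthogonal to
    [v]. The entries are the values of the Hessian [H] on pairs of these tangent vectors, divided by
    [a]. *)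
Definition tangential_mx (a : R) (v : 'I_n.+1 -> R) (H : 'I_n.+1 -> 'I_n.+1 -> R)
    : 'M[R]_n :=
  \matrix_(m, k) (a^-1 * (H (lift j k) (lift j m)
    - sg * H (lift j k) j * v (lift j m) - sg * v (lift j k) * H j (lift j m)
    + v (lift j k) * v (lift j m) * H j j)).

Lemma tangential_mx_sym a v H : (forall i l, H i l = H l i) ->
  (tangential_mx a v H)^T = tangential_mx a v H.
Proof.
move=> Hs; apply/matrixP => k m; rewrite !mxE; congr (_ * _).
rewrite (Hs (lift j m) (lift j k)) (Hs (lift j m) j) (Hs j (lift j k)); ring.
Qed.

Lemma mul_tangential_mx a v H (D : V) k :
  (col' j D *m tangential_mx a v H) ord0 k =
  a^-1 * (\sum_m D ord0 (lift j m) *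
            (H (lift j k) (lift j m) - sg * H (lift j k) j * v (lift j m)) -
          sg * v (lift j k) * \sum_m D ord0 (lift j m) *
            (H j (lift j m) - sg * H j j * v (lift j m))).
Proof.
rewrite mxE mulrBr !mulr_sumr -sumrB; apply: eq_bigr => m _; rewrite !mxE.
have -> : v (lift j k) * v (lift j m) * H j j =
  sg * sg * (v (lift j k) * v (lift j m) * H j j) by rewrite sg_sqr mul1r.
ring.
Qed.

(* The second fundamental form of the boundary, seen as a graph over the
   hyperplane orthogonal to the [j]-th axis. *)
Definition curvature (f : V -> R) (x0 : V) : 'M[R]_n :=
  tangential_mx (sg * partial j f x0) (fun i => partial i f x0 / (sg * partial j f x0))
    (fun i l => partial l (partial i f) x0).

Lemma curvature_sym U f x0 : chart U f x0 -> (curvature f x0)^T = curvature f x0.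
Proof.
move=> [oU Ux cf _]; apply: tangential_mx_sym => i l.
exact: (partial_sym i l oU Ux cf).
Qed.

(** The displacement [D] of two boundary points is almost tangent: it pairs nonnegatively with one
    normal and nonpositively with the other, and both are within [e] of [v]. This determines [D j]
    from the other coordinates up to O(e s). Inserting it in the expansion of the gradient and
    dividing by the scale [ax] gives the normals; [Q] collects the constants. *)
Lemma expansion_core (H : 'I_n.+1 -> 'I_n.+1 -> R) (v gx gy nu mu D : 'I_n.+1 -> R)
    (a ax ay e s Hb N : R) :
  let W i := \sum_(m < n) D (lift j m) * (H i (lift j m) - sg * H i j * v (lift j m)) in
  let C1 := n%:R * (N + 2) in
  let Ws := n%:R * (Hb * (1 + N)) in
  let Q := n%:R * Hb * (N + 2) + C1 * (N + 2) + Ws + Ws * (1 + N) / a in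
  v j = sg -> 0 < a -> a / 2 <= ax -> `|ax - a| <= e -> 0 < e <= 1 ->
  (forall i, gx i = ax * nu i) -> (forall i, gy i = ay * mu i) ->
  ax = sg * gx j -> ay = sg * gy j -> nu j = sg -> mu j = sg ->
  (forall i, `|nu i - v i| <= e) -> (forall i, `|mu i - v i| <= e) ->
  0 <= N -> (forall i, `|v i| <= N) -> 0 <= Hb -> (forall i l, `|H i l| <= Hb) ->
  0 <= s -> (forall k, `|D (lift j k)| <= s) ->
  0 <= \sum_i D i * nu i -> \sum_i D i * mu i <= 0 ->
  (forall i, `|gx i - gy i - \sum_l H i l * D l| <= e * \sum_l `|D l|) ->
  forall k, `|nu (lift j k) - mu (lift j k) -
     a^-1 * (W (lift j k) - sg * v (lift j k) * W j)| <= 2 * Q / a * e * s.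
Proof.
move=> W C1 Ws Q vj a0 axa axe /andP[e0 e1] gxE gyE axE ayE nuj muj nuv muv N0 vN
  Hb0 HHb s0 Ds Dnu Dmu gH k.
have ax0 : 0 < ax by lra.
have n0 : 0 <= n%:R :> R by rewrite ler0n.
have es0 : 0 <= e * s by rewrite mulr_ge0// ltW.
(* [q] measures the deviation of [D] from the tangent plane; [qb] below traps it between the
   pairings with [nu] and [mu]. *)
pose q := \sum_i D i * v i.
have qE : q = D j * sg + \sum_(m < n) D (lift j m) * v (lift j m).
  by rewrite /q sum_lift vj.
have dif (w : 'I_n.+1 -> R) : w j = sg -> (forall i, `|w i - v i| <= e) ->
    `|\sum_i D i * w i - q| <= n%:R * (e * s).
  move=> wj wv; rewrite -sumrB sum_lift wj vj subrr add0r; apply: sum_norm_le => m.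
  by rewrite -mulrBr normrM [e * s]mulrC ler_pM.
have qb : `|q| <= n%:R * (e * s).
  have := dif nu nuj nuv; have := dif mu muj muv; rewrite !ler_norml; lra.
have Djb : `|D j| <= n%:R * ((N + 1) * s).
  have -> : D j = sg * (q - \sum_(m < n) D (lift j m) * v (lift j m)).
    by rewrite qE addrK mulrCA sg_sqr mulr1.
  rewrite normrM sg_norm mul1r; apply: le_trans (ler_normB _ _) _.
  rewrite mulrDl mulrDr addrC lerD//.
    by apply: sum_norm_le => m; rewrite normrM mulrC ler_pM.
  apply: le_trans qb _; rewrite ler_wpM2l// ler_wpM2r//.
have D1b : \sum_l `|D l| <= C1 * s.
  rewrite sum_lift.
  have : \sum_(m < n) `|D (lift j m)| <= n%:R * s.
    apply: le_trans (ler_sum _ (fun m _ => Ds m)) _.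
    by rewrite sumr_const card_ord mulr_natl.
  have -> : C1 * s = n%:R * ((N + 1) * s) + n%:R * s by rewrite /C1; ring.
  by move=> h; rewrite lerD.
have C10 : 0 <= C1 by rewrite mulr_ge0//; lra.
have Wb i : `|W i| <= Ws * s.
  rewrite /Ws -mulrA; apply: sum_norm_le => m; rewrite normrM mulrC ler_pM//.
  apply: le_trans (ler_normB _ _) _; rewrite mulrDr mulr1 lerD//.
  by rewrite !normrM sg_norm mul1r ler_pM.
have Ws0 : 0 <= Ws by rewrite mulr_ge0// mulr_ge0//; lra.
have LE i : \sum_l H i l * D l = sg * H i j * q + W i.
  rewrite sum_lift qE; pose S := \sum_(m < n) D (lift j m) * v (lift j m); rewrite -/S.
  have -> : sg * H i j * (D j * sg + S) = H i j * D j + sg * H i j * S.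
    by rewrite -[H i j * D j]mul1r -sg_sqr; ring.
  rewrite /S -addrA; congr (_ + _); rewrite mulr_sumr -big_split/=; apply: eq_bigr => m _; ring.
pose p i := gx i - gy i - \sum_l H i l * D l.
have pb i : `|p i| <= e * (C1 * s).
  by apply: le_trans (gH i) _; rewrite ler_wpM2l// ltW.
have gE i : gx i - gy i = sg * H i j * q + W i + p i by rewrite /p LE; ring.
pose k' := lift j k; rewrite -/k'.
pose T := a^-1 * (W k' - sg * v k' * W j).
have aT : a * T = W k' - sg * v k' * W j by rewrite /T mulrA divff ?mul1r// gt_eqF.
(* Each term on the right has a factor of order [e]: [q], a remainder [p], the difference
   [mu k' - v k'], or [ax - a]. The hypothesis [a / 2 <= ax] then costs a factor 2 / a. *)
have E : ax * (nu k' - mu k' - T) =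
    sg * H k' j * q + p k' - sg * p j * mu k' - sg * W j * (mu k' - v k')
    - H j j * q * mu k' - (ax - a) * T.
  have h1 : ax * nu k' - ay * mu k' = sg * H k' j * q + W k' + p k'.
    by rewrite -gxE -gyE gE.
  have h2 : ax - ay = H j j * q + sg * W j + sg * p j.
    rewrite axE ayE -mulrBr gE !mulrDr; congr (_ + _ + _).
    by rewrite !mulrA sg_sqr mul1r.
  have -> : ax * (nu k' - mu k' - T) =
    (ax * nu k' - ay * mu k') - (ax - ay) * mu k' - (ax - a) * T - a * T by ring.
  by rewrite h1 h2 aT; ring.
have mub : `|mu k'| <= N + 1.
  have := muv k'; have := vN k'; rewrite !ler_norml; lra.
have Tb : `|T| <= Ws * (1 + N) / a * s.
  rewrite /T normrM gtr0_norm ?invr_gt0//.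
  have -> : Ws * (1 + N) / a * s = a^-1 * (Ws * s + N * (Ws * s)) by ring.
  rewrite ler_pM2l ?invr_gt0//; apply: le_trans (ler_normB _ _) _; rewrite lerD//.
  by rewrite !normrM sg_norm mul1r ler_pM.
have big : ax * `|nu k' - mu k' - T| <= Q * (e * s).
  rewrite -[X in X * _](gtr0_norm ax0) -normrM E.
  have -> : Q * (e * s) = Hb * (n%:R * (e * s)) + e * (C1 * s) + (e * (C1 * s)) * (N + 1)
     + (Ws * s) * e + Hb * (n%:R * (e * s)) * (N + 1) + e * (Ws * (1 + N) / a * s).
    by rewrite /Q; ring.
  apply: le_trans (ler_normB _ _) _; apply: lerD; last by rewrite normrM ler_pM.
  apply: le_trans (ler_normB _ _) _; apply: lerD; last by rewrite !normrM ler_pM// ler_pM.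
  apply: le_trans (ler_normB _ _) _; apply: lerD.
    2: by rewrite !normrM sg_norm mul1r ler_pM.
  apply: le_trans (ler_normB _ _) _; apply: lerD.
    2: by rewrite !normrM sg_norm mul1r ler_pM.
  apply: le_trans (ler_normD _ _) _; apply: lerD => //.
  by rewrite !normrM sg_norm mul1r ler_pM.
have : a / 2 * `|nu k' - mu k' - T| <= a / 2 * (2 * Q / a * e * s).
  apply: le_trans (ler_wpM2r (normr_ge0 _) axa) _; apply: le_trans big _.
  by rewrite le_eqVlt; apply/orP; left; apply/eqP; field; rewrite gt_eqF.
by rewrite ler_pM2l// divr_gt0.
Qed.

(** Both points vary near [x0] while the matrix stays that of [x0]; this strict form lets one matrix
    serve a whole patch. *)
Lemma normal_expansion U f x0 (e : R) : chart U f x0 -> 0 < sg * partial j f x0 -> 0 < e ->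
  exists2 r, 0 < r & forall x y nu mu, `|x - x0| < r -> `|y - x0| < r ->
    supports K x nu -> supports K y mu -> nu ord0 j = sg -> mu ord0 j = sg ->
    forall k, `|(nu - mu) ord0 (lift j k) -
                (col' j (x - y) *m curvature f x0) ord0 k| <= e * `|col' j (x - y)|.
Proof.
move=> ch a0 e0; set a := sg * partial j f x0 in a0 *.
pose H i l := partial l (partial i f) x0.
pose v i := partial i f x0 / a.
pose Hb := \sum_i \sum_l `|H i l|; pose N := \sum_i `|v i|.
have Hb0 : 0 <= Hb by apply: sumr_ge0 => i _; exact: sumr_ge0.
have N0 : 0 <= N by exact: sumr_ge0.
have vN i : `|v i| <= N by exact: norm_le_sum.
have HHb i l : `|H i l| <= Hb by exact: (norm_le_sum2 H).
have vj : v j = sg.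
  have pj : partial j f x0 = sg * a by rewrite /a mulrA sg_sqr mul1r.
  by rewrite /v pj mulfK// gt_eqF.
pose C1 : R := n%:R * (N + 2); pose Ws := n%:R * (Hb * (1 + N)).
pose Q := n%:R * Hb * (N + 2) + C1 * (N + 2) + Ws + Ws * (1 + N) / a.
have Q0 : 0 <= Q.
  have ? : 0 <= N + 2 by lra.
  have ? : 0 <= 1 + N by lra.
  by rewrite /Q /C1 /Ws !addr_ge0 ?divr_ge0 ?(ltW a0)// !mulr_ge0.
pose e' := Num.min 1 (e * a / (2 * Q + 1)).
have Q1 : 0 < 2 * Q + 1 by lra.
have e'0 : 0 < e' by rewrite lt_min ltr01 divr_gt0// mulr_gt0.
have e'1 : e' <= 1 by rewrite ge_min lexx.
have e'Q : 2 * Q / a * e' <= e.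
  have : e' <= e * a / (2 * Q + 1) by rewrite ge_min lexx orbT.
  rewrite ler_pdivlMr// => h; rewrite mulrAC ler_pdivrMr//; apply: le_trans h.
  by rewrite mulrC ler_wpM2l ?(ltW e'0)//; lra.
have [r1 r10 H1] := normal_near ch a0 e'0.
have [r2 r20 H2] := gradient_strict_differentiability ch e'0.
exists (Num.min r1 r2) => [|x y nu mu]; first by rewrite lt_min r10.
rewrite !lt_min => /andP[xr1 xr2] /andP[yr1 yr2] snu smu nuj muj k.
have [Ux axe axa /(_ _ snu nuj)[gxE nuv]] := H1 _ xr1.
have [Uy _ _ /(_ _ smu muj)[gyE muv]] := H1 _ yr1.
have Ds m : `|(x - y) ord0 (lift j m)| <= `|col' j (x - y)|.
  by have := coord_le_norm (col' j (x - y)) m; rewrite [X in `|X| <= _]mxE.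
have dnu : 0 <= \sum_i (x - y) ord0 i * nu ord0 i.
  have [_ /(_ y smu.1)] := snu; rewrite -opprB dotNl oppr_le0; exact.
have dmu : \sum_i (x - y) ord0 i * mu ord0 i <= 0 by have [_ /(_ x snu.1)] := smu; exact.
have := @expansion_core H v (fun i => partial i f x) (fun i => partial i f y)
  (nu ord0) (mu ord0) ((x - y) ord0) a (sg * partial j f x) (sg * partial j f y) e'
  `|col' j (x - y)| Hb N vj a0 axa axe _ gxE gyE erefl erefl nuj muj nuv muv N0 vN
  Hb0 HHb (normr_ge0 _) Ds dnu dmu (fun i => H2 i x y xr2 yr2) k.
rewrite e'0 e'1 => /(_ isT) main.
have {}main := le_trans main (ler_wpM2r (normr_ge0 _) e'Q).
by rewrite /curvature mul_tangential_mx [(nu - mu) _ _]mxE [(- mu) _ _]mxE.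
Qed.

End Curvature.

(** * Positive semidefiniteness of the curvature matrix *)

Section CurvaturePositive.
Variables (R : realType) (n : nat).
Notation V := 'rV[R]_n.+1.
Variables (K : set V) (j : 'I_n.+1) (sg : R).
Hypothesis cK : Defs.convex_set K.
Hypothesis sg1 : sg = 1 \/ sg = -1.

Definition ins (v : 'rV[R]_n) : V := \row_i oapp (v ord0) 0 (unlift j i).

Lemma ins_lift v k : ins v ord0 (lift j k) = v ord0 k.
Proof. by rewrite mxE liftK. Qed.

Lemma ins_diag v : ins v ord0 j = 0.
Proof. by rewrite mxE unlift_none. Qed.

Lemma evec_diag : evec R j ord0 j = 1.
Proof. by rewrite mxE !eqxx. Qed.

Lemma evec_lift k : evec R j ord0 (lift j k) = 0.
Proof. by rewrite mxE [_ == j]eq_sym (negbTE (neq_lift j k)) andbF. Qed.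

(** Shift the projection of [x0] by a small multiple of [v] and move along the [j]-th axis: [f]
    changes sign there, so the intermediate value theorem yields a boundary point above any
    prescribed direction. *)
Lemma surface_point U f x0 (v : 'rV[R]_n) (r : R) : chart K U f x0 -> f x0 = 0 ->
  0 < sg * partial j f x0 -> 0 < r ->
  exists s x, [/\ 0 < s, `|x - x0| < r, U x, f x = 0 & col' j (x - x0) = s *: v].
Proof.
move=> [oU Ux0 cf KU] fx0 a0 r0; set a := sg * partial j f x0 in a0 *.
have a40 : 0 < a / 4 by rewrite divr_gt0.
have [r1 r10 H1] := C2_diff oU Ux0 cf a40.
pose g := grad f x0; pose w0 := ins v.
pose V1 := \sum_l `|w0 ord0 l|; pose Gv := `|dot g w0|.
have V10 : 0 <= V1 by exact: sumr_ge0.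
have Gv0 : 0 <= Gv by exact: normr_ge0.
pose rho := Num.min r r1 / 3.
have rho0 : 0 < rho by rewrite divr_gt0// lt_min r0.
have rhor : 3 * rho <= r by rewrite /rho mulrC divfK// ge_min lexx.
have rhor1 : 3 * rho <= r1 by rewrite /rho mulrC divfK// ge_min lexx orbT.
have aV0 : 0 <= a * V1 by rewrite mulr_ge0// ltW.
have den0 : 0 < Gv + a * V1 + 1 by lra.
(* With this [s], the shift along [v] and the linearisation error cannot outweigh the change
   [rho * a] caused by moving [rho] along the axis. *)
pose s := rho * a / 4 / (Gv + a * V1 + 1).
have s0 : 0 < s by rewrite !divr_gt0// mulr_gt0.
have sle : s * Gv + s * (a * V1) <= rho * a / 4.
  rewrite -mulrDr; apply: le_trans (_ : s * (Gv + a * V1 + 1) <= _).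
    by rewrite ler_pM2l//; lra.
  by rewrite /s divfK// gt_eqF.
have sV1 : s * V1 <= rho / 4.
  rewrite -(ler_pM2l a0); have : 0 <= s * Gv by rewrite mulr_ge0// ltW.
  have -> : a * (s * V1) = s * (a * V1) by ring.
  have -> : a * (rho / 4) = rho * a / 4 by ring.
  lra.
pose w (t : R) := s *: w0 + t *: evec R j.
have wj t : w t ord0 j = t.
  by rewrite mxE [X in X + _]mxE ins_diag mulr0 add0r mxE evec_diag mulr1.
have wl t k : w t ord0 (lift j k) = s * v ord0 k.
  by rewrite mxE [X in X + _]mxE ins_lift [X in _ + X]mxE evec_lift mulr0 addr0.
have w1 t : `|t| <= rho -> \sum_l `|w t ord0 l| <= s * V1 + `|t|.
  move=> tr; rewrite (sum_lift j) /V1 (sum_lift j) wj ins_diag normr0 add0r addrC lerD//.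
  by rewrite mulr_sumr ler_sum// => k _; rewrite wl ins_lift normrM gtr0_norm.
have wr t : `|t| <= rho -> `|w t| < 3 * rho.
  move=> tr; apply: le_lt_trans (_ : \sum_l `|w t ord0 l| < _).
    by apply: norm_le_coord => [|i]; [exact: sumr_ge0|exact: norm_le_sum (w t ord0) i].
  by have := w1 t tr; lra.
have Uw t : `|t| <= rho -> U (x0 + w t).
  by move=> tr; have [] := H1 (w t) (lt_le_trans (wr t tr) rhor1).
have gw t : dot g (w t) = s * dot g w0 + t * partial j f x0.
  rewrite /w dotDr !dotZr; congr (_ + _ * _).
  rewrite /dot (sum_lift j) evec_diag mulr1 [X in X + _]mxE big1 ?addr0// => k _.
  by rewrite evec_lift mulr0.
have fw t : `|t| <= rho ->
    `|f (x0 + w t) - (s * dot g w0 + t * partial j f x0)| <= a / 4 * (s * V1 + `|t|).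
  move=> tr; have [_] := H1 (w t) (lt_le_trans (wr t tr) rhor1).
  rewrite fx0 subr0 gw => /le_trans; apply.
  by rewrite ler_pM2l// w1.
pose F t := f (x0 + s *: w0 + t *: evec R j).
have FE t : F t = f (x0 + w t) by rewrite /F /w addrA.
have cF : {within `[- rho, rho], continuous F}.
  apply: derivable_within_continuous => t; rewrite in_itv/= => tr.
  apply: derivable_line; have [_ [C1 _]] := cf; have [h _] := C1 j; apply: h.
  by rewrite -addrA; apply: Uw; rewrite ler_norml.
have nr : `|rho| <= rho by rewrite gtr0_norm.
have nr' : `|- rho| <= rho by rewrite normrN.
have pjE : partial j f x0 = sg * a by rewrite /a mulrA (sg_sqr sg1) mul1r.
have ar : a * rho = rho * a by rewrite mulrC.
have Gn : `|s * dot g w0| <= s * Gv by rewrite normrM gtr0_norm.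
have [s1 s2] : F rho * sg > 0 /\ F (- rho) * sg < 0.
  have := fw _ nr; have := fw _ nr'; rewrite -!FE normrN (gtr0_norm rho0) pjE.
  move: Gn; rewrite !ler_norml => Gn.
  have aV : a / 4 * (s * V1 + rho) = s * (a * V1) / 4 + rho * a / 4 by field.
  have ra : 0 < rho * a by exact: mulr_gt0.
  have saV : 0 <= s * (a * V1) by rewrite mulr_ge0// ltW.
  have sG : 0 <= s * Gv by rewrite mulr_ge0// ltW.
  rewrite aV mulNr; case: sg1 => ->; rewrite ?mulr1 ?mul1r ?mulN1r ?mulrN1 ?mulrN; lra.
have [t] : exists2 c, c \in `[- rho, rho] & F c = 0.
  apply: IVT => //; first by lra.
  case: sg1 s1 s2 => ->; rewrite ?mulr1 ?mulrN1 ge_min le_max => *; apply/andP; split; apply/orP;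
    ((by left; lra) || (by right; lra)).
rewrite in_itv/= => tr Ft; have {}tr : `|t| <= rho by rewrite ler_norml.
exists s, (x0 + w t); have xw : x0 + w t - x0 = w t by rewrite addrC addKr.
split => //; rewrite ?xw.
- exact: lt_le_trans (wr t tr) _.
- exact: Uw.
- by rewrite -FE.
- by apply/rowP => k; rewrite mxE wl mxE.
Qed.

Lemma supportsZ x q c : 0 <= c -> supports K x q -> supports K x (c *: q).
Proof. by move=> c0 [Kx h]; split => // z Kz; rewrite dotZr mulr_ge0_le0 ?h. Qed.

Lemma quad_form m (v : 'rV[R]_m) (M : 'M[R]_m) :
  (v *m M *m v^T) ord0 ord0 = \sum_k v ord0 k * (v *m M) ord0 k.
Proof. by rewrite mxE; apply: eq_bigr => k _; rewrite !mxE mulrC. Qed.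

Lemma norm_sqr_le m (v : 'rV[R]_m) k : `|v ord0 k| * `|v| <= \sum_k v ord0 k ^+ 2.
Proof.
apply: le_trans (_ : `|v| ^+ 2 <= _).
  by rewrite expr2 ler_wpM2r// coord_le_norm.
have s0 : 0 <= \sum_k v ord0 k ^+ 2 by apply: sumr_ge0 => i _; exact: sqr_ge0.
rewrite -[leRHS](sqr_sqrtr s0) lerXn2r ?nnegrE ?sqrtr_ge0//.
by apply: norm_le_coord => [|i]; [exact: sqrtr_ge0|exact: coord_le_enorm].
Qed.

(** Normals of a convex set are monotone. Comparing [x0] with the boundary points above direction
    [v] and inserting [normal_expansion] gives nonnegativity up to any [e]. *)
Lemma curvature_psd U f x0 (v : 'rV[R]_n) : chart K U f x0 -> f x0 = 0 ->
  0 < sg * partial j f x0 -> 0 <= (v *m curvature j sg f x0 *m v^T) ord0 ord0.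
Proof.
move=> ch fx0 a0; set M := curvature j sg f x0.
pose S := \sum_k v ord0 k ^+ 2.
have S0 : 0 <= S by apply: sumr_ge0 => i _; exact: sqr_ge0.
rewrite -oppr_le0; apply/ler_addgt0Pr => e e0; rewrite add0r.
have nS : 0 <= n%:R * S by rewrite mulr_ge0.
have e'0 : 0 < e / (n%:R * S + 1) by rewrite divr_gt0// ltr_wpDl.
have [r1 r10 H1] := normal_expansion sg1 ch a0 e'0.
have [r2 r20 H2] := normal_near sg1 ch a0 ltr01.
have r0 : 0 < Num.min r1 r2 by rewrite lt_min r10.
have [s [x [s0 xr Ux fx xv]]] := surface_point v ch fx0 a0 r0.
move: xr; rewrite lt_min => /andP[xr1 xr2].
have [oU Ux0 cf KU] := ch.
have [_ _ ax _] := H2 _ xr2.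
have nrm y : U y -> f y = 0 -> 0 < sg * partial j f y ->
    supports K y ((sg * partial j f y)^-1 *: grad f y) /\
    ((sg * partial j f y)^-1 *: grad f y) ord0 j = sg.
  move=> Uy fy ay; split.
    apply: supportsZ; first by rewrite invr_ge0 ltW.
    exact: (grad_supports cK oU Uy cf KU fy).
  rewrite !mxE -[X in _ * X]mul1r -(sg_sqr sg1) -mulrA mulrCA mulVf ?mulr1//.
  by rewrite gt_eqF.
have ax0 : 0 < sg * partial j f x by apply: lt_le_trans ax; rewrite divr_gt0.
have [sx nxj] := nrm x Ux fx ax0; have [sx0 nx0j] := nrm x0 Ux0 fx0 a0.
set nx := _ *: grad f x in sx nxj; set n0 := _ *: grad f x0 in sx0 nx0j.
have x0r : `|x0 - x0| < r1 by rewrite subrr normr0.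
have HH := H1 x x0 nx n0 xr1 x0r sx sx0 nxj nx0j.
have mono := supports_monotone sx sx0.
have dE : dot (x - x0) (nx - n0) =
    s * \sum_k v ord0 k * (nx - n0) ord0 (lift j k).
  rewrite /dot (sum_lift j) [(nx - n0) ord0 j]mxE [(- n0) ord0 j]mxE nxj nx0j subrr mulr0 add0r.
  rewrite mulr_sumr; apply: eq_bigr => k _; rewrite mulrA; congr (_ * _).
  by have /rowP/(_ k) := xv; rewrite mxE [RHS]mxE.
rewrite dE pmulr_rge0// in mono.
rewrite quad_form.
have bnd k : `|v ord0 k * (nx - n0) ord0 (lift j k) - s * (v ord0 k * (v *m M) ord0 k)| <=
    s * (e / (n%:R * S + 1) * S).
  have -> : v ord0 k * (nx - n0) ord0 (lift j k) - s * (v ord0 k * (v *m M) ord0 k) =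
     v ord0 k * ((nx - n0) ord0 (lift j k) - (col' j (x - x0) *m M) ord0 k).
    have -> : (col' j (x - x0) *m M) ord0 k = s * (v *m M) ord0 k.
      by rewrite xv -scalemxAl mxE.
    by move: ((v *m M) _ _) => q; ring.
  rewrite normrM; apply: le_trans (ler_wpM2l (normr_ge0 _) (HH k)) _.
  rewrite xv normrZ gtr0_norm//.
  have -> : `|v ord0 k| * (e / (n%:R * S + 1) * (s * `|v|)) =
     s * (e / (n%:R * S + 1) * (`|v ord0 k| * `|v|)) by ring.
  by rewrite ler_pM2l// ler_pM2l// norm_sqr_le.
have := sum_norm_le bnd; rewrite sumrB -mulr_sumr.
set A := \sum_k _; set B := \sum_k _ => h.
have : n%:R * (s * (e / (n%:R * S + 1) * S)) <= s * e.
  have -> : n%:R * (s * (e / (n%:R * S + 1) * S)) = s * e * (n%:R * S / (n%:R * S + 1)) by ring.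
  by rewrite ger_pMr ?mulr_gt0// ler_pdivrMr ?ltr_wpDl// mul1r lerDl.
move=> h2; move: (le_trans h h2); rewrite ler_norml => /andP[h3 h4].
by rewrite -(ler_pM2l s0) mulrN; move: mono; rewrite -/A; lra.
Qed.

End CurvaturePositive.

(** * Uniform linearisation over a class of normals *)

Section UniformExpansion.
Variables (R : realType) (n : nat).
Notation V := 'rV[R]_n.+1.
Variable K : set V.
Hypothesis cK : Defs.convex_set K.

(** The normal has maximum norm 1, attained at coordinate [j] with sign [sg]. Any nonzero normal can
    be rescaled into one of these 2d classes. *)
Definition unit_normal (j : 'I_n.+1) (sg : R) (x nu : V) : Prop :=
  [/\ supports K x nu, nu ord0 j = sg & forall i, `|nu ord0 i| <= 1].

Definition linearizes (j : 'I_n.+1) (sg e : R) (x0 : V) (r : R) (M : 'M[R]_n) : Prop :=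
  forall x y nu mu, `|x - x0| < r -> `|y - x0| < r ->
    unit_normal j sg x nu -> unit_normal j sg y mu ->
    forall k, `|(nu - mu) ord0 (lift j k) - (col' j (x - y) *m M) ord0 k| <=
              e * `|col' j (x - y)|.

Definition psd (M : 'M[R]_n) : Prop :=
  M^T = M /\ forall v : 'rV[R]_n, 0 <= (v *m M *m v^T) ord0 ord0.

Lemma psd0 : psd 0.
Proof. by split => [|v]; [rewrite trmx0|rewrite mulmx0 mul0mx mxE]. Qed.

(** Only centres where [sg * partial j f] is positive carry curvature. Near interior points, and
    near boundary points where it is nonpositive, no normal of the class exists and the matrix 0
    serves vacuously. *)
Lemma linearizes_local j sg e x0 : (sg = 1 \/ sg = -1) -> C2_boundary K -> 0 < e ->
  K x0 -> exists r M, [/\ 0 < r, psd M & linearizes j sg e x0 r M].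
Proof.
move=> sg1 C2K e0 Kx0.
have [intx|nint] := pselect ((K°) x0).
  have : nbhs x0 K by [].
  rewrite -filter_from_ballE => -[r /= r0 rK].
  exists (r / 2), 0; split; [by rewrite divr_gt0|exact: psd0|].
  move=> x y nu mu xr _ [[Kx snu] nuj _] _; exfalso.
  (* Moving from [x] along the axis in the direction [sg] stays inside [K], contradicting the
     support at [x]. *)
  pose z := x + (r / 2) *: (sg *: evec R j).
  have Kz : K z.
    apply: rK; rewrite -ball_normE /ball_/= /z opprD addrA.
    apply: le_lt_trans (ler_normB _ _) _; rewrite normrZ [`|sg *: _|]normrZ (sg_norm sg1) mul1r distrC.
    have : `|r / 2| * `|evec R j| <= r / 2 * 1.
      by rewrite gtr0_norm ?divr_gt0// ler_pM2l ?divr_gt0// norm_evec.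
    lra.
  have := snu _ Kz; rewrite /z addrC addKr !dotZl.
  have -> : dot (evec R j) nu = sg.
    rewrite /dot (sum_lift j) evec_diag mul1r nuj big1 ?addr0// => k _.
    by rewrite evec_lift mul0r.
  by rewrite (sg_sqr sg1); lra.
have [U [f [oU Ux0 cf [i gi] KU]]] := C2K _ Kx0 nint.
have ch : chart K U f x0 by split.
have fx0 : f x0 = 0.
  have fle : f x0 <= 0 by have : (K `&` U) x0 by []; rewrite KU => -[].
  apply/eqP; rewrite eq_le fle leNgt; apply/negP => flt; apply: nint.
  have cfx : {for x0, continuous f}.
    by have [+ _] := cf; rewrite continuous_open_subspace// => /(_ x0); apply; exact: mem_set.
  have nf : 0 < - f x0 by rewrite oppr_gt0.
  have [r1 r10 H1] := continuous_near cfx nf.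
  have [r2 r20 H2] := open_ball oU Ux0.
  rewrite /interior -filter_from_ballE; exists (Num.min r1 r2).
    by rewrite /= lt_min r10; apply: r20.
  move=> y; rewrite -ball_normE/= distrC lt_min => /andP[y1 y2].
  have [] // : (K `&` U) y; rewrite KU; split; first exact: H2.
  by have := H1 _ y1; rewrite ltr_norml; lra.
have [a0|a0] := ltP 0 (sg * partial j f x0).
  have [r r0 H] := normal_expansion sg1 ch a0 e0.
  exists r, (curvature j sg f x0); split => //.
    split; first exact: (curvature_sym _ _ ch).
    by move=> v; exact: (curvature_psd cK sg1 v ch fx0 a0).
  move=> x y nu mu xr yr [snu nuj _] [smu muj _] k; exact: H.
(* A normal of the class at a nearby [x] would make [sg * partial j f x] at least the size of
   [partial i f x]; but the former is below b/3 and the latter above 2b/3. *)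
pose b := `|partial i f x0|.
have b0 : 0 < b by rewrite normr_gt0.
have b30 : 0 < b / 3 by rewrite divr_gt0.
have [r1 r10 H1] := continuous_near_all (fun i => @C2_partial_continuous _ _ K U f x0 i ch) b30.
have [r2 r20 H2] := open_ball oU Ux0.
exists (Num.min r1 r2), 0; split; [by rewrite lt_min r10|exact: psd0|].
move=> x y nu mu; rewrite lt_min => /andP[xr1 xr2] _ [snu nuj nu1] _; exfalso.
have Ux := H2 _ xr2.
have gb : 2 * b / 3 < `|partial i f x|.
  have := H1 x i xr1; rewrite -/b => h.
  have := lerB_dist (partial i f x0) (partial i f x); rewrite distrC -/b; lra.
have g0 : grad f x != 0.
  apply/eqP => /rowP/(_ i); rewrite !mxE => h; move: gb; rewrite h normr0; lra.
have [c c0 nuE] := normal_unique oU Ux cf KU snu g0.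
have nuiE l : nu ord0 l = c * partial l f x by rewrite nuE !mxE.
have cb : c * (sg * partial j f x) = 1 by rewrite mulrCA -nuiE nuj (sg_sqr sg1).
have c1 : 0 < c.
  by rewrite lt0r c0 andbT; apply: contraPneq cb => ->; rewrite mul0r => /esym/eqP; rewrite oner_eq0.
have : c * `|partial i f x| <= c * (sg * partial j f x).
  by rewrite cb -[X in X * _](gtr0_norm c1) -normrM -nuiE nu1.
rewrite ler_pM2l// => h.
have : `|sg * partial j f x - sg * partial j f x0| < b / 3.
  by rewrite -mulrBr normrM (sg_norm sg1) mul1r; exact: H1.
by rewrite ltr_norml; lra.
Qed.

(** Compactness makes the radius uniform: a matrix valid on a ball about [x] is also valid on
    half-size balls about nearby centres. *)
Lemma linearizes_uniform j sg e : (sg = 1 \/ sg = -1) -> compact K -> C2_boundary K ->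
  0 < e -> exists2 r, 0 < r &
    forall x0, K x0 -> exists2 M, psd M & linearizes j sg e x0 r M.
Proof.
move=> sg1 compK C2K e0.
have /compact_near_coveringP := compK.
move=> /(_ R (0^'+) (fun r x0 => exists2 M, psd M & linearizes j sg e x0 r M) _).
case=> [x Kx|r /= r0 H].
  have [r [M [r0 pM lM]]] := linearizes_local j sg1 C2K e0 Kx.
  exists (ball x (r / 2), [set s | s < r / 2]).
    split => /=; first by apply: nbhsx_ballx; rewrite divr_gt0.
    by apply: nbhs_right_lt; rewrite divr_gt0.
  move=> [y s] /= []; rewrite -ball_normE/= => yx sr.
  exists M => // u w nu mu us ws; apply: lM.
    by rewrite -(subrKA y); apply: le_lt_trans (ler_normD _ _) _; rewrite [`|y - x|]distrC; lra.
  by rewrite -(subrKA y); apply: le_lt_trans (ler_normD _ _) _; rewrite [`|y - x|]distrC; lra.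
have r20 : 0 < r / 2 by rewrite divr_gt0.
exists (r / 2) => // x Kx; apply: H => //=.
by rewrite sub0r normrN gtr0_norm//; lra.
Qed.

End UniformExpansion.

(** * Number of patches bounded by the volume of a shell *)

Section ShellCount.
Variables (R : realType) (n : nat).
Notation V := 'rV[R]_n.+1.

Lemma truncn_eq (a b : nat) (h w : R) : 0 < h ->
  h * a%:R <= w < h * a%:R + h -> h * b%:R <= w < h * b%:R + h -> a = b.
Proof.
move=> h0 /andP[a1 a2] /andP[b1 b2].
have lt (p q : nat) : h * p%:R <= w -> w < h * q%:R + h -> (p <= q)%N.
  move=> h1 h2; have := le_lt_trans h1 h2.
  by rewrite -[X in _ < _ + X]mulr1 -mulrDr ltr_pM2l// natr1 ltr_nat.
by apply/eqP; rewrite eqn_leq !lt.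
Qed.

(** Over each point stands a slab of base [de ^+ n] and height t/4 inside the shell. As outer
    measure is not known to be additive here, [K] is covered by the grid cells meeting it, and those
    same cells together with the slabs are packed in the parallel body; subtracting removes the
    grid. *)
Lemma shell_count (K : set V) (j : 'I_n.+1) (sg : R) (T : finType) (x nu : T -> V)
    (c : T -> 'rV[R]_n) (de t M : R) :
  (sg = 1 \/ sg = -1) -> (forall z, K z -> forall i, `|z ord0 i| <= M) ->
  0 < de -> 0 < t -> n%:R * de <= t / 8 ->
  (forall P, unit_normal K j sg (x P) (nu P)) ->
  (forall P k, c P ord0 k <= x P ord0 (lift j k) < c P ord0 k + de) ->
  (forall P P' (u : 'rV[R]_n), (forall k, c P ord0 k <= u ord0 k < c P ord0 k + de) ->
     (forall k, c P' ord0 k <= u ord0 k < c P' ord0 k + de) -> P = P') ->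
  #|T|%:R * (de ^+ n * (t / 4)) <= volume (parallel_body K t) - volume K.
Proof.
move=> sg1 KM de0 t0 nde un cx cdisj.
pose D : R := n.+1%:R.
have D0 : 0 < D by rewrite ltr0n.
have D1 : 1 <= D by rewrite ler1n.
(* This mesh makes two points of one grid cell differ by at most t/16 in the sum of coordinates,
   less than the gap that [sepGS] exploits. *)
pose h := t / (16 * D).
have h0 : 0 < h by rewrite divr_gt0// mulr_gt0.
have Dh : D * h = t / 16 by rewrite /h; field; rewrite gt_eqF.
pose M0 := `|M|.
have KM0 z : K z -> forall i, - M0 <= z ord0 i <= M0.
  by move=> /KM h1 i; rewrite -ler_norml; apply: le_trans (h1 i) (ler_norm _).
pose m := (Num.truncn (2 * M0 / h)).+1.
pose glo (k : {ffun 'I_n.+1 -> 'I_m}) : V := \row_i (- M0 + h * (k i)%:R).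
pose inG k (y : V) := forall i, glo k ord0 i <= y ord0 i < glo k ord0 i + h.
pose act k := `[< exists2 z, K z & inG k z >].
pose G := {k : {ffun 'I_n.+1 -> 'I_m} | act k}.
have Kcov z : K z -> exists k : G, inG (val k) z.
  move=> Kz; have zM := KM0 z Kz.
  have w0 i : 0 <= (z ord0 i + M0) / h by rewrite divr_ge0 ?(ltW h0)//; have := zM i; lra.
  have wm i : (Num.truncn ((z ord0 i + M0) / h) < m)%N.
    rewrite ltnS; apply: le_truncn; rewrite ler_pM2r ?invr_gt0//; have := zM i; lra.
  pose k := [ffun i => Ordinal (wm i)].
  have kz : inG k z.
    move=> i; rewrite mxE ffunE/=.
    have /andP[] := truncn_itv (w0 i); set q := Num.truncn _.
    rewrite ler_pdivlMr// ltr_pdivrMr// -natr1 mulrDl mul1r [_ * h]mulrC; lra.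
  have ak : act k by apply/asboolP; exists z.
  by exists (Sub k ak).
have sub_supp P (y z : V) : K z ->
    sg * (y ord0 j - x P ord0 j) - \sum_(k < n) `|(y - x P) ord0 (lift j k)| <=
    \sum_i `|(y - z) ord0 i|.
  move=> Kz; have [[Kx sx] nuj nu1] := un P.
  have nuN (w : V) : dot w (nu P) <= \sum_i `|w ord0 i|.
    apply: ler_sum => i _; apply: le_trans (ler_norm _) _.
    by rewrite normrM ler_piMr.
  have := nuN (y - z); have -> : y - z = (y - x P) - (z - x P) by rewrite opprB addrA subrK.
  rewrite dotBl; have := sx z Kz.
  have : sg * (y ord0 j - x P ord0 j) - \sum_(k < n) `|(y - x P) ord0 (lift j k)| <=
      dot (y - x P) (nu P).
    rewrite /dot (sum_lift j) nuj ![in leRHS]mxE -sumrN mulrC lerD// ler_sum// => k _.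
    rewrite lerNl -mulrN; apply: le_trans (ler_norm _) _.
    by rewrite normrM normrN ler_piMr.
  lra.
(* Heights between t/4 and t/2 are measured outward along [sg], so for the sign -1 the lower end of
   the slab is at -(t/2). *)
pose sh : R := if sg == 1 then t / 4 else - (t / 2).
pose slo P : V := \row_i oapp (c P ord0) (x P ord0 j + sh) (unlift j i).
pose sga (i : 'I_n.+1) : R := oapp (fun=> de) (t / 4) (unlift j i).
have sga0 i : 0 <= sga i by rewrite /sga; case: unlift => [k|]/=; rewrite ?divr_ge0 ?(ltW t0)// ltW.
have inS P (y : V) : (forall i, slo P ord0 i <= y ord0 i < slo P ord0 i + sga i) ->
  [/\ forall k, c P ord0 k <= y ord0 (lift j k) < c P ord0 k + de,
      t / 4 <= sg * (y ord0 j - x P ord0 j) <= t / 2,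
      `|y ord0 j - x P ord0 j| <= t / 2 &
      \sum_(k < n) `|(y - x P) ord0 (lift j k)| <= t / 8].
  move=> hy.
  have yk k : c P ord0 k <= y ord0 (lift j k) < c P ord0 k + de.
    by have := hy (lift j k); rewrite mxE /sga liftK.
  have yj : t / 4 <= sg * (y ord0 j - x P ord0 j) <= t / 2.
    have := hy j; rewrite mxE /sga unlift_none /= /sh.
    case: sg1 => ->; first by rewrite eqxx; lra.
    by rewrite -subr_eq0 (_ : -1 - 1 = - 2 :> R) ?oppr_eq0 ?pnatr_eq0/=; lra.
  split => //.
    have : `|sg * (y ord0 j - x P ord0 j)| <= t / 2 by rewrite ger0_norm; lra.
    by rewrite normrM (sg_norm sg1) mul1r.
  apply: le_trans nde; rewrite mulr_natl -[X in _ *+ X]card_ord -sumr_const.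
  apply: ler_sum => k _; rewrite !mxE.
  by have := yk k; have := cx P k; rewrite ler_norml; lra.
have par_fin : leb_outer (parallel_body K t) \is a fin_num.
  apply: (@leb_outer_fin_num _ _ _ (M0 + t)) => y [z Kz yz] i.
  have := coord_le_enorm (y - z) i; rewrite !mxE => h1.
  have := KM0 z Kz i; have := le_trans h1 yz; rewrite !ler_norml; lra.
have K_fin : leb_outer K \is a fin_num by exact: leb_outer_fin_num KM.
pose flo (p : G + T) := match p with inl k => glo (val k) | inr P => slo P end.
pose fga (p : G + T) (i : 'I_n.+1) := match p with inl k => h | inr P => sga i end.
have close k (y z : V) : inG k y -> inG k z -> \sum_i `|(y - z) ord0 i| <= t / 16.
  move=> hy hz; rewrite -Dh /D mulr_natl -[X in _ *+ X]card_ord -sumr_const.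
  apply: ler_sum => i _; rewrite !mxE.
  by have := hy i; have := hz i; rewrite ler_norml; lra.
(* A slab point is at least t/4 - t/8 beyond the supporting hyperplane in the sense of [sub_supp],
   while a point of an active grid cell is within t/16 of [K]. *)
have sepGS k P (y : V) : act k -> inG k y ->
    (forall i, slo P ord0 i <= y ord0 i < slo P ord0 i + sga i) -> False.
  move=> /asboolP[z Kz kz] ky /inS[_ yj _ ys].
  have := sub_supp P y z Kz; have := close k y z ky kz; lra.
have := @leb_outer_ge_packing R (G + T)%type n.+1 (parallel_body K t) flo fga.
rewrite (@big_sumType _ _ _ G T xpredT) /=.
have -> : \sum_(P : T) \prod_i sga i = #|T|%:R * (de ^+ n * (t / 4)).
  rewrite sumr_const mulr_natl (bigD1_ord j)//= /sga unlift_none/= mulrC.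
  under eq_bigr do rewrite liftK/=.
  by rewrite prodr_const card_ord.
have GK := @leb_outer_le_boxes R G n K (fun k => glo (val k)) (fun _ _ => h).
have {}GK : (leb_outer K <= (\sum_(k : G) \prod_(i < n.+1) h)%:E)%E.
  apply: GK => [_ _|z Kz]; first exact: ltW.
  by have [k hk] := Kcov z Kz; exists k => i; have /andP[-> /ltW] := hk i.
move=> H; have {}H := H _ _ _.
rewrite lerBrDl /volume; move: GK; rewrite -(fineK K_fin) lee_fin => GK.
rewrite -lee_fin (fineK par_fin); apply: le_trans (H _ _ _).
- by rewrite lee_fin lerD2r.
- by move=> [k|P] i /=; [exact: ltW|].
- move=> [k|P] y /= hy.
    have /asboolP[z Kz kz] := valP k; exists z => //.
    by apply: le_trans (enorm_le_sum _) _; have := close _ _ _ hy kz; lra.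
  have [_ _ yj ys] := inS P y hy; exists (x P); first by have [[]] := un P.
  apply: le_trans (enorm_le_sum _) _; rewrite (sum_lift j).
  by have -> : (y - x P) ord0 j = y ord0 j - x P ord0 j; [rewrite !mxE|lra].
- move=> [k|P] [k'|P'] y /= h1 h2.
  + congr inl; apply/val_inj/ffunP => i; apply/val_inj => /=.
    apply: (@truncn_eq _ _ h (y ord0 i + M0)) => //.
      by have := h1 i; rewrite mxE; lra.
    by have := h2 i; rewrite mxE; lra.
  + by case: (sepGS (val k) P' y (valP k) h1 h2).
  + by case: (sepGS (val k') P y (valP k') h2 h1).
  + congr inr; have [c1 _ _ _] := inS P y h1; have [c2 _ _ _] := inS P' y h2.
    by apply: (cdisj P P' (col' j y)) => k; rewrite mxE.
Qed.

End ShellCount.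

(** * Finite selection, AM-GM, and packings of triangular cells *)

Section Counting.
Variable R : realType.

(** A list of maximal length with distinct keys exists because lengths are bounded, and maximality
    makes it meet every key. It turns a counting bound into a finite cover, both for patches and for
    cells. *)
Lemma finite_representatives (T X : eqType) (good : T -> Prop) (key : T -> X) (b : R) :
  (forall s : seq T, {in s, forall p, good p} -> uniq (map key s) -> (size s)%:R <= b) ->
  exists s : seq T, [/\ {in s, forall p, good p}, uniq (map key s), (size s)%:R <= b &
    forall p, good p -> exists2 p', p' \in s & key p' = key p].
Proof.
move=> bound.
pose Q m := `[< exists s : seq T,
  [/\ {in s, forall p, good p}, uniq (map key s) & size s = m] >].
have exQ : exists m, Q m by exists 0%N; apply/asboolP; exists [::].
have b0 : 0 <= b by have := bound [::]; apply.
have ubQ m : Q m -> (m <= Num.truncn b)%N.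
  move=> /asboolP[s [gs us <-]]; rewrite truncn_ge_nat//; exact: bound.
case: (ex_maxnP exQ ubQ) => m /asboolP[s [gs us sm]] maxm.
exists s; split => // [|p gp]; first exact: bound.
apply: contrapT => np.
have kp : key p \notin map key s.
  by apply/negP => /mapP[p' p's E]; apply: np; exists p'.
have : Q m.+1.
  apply/asboolP; exists (p :: s); split; last by rewrite /= sm.
    by move=> q; rewrite inE => /predU1P[->//|]; exact: gs.
  by rewrite /= kp.
by move=> /maxm; rewrite ltnn.
Qed.

Lemma floor_bounds (x : R) : (Num.floor x)%:~R <= x < (Num.floor x)%:~R + 1.
Proof. by have := floor_itv x; rewrite intrD. Qed.

Lemma floor_cell (x b : R) : 0 < b ->
  (Num.floor (x / b))%:~R * b <= x < (Num.floor (x / b))%:~R * b + b.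
Proof.
move=> b0; have /andP[h1 h2] := floor_bounds (x / b).
move: h1 h2; rewrite ler_pdivlMr// ltr_pdivrMr// mulrDl mul1r => -> ->.
by [].
Qed.

Lemma cell_unique (a c : int) (w b : R) : 0 < b ->
  a%:~R * b <= w < a%:~R * b + b -> c%:~R * b <= w < c%:~R * b + b -> a = c.
Proof.
move=> b0 /andP[a1 a2] /andP[c1 c2].
have lt (p q : int) : p%:~R * b <= w -> w < q%:~R * b + b -> (p <= q)%R.
  move=> h1 h2; have := le_lt_trans h1 h2.
  rewrite -[X in _ < _ + X]mul1r -mulrDl ltr_pM2r// -[1]/(1%:~R) -intrD ltr_int.
  by rewrite ltzD1.
by apply/eqP; rewrite eq_le !lt.
Qed.

(** Sum 2 <= th * a + 1 / (th * a) over the index set. *)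
Lemma amgm_card (T : finType) (a : T -> R) (th X Y : R) : (forall i, 0 < a i) -> 0 < th ->
  \sum_i a i <= X -> \sum_i (a i)^-1 <= Y -> #|T|%:R <= (th * X + Y / th) / 2.
Proof.
move=> a0 th0 aX aY; rewrite ler_pdivlMr//.
apply: le_trans (_ : th * (\sum_i a i) + (\sum_i (a i)^-1) / th <= _); last first.
  by rewrite lerD// ?ler_pM2l// ler_pM2r// invr_gt0.
rewrite mulr_sumr mulr_suml -big_split/=.
have -> : #|T|%:R * 2 = \sum_(i : T) 2 :> R by rewrite sumr_const mulr_natl.
apply: ler_sum => i _; have := sqr_ge0 (th * a i - 1).
have p0 : 0 < th * a i by exact: mulr_gt0.
move=> h; rewrite -(ler_pM2l p0) -subr_ge0.
have -> // : th * a i * (th * a i + (a i)^-1 / th) - th * a i * 2 = (th * a i - 1) ^+ 2.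
by have := a0 i; move: th0 => /lt0r_neq0 ? /lt0r_neq0 ?; field; apply/andP.
Qed.

Section Triangular.
Variable n : nat.
Implicit Types (B G : 'M[R]_n).

(** Solving the [k]-th inequality for [u ord0 k] gives an interval whose end depends on later
    coordinates only, since [B] is upper triangular; cells with distinct integer labels are
    disjoint. *)
Lemma upper_cells_packing (T : finType) B (be : 'I_n -> R) (o : 'rV[R]_n)
    (cell : T -> 'I_n -> int) (rho : R) :
  (forall i l : 'I_n, (l < i)%N -> B i l = 0) -> (forall i, B i i = 1) ->
  (forall k, 0 < be k) -> 0 <= rho ->
  (forall i i', cell i =1 cell i' -> i = i') ->
  (forall i (u : 'rV[R]_n), (forall k, (cell i k)%:~R * be k <= ((u - o) *m B^T) ord0 k
      < (cell i k)%:~R * be k + be k) -> forall k, `|(u - o) ord0 k| <= rho) ->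
  #|T|%:R * \prod_k be k <= (2 * rho) ^+ n.
Proof.
move=> Btri Bdiag be0 rho0 inj inbox.
have zE (u : 'rV[R]_n) k : ((u - o) *m B^T) ord0 k =
    (u - o) ord0 k + \sum_(l < n | l != k) (u - o) ord0 l * B k l.
  rewrite mxE (bigD1 k)//= [B^T k k]mxE Bdiag mulr1; congr (_ + _).
  by apply: eq_bigr => l _; rewrite [B^T l k]mxE.
pose al i (k : 'I_n) (u : 'rV[R]_n) :=
  (cell i k)%:~R * be k + o ord0 k - \sum_(l < n | l != k) (u - o) ord0 l * B k l.
have memE i k (u : 'rV[R]_n) : (al i k u <= u ord0 k < al i k u + be k) =
    ((cell i k)%:~R * be k <= ((u - o) *m B^T) ord0 k < (cell i k)%:~R * be k + be k).
  rewrite zE /al [(u - o) ord0 k]mxE [(- o) ord0 k]mxE; set S := \sum_(_ < _ | _) _.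
  by congr (_ && _); apply/idP/idP; lra.
have E : \prod_(i < n) ((\row_k (o ord0 k + rho)) ord0 i -
    (\row_k (o ord0 k - rho)) ord0 i) = (2 * rho) ^+ n.
  transitivity (\prod_(i < n) (2 * rho)); last by rewrite prodr_const card_ord.
  by apply: eq_bigr => k _; rewrite !mxE; ring.
have -> : #|T|%:R * \prod_k be k = \sum_(i : T) \prod_k be k.
  by rewrite sumr_const mulr_natl.
rewrite -[leRHS]mul1r -E.
apply: (@triangular_packing_box_rev R T n 1 al (fun _ => be)).
- by move=> _ k; exact: ltW.
- by move=> k; rewrite !mxE; lra.
- move=> i k u u' uu'; rewrite /al; congr (_ - _); apply: eq_bigr => l lk.
  have [lk'|kl] := ltnP l k; first by rewrite Btri// !mulr0.
  by rewrite !mxE uu'// ltn_neqAle eq_sym lk.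
- move=> u i h k; rewrite !mxE.
  have := inbox i u (fun k => etrans (esym (memE i k u)) (h k)) k.
  by rewrite !mxE ler_norml; lra.
- move=> u A hA; rewrite leqNgt; apply/negP => /card_gt1P[i [i' [iA i'A /eqP]]].
  apply; apply: inj => k.
  by apply: (@cell_unique _ _ (((u - o) *m B^T) ord0 k) (be k)) => //; rewrite -memE hA.
Qed.

(** Multiplying a row vector on the right by an upper triangular [G] mixes in earlier coordinates
    only. Each cell may have its own frame, so overlap is controlled by [W] and not by labels. *)
Lemma lower_cells_packing (T : finType) (W : nat) (G : T -> 'M[R]_n)
    (o lo : T -> 'rV[R]_n) (ga : T -> 'I_n -> R) (b : R) :
  (forall t (i l : 'I_n), (l < i)%N -> G t i l = 0) -> (forall t i, G t i i = 1) ->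
  (forall t k, 0 <= ga t k) -> 0 <= b ->
  (forall t (y : 'rV[R]_n), (forall k, lo t ord0 k <= ((y - o t) *m G t) ord0 k
      < lo t ord0 k + ga t k) -> forall k, `|y ord0 k| <= b) ->
  (forall (y : 'rV[R]_n) (A : {set T}), (forall t, t \in A -> forall k,
      lo t ord0 k <= ((y - o t) *m G t) ord0 k < lo t ord0 k + ga t k) ->
     (#|A| <= W)%N) ->
  \sum_t \prod_k ga t k <= W%:R * (2 * b) ^+ n.
Proof.
move=> Gtri Gdiag ga0 b0 inbox mult.
have zE t (y : 'rV[R]_n) k : ((y - o t) *m G t) ord0 k =
    (y - o t) ord0 k + \sum_(l < n | l != k) (y - o t) ord0 l * G t l k.
  by rewrite mxE (bigD1 k)//= Gdiag mulr1.
pose al t (k : 'I_n) (y : 'rV[R]_n) :=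
  lo t ord0 k + o t ord0 k - \sum_(l < n | l != k) (y - o t) ord0 l * G t l k.
have memE t k (y : 'rV[R]_n) : (al t k y <= y ord0 k < al t k y + ga t k) =
    (lo t ord0 k <= ((y - o t) *m G t) ord0 k < lo t ord0 k + ga t k).
  rewrite zE /al [(y - o t) ord0 k]mxE [(- o t) ord0 k]mxE; set S := \sum_(_ < _ | _) _.
  by congr (_ && _); apply/idP/idP; lra.
have := @triangular_packing_box R T n W al ga (const_mx (- b)) (const_mx b).
have -> : \prod_(i < n) ((const_mx b : 'rV[R]_n) ord0 i - (const_mx (- b) : 'rV[R]_n) ord0 i)
    = (2 * b) ^+ n.
  transitivity (\prod_(i < n) (2 * b)); last by rewrite prodr_const card_ord.
  by apply: eq_bigr => k _; rewrite !mxE; ring.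
apply => //.
- by move=> k; rewrite !mxE; lra.
- move=> t k u u' uu'; rewrite /al; congr (_ - _); apply: eq_bigr => l lk.
  have [lk'|kl] := ltnP k l; first by rewrite Gtri// !mulr0.
  by rewrite !mxE uu'// ltn_neqAle lk.
- move=> u i h k; rewrite !mxE.
  by rewrite -ler_norml; apply: (inbox i u) => l; rewrite -memE.
- by move=> u A hA; apply: (mult u) => t tA k; rewrite -memE hA.
Qed.

Lemma LDL_quad (A B : 'M[R]_n) (D v : 'rV[R]_n) : A = B^T *m diag_mx D *m B ->
  (v *m A *m v^T) ord0 ord0 = \sum_k D ord0 k * (v *m B^T) ord0 k ^+ 2.
Proof.
move=> ->; have -> : v *m (B^T *m diag_mx D *m B) *m v^T =
    (v *m B^T) *m diag_mx D *m (v *m B^T)^T by rewrite trmx_mul trmxK !mulmxA.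
rewrite mxE; apply: eq_bigr => k _.
by rewrite mul_mx_diag [(\matrix_(_, _) _) _ _]mxE [(_^T) _ _]mxE; ring.
Qed.

End Triangular.
End Counting.

(** * Metric estimates within one patch *)

Section PatchGeometry.
Variables (R : realType) (n : nat).
Notation V := 'rV[R]_n.+1.
Variables (K : set V) (j : 'I_n.+1) (sg : R).
Hypothesis n0 : (0 < n)%N.
Hypothesis sg1 : sg = 1 \/ sg = -1.

Lemma dot_normals (x y nu mu : V) : nu ord0 j = mu ord0 j ->
  dot (x - y) (nu - mu) = dot (col' j (x - y)) (col' j (nu - mu)).
Proof.
move=> E; rewrite /dot (sum_lift j) [(nu - mu) ord0 j]mxE [(- mu) ord0 j]mxE E subrr.
by rewrite mulr0 add0r; apply: eq_bigr => k _; rewrite [col' j _ _ _]mxE [col' j (nu - mu) _ _]mxE.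
Qed.

(** The two supporting inequalities bound the [j]-th coordinate of [x - y] from both sides, as its
    coefficients there are [sg] and the other entries are at most 1: the points of a class form a
    Lipschitz graph. *)
Lemma unit_normal_close x y nu mu : unit_normal K j sg x nu -> unit_normal K j sg y mu ->
  `|x - y| <= n%:R * `|col' j (x - y)|.
Proof.
move=> [[Kx sx] nuj nu1] [[Ky sy] muj mu1].
set s := `|col' j (x - y)|.
have s0 : 0 <= s by exact: normr_ge0.
have n1 : 1 <= n%:R :> R by rewrite ler1n.
have Ds k : `|(x - y) ord0 (lift j k)| <= s.
  by have := coord_le_norm (col' j (x - y)) k; rewrite [X in `|X| <= _]mxE.
have ns0 : 0 <= n%:R * s by rewrite mulr_ge0.
apply: norm_le_coord => // i; have [k ->|->] := unliftP j i.
  by apply: le_trans (Ds k) _; rewrite ler_peMl.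
have bnd (w : V) : (forall i, `|w ord0 i| <= 1) ->
    `|\sum_(k < n) (x - y) ord0 (lift j k) * w ord0 (lift j k)| <= n%:R * s.
  by move=> w1; apply: sum_norm_le => k; rewrite normrM -[s]mulr1 ler_pM.
have := sx y Ky; rewrite -opprB dotNl oppr_le0 /dot (sum_lift j) nuj => h1.
have := sy x Kx; rewrite /dot (sum_lift j) muj => h2.
have := bnd _ nu1; have := bnd _ mu1.
have -> : `|(x - y) ord0 j| = `|(x - y) ord0 j * sg|.
  by rewrite normrM (sg_norm sg1) mulr1.
by rewrite !ler_norml; lra.
Qed.

Section Linearized.
Variables (eta tau r : R) (x0 : V) (M : 'M[R]_n).
Hypothesis tau0 : 0 < tau.
Hypothesis tau_eta : n%:R * tau <= eta.
Hypothesis lin : linearizes K j sg tau x0 r M.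
Let A := M + eta%:M.

Definition shifted_normal (x nu : V) : 'rV[R]_n := eta *: col' j x + col' j nu.

Lemma quad_shift (v : 'rV[R]_n) :
  (v *m A *m v^T) ord0 ord0 = (v *m M *m v^T) ord0 ord0 + eta * \sum_k v ord0 k ^+ 2.
Proof.
rewrite /A mulmxDr mulmxDl mxE; congr (_ + _).
rewrite mul_mx_scalar -scalemxAl mxE; congr (_ * _); rewrite mxE.
by apply: eq_bigr => k _; rewrite [v^T k ord0]mxE.
Qed.

(** The linearisation error is at most n * tau times the squared length of [d], which the term [eta]
    of [A] absorbs. *)
Lemma same_cell_dot x y nu mu : `|x - x0| < r -> `|y - x0| < r ->
  unit_normal K j sg x nu -> unit_normal K j sg y mu ->
  forall d : 'rV[R]_n, d = col' j (x - y) ->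
  dot (x - y) (nu - mu) <= (d *m A *m d^T) ord0 ord0.
Proof.
move=> xr yr ux uy d dE; have [_ nuj _] := ux; have [_ muj _] := uy.
rewrite dot_normals ?nuj// -dE quad_shift quad_form /dot.
have S0 : 0 <= \sum_k d ord0 k ^+ 2 by apply: sumr_ge0 => k _; exact: sqr_ge0.
have bnd k : `|d ord0 k * col' j (nu - mu) ord0 k - d ord0 k * (d *m M) ord0 k| <=
    tau * \sum_k d ord0 k ^+ 2.
  rewrite -mulrBr normrM [col' j (nu - mu) _ _]mxE.
  have := lin xr yr ux uy k; rewrite -dE => /(ler_wpM2l (normr_ge0 (d ord0 k)))/le_trans; apply.
  by rewrite mulrCA ler_pM2l// norm_sqr_le.
have := sum_norm_le bnd; rewrite sumrB ler_norml => /andP[_ h].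
have : n%:R * (tau * \sum_k d ord0 k ^+ 2) <= eta * \sum_k d ord0 k ^+ 2.
  by rewrite mulrA ler_wpM2r.
lra.
Qed.

Lemma shifted_normal_expansion x y nu mu : `|x - x0| < r -> `|y - x0| < r ->
  unit_normal K j sg x nu -> unit_normal K j sg y mu ->
  forall d : 'rV[R]_n, d = col' j (x - y) ->
  `|shifted_normal x nu - shifted_normal y mu - d *m A| <= tau * `|d|.
Proof.
move=> xr yr ux uy d dE; apply: norm_le_coord; first by rewrite mulr_ge0// ltW.
move=> k; have := lin xr yr ux uy k; rewrite -dE.
have -> : (shifted_normal x nu - shifted_normal y mu - d *m A) ord0 k =
    (nu - mu) ord0 (lift j k) - (d *m M) ord0 k.
  rewrite /A mulmxDr mul_mx_scalar.
  have -> : (shifted_normal x nu - shifted_normal y mu - (d *m M + eta *: d)) ord0 k =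
    shifted_normal x nu ord0 k - shifted_normal y mu ord0 k
      - ((d *m M) ord0 k + eta * d ord0 k).
    by rewrite mxE [(- (d *m M + _)) _ _]mxE [(d *m M + _) _ _]mxE [(eta *: d) _ _]mxE
       [(shifted_normal x nu - _) _ _]mxE [(- shifted_normal y mu) _ _]mxE.
  move: ((d *m M) ord0 k) => q; rewrite /shifted_normal dE !mxE; ring.
by [].
Qed.

End Linearized.

(** The normals contribute nonnegatively by monotonicity, so [eta] alone bounds the increment below.
    This separates images even when the points lie in different patches, where no common
    linearisation is available. *)
Lemma shifted_normal_monotone eta x y nu mu (b : R) : 0 < eta ->
  unit_normal K j sg x nu -> unit_normal K j sg y mu ->
  `|shifted_normal eta x nu - shifted_normal eta y mu| <= b ->
  eta * `|col' j (x - y)| <= n%:R * b.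
Proof.
move=> eta0 ux uy hb; set d := col' j (x - y).
have [sx nuj _] := ux; have [sy muj _] := uy.
have b0 : 0 <= b by apply: le_trans hb.
have [d0|d0] := eqVneq `|d| 0; first by rewrite d0 mulr0 mulr_ge0.
have dp : 0 < `|d| by rewrite lt0r d0 normr_ge0.
have := supports_monotone sx sy; rewrite dot_normals ?nuj// -/d => mono.
have E : shifted_normal eta x nu - shifted_normal eta y mu = eta *: d + col' j (nu - mu).
  by apply/rowP => k; rewrite /shifted_normal /d !mxE; ring.
have h1 : eta * dot d d <= dot d (shifted_normal eta x nu - shifted_normal eta y mu).
  by rewrite E dotDr dotZr lerDl.
have h2 := le_trans h1 (le_trans (ler_norm _) (le_dot _ _)).
have h3 : \sum_l `|d ord0 l| <= n%:R * `|d|.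
  apply: le_trans (ler_sum _ (fun k _ => coord_le_norm d k)) _.
  by rewrite sumr_const card_ord mulr_natl.
have h4 : eta * `|d| ^+ 2 <= b * (n%:R * `|d|).
  apply: le_trans (le_trans h2 (ler_pM _ _ hb h3)); rewrite ?sumr_ge0//.
  rewrite ler_pM2l//.
  have s0 : 0 <= dot d d by exact: dot_ge0.
  rewrite -[leRHS](sqr_sqrtr s0) lerXn2r ?nnegrE ?sqrtr_ge0//.
  apply: norm_le_coord => [|i]; first exact: sqrtr_ge0.
  rewrite -sqrtr_sqr ler_sqrt// /dot (bigD1 i)//= expr2 lerDl.
  by apply: sumr_ge0 => k _; rewrite -expr2 sqr_ge0.
rewrite -(ler_pM2r dp); apply: le_trans (le_trans _ h4) _.
  by rewrite expr2 mulrA.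
by rewrite mulrCA mulrA.
Qed.

(** The form dominates [eta] times the squared length, so vectors with form O(eps) shrink with eps,
    and so do their images under the fixed matrix. *)
Lemma small_cells (A : 'M[R]_n) (eta ka : R) : 0 < eta -> 0 < ka ->
  (forall d : 'rV[R]_n, eta * \sum_k d ord0 k ^+ 2 <= (d *m A *m d^T) ord0 ord0) ->
  exists2 e, 0 < e & forall eps, 0 < eps <= e -> forall d : 'rV[R]_n,
    (d *m A *m d^T) ord0 ord0 <= n%:R * eps ->
    `|d| <= ka /\ `|d *m A| <= ka.
Proof.
move=> eta0 ka0 Apos; pose a := \sum_k \sum_l `|A k l|.
have a0 : 0 <= a by apply: sumr_ge0 => k _; exact: sumr_ge0.
have a1 : 0 < a + 1 by lra.
pose rho := ka / (a + 1).
have rho0 : 0 < rho by rewrite divr_gt0.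
have rhoka : rho * (a + 1) = ka by rewrite /rho divfK// gt_eqF.
have nR : 0 < n%:R :> R by rewrite ltr0n.
have rr0 : 0 < rho ^+ 2 by rewrite exprn_gt0.
exists (eta * rho ^+ 2 / n%:R) => [|eps /andP[e0 ele] d dA].
  by rewrite divr_gt0// mulr_gt0.
have S : \sum_k d ord0 k ^+ 2 <= rho ^+ 2.
  rewrite -(ler_pM2l eta0); apply: le_trans (Apos d) _; apply: le_trans dA _.
  by move: ele; rewrite ler_pdivlMr// mulrC.
have dr : `|d| <= rho.
  apply: norm_le_coord => [|k]; first exact: ltW.
  rewrite -(ger0_norm (ltW rho0)) -ler_sqr ?nnegrE// !real_normK ?num_real//.
  apply: le_trans S; rewrite (bigD1 k)//= lerDl sumr_ge0// => l _; exact: sqr_ge0.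
have ra : 0 <= rho * a by rewrite mulr_ge0// ltW.
have rk : rho <= ka by lra.
have rak : rho * a <= ka by lra.
split; first exact: le_trans rk.
apply: norm_le_coord => [|k]; first exact: ltW.
apply: le_trans rak; rewrite mxE; apply: le_trans (ler_norm_sum _ _ _) _.
rewrite /a mulr_sumr; apply: ler_sum => l _; rewrite normrM ler_pM//.
  exact: le_trans (coord_le_norm d l) dr.
exact: norm_le_sum (A l) k.
Qed.

End PatchGeometry.

(** Adjacent grid cubes with equal parities coincide, so at most 2^n cubes can be pairwise
    adjacent. *)
Lemma parity_inj (a b : int) : (`|a - b| <= 1)%R -> odd `|a|%N = odd `|b|%N -> a = b.
Proof. lia. Qed.

(** * Patches as grid cubes of the projection, and their data *)

Section ClassCover.
Variables (R : realType) (n : nat).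
Notation V := 'rV[R]_n.+1.
Variables (K : set V) (j : 'I_n.+1) (sg : R).
Hypothesis n0 : (0 < n)%N.
Hypothesis sg1 : sg = 1 \/ sg = -1.

Let good (p : V * V) : Prop := unit_normal K j sg p.1 p.2.
Let p0 : V * V := (0, 0).

Definition patch_key (de : R) (p : V * V) : {ffun 'I_n -> int} :=
  [ffun k => Num.floor (p.1 ord0 (lift j k) / de)].

(** One point is kept per grid cube, so the slabs of [shell_count] stand over disjoint bases and the
    factor t cancels from both sides. *)
Lemma patch_representatives (M t de E : R) :
  (forall z, K z -> forall i, `|z ord0 i| <= M) -> 0 < t -> 0 < de ->
  n%:R * de <= t / 8 -> volume (parallel_body K t) - volume K <= t * E ->
  exists s : seq (V * V), [/\ {in s, forall p, good p}, uniq (map (patch_key de) s),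
    (size s)%:R * de ^+ n <= 4 * E &
    forall p, good p -> exists2 p', p' \in s & patch_key de p' = patch_key de p].
Proof.
move=> KM t0 de0 nde vol.
have den0 : 0 < de ^+ n by rewrite exprn_gt0.
have bound (s : seq (V * V)) : {in s, forall p, good p} -> uniq (map (patch_key de) s) ->
    (size s)%:R <= 4 * E / de ^+ n.
  move=> gs us; pose pt (i : 'I_(size s)) := nth p0 s i.
  have gpt i : good (pt i) by apply: gs; exact: mem_nth.
  have := @shell_count R n K j sg 'I_(size s) (fun i => (pt i).1) (fun i => (pt i).2)
    (fun i => \row_k ((patch_key de (pt i) k)%:~R * de)) de t M sg1 KM de0 t0 nde gpt.
  rewrite card_ord => H.
  have := le_trans (H _ _) vol; rewrite ler_pdivlMr//.
  have -> : (size s)%:R * (de ^+ n * (t / 4)) = t * ((size s)%:R * de ^+ n / 4) by ring.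
  rewrite ler_pM2l// => {}H.
  suff : (size s)%:R * de ^+ n / 4 <= E by lra.
  apply: H.
    by move=> i k; rewrite !mxE ffunE; exact: floor_cell.
  move=> i i' u h1 h2; apply: val_inj; apply/eqP => /=.
  rewrite -(nth_uniq (patch_key de p0) _ _ us) ?size_map//.
  rewrite !(nth_map p0)//; apply/eqP/ffunP => k.
  apply: (@cell_unique _ _ _ (u ord0 k) de) => //.
    by have := h1 k; rewrite mxE.
  by have := h2 k; rewrite mxE.
have [s [gs us sz rep]] := finite_representatives bound.
by exists s; split => //; move: sz; rewrite ler_pdivlMr.
Qed.

Lemma patch_key_close (de : R) p q : 0 < de -> patch_key de p = patch_key de q ->
  `|col' j (p.1 - q.1)| <= de.
Proof.
move=> de0 /ffunP E; apply: norm_le_coord => [|k]; first exact: ltW.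
have := floor_cell (p.1 ord0 (lift j k)) de0; have := floor_cell (q.1 ord0 (lift j k)) de0.
have := E k; rewrite !ffunE => ->; rewrite !mxE ler_norml; lra.
Qed.

Lemma patch_key_neighbors (de : R) p q : 0 < de -> `|col' j (p.1 - q.1)| < de ->
  forall k, (`|patch_key de p k - patch_key de q k| <= 1)%R.
Proof.
move=> de0 pq k; rewrite !ffunE.
have /andP[a1 a2] := floor_cell (p.1 ord0 (lift j k)) de0.
have /andP[b1 b2] := floor_cell (q.1 ord0 (lift j k)) de0.
have := le_lt_trans (coord_le_norm (col' j (p.1 - q.1)) k) pq.
rewrite !mxE ltr_norml => /andP[c1 c2].
move: a1 a2 b1 b2; set a := Num.floor _; set b := Num.floor _ => a1 a2 b1 b2.
have lt2 (u v : int) : u%:~R * de < v%:~R * de + de + de -> (u <= v + 1)%R.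
  have -> : v%:~R * de + de + de = (v + 2)%:~R * de by rewrite intrD; ring.
  by rewrite ltr_pM2r// ltr_int; lia.
have h1 : (a <= b + 1)%R by apply: lt2; lra.
have h2 : (b <= a + 1)%R by apply: lt2; lra.
lia.
Qed.

Definition patch_data (eta tau r : R) (x : V)
    (q : 'M[R]_n * 'M[R]_n * 'M[R]_n * 'rV[R]_n) : Prop :=
  let: (M, B, G, D) := q in
  [/\ psd M, linearizes K j sg tau x r M, M + eta%:M = B^T *m diag_mx D *m B,
      B *m G = 1%:M & [/\ forall i, 0 < D ord0 i,
        forall i l : 'I_n, (l < i)%N -> B i l = 0 /\ G i l = 0 &
        forall i, B i i = 1 /\ G i i = 1]].

Lemma psd_shift_ge (eta : R) (M : 'M[R]_n) (v : 'rV[R]_n) : psd M ->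
  eta * \sum_k v ord0 k ^+ 2 <= (v *m (M + eta%:M) *m v^T) ord0 ord0.
Proof. by move=> [_ pM]; rewrite quad_shift lerDr. Qed.

Lemma patch_data_exists (eta tau r : R) : 0 < eta ->
  (forall x, K x -> exists2 M, psd M & linearizes K j sg tau x r M) ->
  forall x, K x -> exists q, patch_data eta tau r x q.
Proof.
move=> eta0 lin x Kx.
have [M pM lM] := lin x Kx.
have Asym : (M + eta%:M)^T = M + eta%:M.
  by rewrite linearD/= tr_scalar_mx; have [-> _] := pM.
have Apos (v : 'rV[R]_n) : v != 0 -> 0 < (v *m (M + eta%:M) *m v^T) ord0 ord0.
  move=> v0; apply: lt_le_trans (psd_shift_ge eta v pM); rewrite mulr_gt0//.
  rewrite lt0r sumr_ge0 ?andbT => [|k _]; last exact: sqr_ge0.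
  apply: contra v0; rewrite psumr_eq0 => [/allP h|k _]; last exact: sqr_ge0.
  apply/eqP/rowP => k; rewrite mxE; apply/eqP.
  by have := h k (mem_index_enum _); rewrite /= sqrf_eq0.
have [B [G [D [AE BG D0 tri diag]]]] := pos_def_LDL Asym Apos.
by exists (M, B, G, D).
Qed.

End ClassCover.

(** * Counting the cells of all patches of a class *)

Section CellCount.
Variables (R : realType) (n : nat).
Notation V := 'rV[R]_n.+1.
Variables (K : set V) (j : 'I_n.+1) (sg : R).
Hypothesis n0 : (0 < n)%N.
Hypothesis sg1 : sg = 1 \/ sg = -1.

Let good (p : V * V) : Prop := unit_normal K j sg p.1 p.2.
Let p0 : V * V := (0, 0).

Variables (eta tau r de eps ka : R) (s1 : seq (V * V)).
Variable data : nat -> 'M[R]_n * 'M[R]_n * 'M[R]_n * 'rV[R]_n.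
Hypothesis eta0 : 0 < eta.
Hypothesis eta1 : eta <= 1.
Hypothesis tauE : 8 * n%:R * tau = eta.
Hypothesis de0 : 0 < de.
Hypothesis de1 : de <= 1.
Hypothesis nde : n%:R * de < r.
Hypothesis eps0 : 0 < eps.
Hypothesis Kbd : forall z, K z -> forall i, eta * `|z ord0 i| <= 1.
Hypothesis s1good : {in s1, forall p, good p}.
Hypothesis s1cover : forall p, good p -> patch_key j de p \in map (patch_key j de) s1.
Let ctr (P : nat) : V := (nth p0 s1 P).1.
Hypothesis dataP : forall P, (P < size s1)%N -> patch_data K j sg eta tau r (ctr P) (data P).
Let MM P := (data P).1.1.1.
Let BB P := (data P).1.1.2.
Let GG P := (data P).1.2.
Let DD P := (data P).2.
Let AA P := MM P + eta%:M.
Hypothesis kade : ka <= tau * de.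
Hypothesis small : forall P, (P < size s1)%N -> forall d : 'rV[R]_n,
  (d *m AA P *m d^T) ord0 ord0 <= n%:R * eps -> `|d| <= ka /\ `|d *m AA P| <= ka.

Let nR : 1 <= n%:R :> R. Proof. by rewrite ler1n. Qed.

Let tau0 : 0 < tau.
Proof. by have := eta0; rewrite -tauE pmulr_rgt0// mulr_gt0// ltr0n. Qed.

Let ntau : n%:R * tau = eta / 8.
Proof. by rewrite -tauE; field. Qed.

Let tau8 : tau <= eta / 8.
Proof. by rewrite -ntau ler_peMl// ltW. Qed.

Let dataE P : (P < size s1)%N ->
  [/\ psd (MM P), linearizes K j sg tau (ctr P) r (MM P),
      AA P = (BB P)^T *m diag_mx (DD P) *m BB P,
      BB P *m GG P = 1%:M & [/\ forall i, 0 < DD P ord0 i,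
        forall i l : 'I_n, (l < i)%N -> BB P i l = 0 /\ GG P i l = 0 &
        forall i, BB P i i = 1 /\ GG P i i = 1]].
Proof.
by move=> /dataP; rewrite /AA /MM /BB /GG /DD; case: (data P) => [[[M B] G] D].
Qed.

Definition patch_index (p : V * V) : nat :=
  index (patch_key j de p) (map (patch_key j de) s1).

(** Chosen so that each diagonal term of the form contributes at most [eps]. The corresponding image
    side, D_k times the mesh, is sqrt(eps * D_k). *)
Definition mesh (P : nat) (k : 'I_n) : R := Num.sqrt (eps / (data P).2 ord0 k).

Definition cell_coord (P : nat) (x : V) : 'rV[R]_n :=
  col' j (x - (nth p0 s1 P).1) *m ((data P).1.1.2)^T.

Definition cell_index (p : V * V) : {ffun 'I_n -> int} :=
  [ffun k => Num.floor (cell_coord (patch_index p) p.1 ord0 k / mesh (patch_index p) k)].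

Definition cell_key (p : V * V) : nat * {ffun 'I_n -> int} :=
  (patch_index p, cell_index p).

Let pidx_lt p : good p -> (patch_index p < size s1)%N.
Proof. by move=> /s1cover; rewrite -index_mem size_map. Qed.

Let ctr_good p : good p -> good (nth p0 s1 (patch_index p)).
Proof. by move=> gp; apply: s1good; apply: mem_nth; exact: pidx_lt. Qed.

Let ctr_key p : good p -> patch_key j de (nth p0 s1 (patch_index p)) = patch_key j de p.
Proof.
move=> gp; rewrite -(nth_map p0 (patch_key j de p0)) ?pidx_lt//.
by apply: nth_index; exact: s1cover.
Qed.

Let ctr_close p : good p -> `|col' j (p.1 - ctr (patch_index p))| <= de.
Proof. by move=> gp; apply: patch_key_close => //; rewrite ctr_key. Qed.

Let ctr_r p : good p -> `|p.1 - ctr (patch_index p)| < r.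
Proof.
move=> gp; apply: le_lt_trans nde.
apply: le_trans (unit_normal_close n0 sg1 gp (ctr_good gp)) _.
by rewrite ler_wpM2l// ctr_close.
Qed.

Let mesh_gt0 P k : (P < size s1)%N -> 0 < mesh P k.
Proof. by move=> /dataE[_ _ _ _ [D0 _ _]]; rewrite sqrtr_gt0 divr_gt0//; exact: D0. Qed.

Let mesh_sqr P k : (P < size s1)%N -> DD P ord0 k * mesh P k ^+ 2 = eps.
Proof.
move=> /dataE[_ _ _ _ [D0 _ _]]; rewrite sqr_sqrtr ?divr_ge0 ?(ltW eps0) ?(ltW (D0 k))//.
by rewrite mulrCA divff ?mulr1// gt_eqF//; exact: D0.
Qed.

Let cell_quad P (v w : 'rV[R]_n) (c : 'I_n -> R) : (P < size s1)%N ->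
  (forall k, c k <= (v *m (BB P)^T) ord0 k < c k + mesh P k) ->
  (forall k, c k <= (w *m (BB P)^T) ord0 k < c k + mesh P k) ->
  ((v - w) *m AA P *m (v - w)^T) ord0 ord0 <= n%:R * eps.
Proof.
move=> Ps hv hw; have [_ _ AE _ [D0 _ _]] := dataE Ps.
rewrite (LDL_quad _ AE).
have -> : n%:R * eps = \sum_(k < n) DD P ord0 k * mesh P k ^+ 2.
  rewrite (eq_bigr (fun=> eps)) => [|k _]; last exact: mesh_sqr.
  by rewrite sumr_const card_ord mulr_natl.
apply: ler_sum => k _; rewrite ler_pM2l//.
have -> : ((v - w) *m (BB P)^T) ord0 k = (v *m (BB P)^T) ord0 k - (w *m (BB P)^T) ord0 k.
  by rewrite mulmxBl; move: (v *m _) (w *m _) => a b; rewrite !mxE.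
rewrite -[leLHS]real_normK ?num_real//.
rewrite lerXn2r ?nnegrE// ?(ltW (mesh_gt0 _ Ps))// ler_norml.
by have := hv k; have := hw k; lra.
Qed.

Let cell_itv p k : good p ->
  (cell_index p k)%:~R * mesh (patch_index p) k <=
    (col' j (p.1 - ctr (patch_index p)) *m (BB (patch_index p))^T) ord0 k <
  (cell_index p k)%:~R * mesh (patch_index p) k + mesh (patch_index p) k.
Proof.
by move=> gp; rewrite ffunE; apply: floor_cell; apply: mesh_gt0; exact: pidx_lt.
Qed.

(** The difference of normals is [d *m A], minus [eta *: d], plus the linearisation error; each is
    at most [ka], whence the factor 3. *)
Lemma same_cell p p' : good p -> good p' -> cell_key p = cell_key p' ->
  dot (p.1 - p'.1) (p.2 - p'.2) <= n%:R * eps /\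
  forall i, `|p.2 ord0 i - p'.2 ord0 i| <= 3 * ka.
Proof.
move=> gp gp' [Pe ce]; have Ps := pidx_lt gp.
have [pM lin _ _ _] := dataE Ps.
pose d := col' j (p.1 - p'.1).
have dE : d = col' j (p.1 - ctr (patch_index p)) - col' j (p'.1 - ctr (patch_index p)).
  by apply/rowP => k; rewrite !mxE; ring.
have qd : (d *m AA (patch_index p) *m d^T) ord0 ord0 <= n%:R * eps.
  rewrite dE; apply: (cell_quad (c := fun k => (cell_index p k)%:~R * mesh (patch_index p) k)) => // k.
    exact: cell_itv.
  by rewrite Pe ce; exact: cell_itv.
have pr := ctr_r gp; have p'r : `|p'.1 - ctr (patch_index p)| < r.
  by rewrite Pe; exact: ctr_r.
split.
  apply: le_trans qd; apply: (same_cell_dot tau0 _ lin pr p'r gp gp') => //.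
  by rewrite ntau; have := eta0; lra.
have [dka dAka] := small Ps qd.
have ka0 : 0 <= ka by apply: le_trans dka.
have [_ pj _] := gp; have [_ p'j _] := gp'.
move=> i; have [k ->|->] := unliftP j i; last first.
  by rewrite pj p'j subrr normr0 mulr_ge0.
have := shifted_normal_expansion eta tau0 lin pr p'r gp gp' (erefl d).
move=> h; have := le_trans (coord_le_norm _ k) h.
set S := shifted_normal _ _ _ _ - _.
have -> : (S - d *m AA (patch_index p)) ord0 k =
    (p.2 ord0 (lift j k) - p'.2 ord0 (lift j k)) + eta * d ord0 k
      - (d *m AA (patch_index p)) ord0 k.
  rewrite [LHS]mxE [(- (d *m _)) _ _]mxE; congr (_ - _).
  by rewrite /S /shifted_normal /d !mxE; ring.
have h1 : `|eta * d ord0 k| <= ka.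
  rewrite normrM gtr0_norm// -[ka]mul1r ler_pM ?(ltW eta0)//.
  exact: le_trans (coord_le_norm d k) dka.
have h2 : `|(d *m AA (patch_index p)) ord0 k| <= ka.
  exact: le_trans (coord_le_norm _ k) dAka.
have h3 : tau * `|d| <= ka.
  rewrite -[ka]mul1r ler_pM ?(ltW tau0)//; have := tau8; have := eta1; have := eta0; lra.
move=> h4; move: h1 h2 (le_trans h4 h3); rewrite !ler_norml; lra.
Qed.

Section Bound.
Variable s : seq (V * V).
Hypothesis sgood : {in s, forall p, good p}.
Hypothesis suniq : uniq (map cell_key s).

Let pt (i : 'I_(size s)) := nth p0 s i.
Let ptgood i : good (pt i). Proof. by apply: sgood; exact: mem_nth. Qed.
Let PP i := patch_index (pt i).
Let PPs i : (PP i < size s1)%N. Proof. exact: pidx_lt. Qed.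

Let pt_inj i i' : PP i = PP i' -> cell_index (pt i) = cell_index (pt i') -> i = i'.
Proof.
move=> Pe ce; apply: val_inj; apply/eqP => /=.
rewrite -(nth_uniq (cell_key p0) _ _ suniq) ?size_map//.
by rewrite !(nth_map p0)//; apply/eqP; congr (_, _).
Qed.

(** The cells of a patch lie within 2 * de of its centre: [de] for the patch and [ka <= de] for the
    cell. They are disjoint, so each patch contributes at most the volume of a cube of side 4 *
    de. *)
Let mesh_sum : \sum_i \prod_k mesh (PP i) k <= (size s1)%:R * (4 * de) ^+ n.
Proof.
rewrite (partition_big (fun i => Ordinal (PPs i)) xpredT)//=.
apply: le_trans (_ : \sum_(P < size s1) (4 * de) ^+ n <= _); last first.
  by rewrite sumr_const card_ord -[leLHS]mulr_natl.
apply: ler_sum => P _.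
rewrite (eq_bigr (fun=> \prod_k mesh P k)) => [|i /eqP <-//].
rewrite sumr_const -[leLHS]mulr_natl.
pose T := {i : 'I_(size s) | Ordinal (PPs i) == P}.
have -> : #|[pred i | Ordinal (PPs i) == P]| = #|{: T}| by rewrite card_sig.
have TP (t : T) : PP (val t) = P by have /eqP/(congr1 val) := valP t.
have Ps := ltn_ord P.
have [_ _ AE _ [D0 tri diag]] := dataE Ps.
have -> : 4 * de = 2 * (2 * de) by ring.
apply: (upper_cells_packing (B := BB P) (o := col' j (ctr P))
  (cell := fun (t : T) k => cell_index (pt (val t)) k)).
- by move=> i l /tri[].
- by move=> i; have [] := diag i.
- by move=> k; exact: mesh_gt0.
- by rewrite mulr_ge0// ltW.
- move=> t t' h; apply: val_inj; apply: pt_inj; first by rewrite !TP.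
  by apply/ffunP => k; exact: h.
- move=> t u h k.
  pose v := col' j ((pt (val t)).1 - ctr P).
  have hv l : (cell_index (pt (val t)) l)%:~R * mesh P l <= (v *m (BB P)^T) ord0 l
      < (cell_index (pt (val t)) l)%:~R * mesh P l + mesh P l.
    by rewrite /v -(TP t); exact: cell_itv.
  have [dk _] := small Ps (cell_quad Ps h hv).
  have vde : `|v| <= de by rewrite /v -(TP t); exact: ctr_close.
  have tde : tau * de <= de by rewrite ger_pMl//; have := tau8; have := eta1; have := eta0; lra.
  have -> : u - col' j (ctr P) = (u - col' j (ctr P) - v) + v by rewrite subrK.
  apply: le_trans (coord_le_norm _ k) _; apply: le_trans (ler_normD _ _) _; have := kade; lra.
Qed.

(** Pulling [y] back through the linear map gives a vector in the same domain cell as the chosen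
    point. The cell size and the linearisation error each contribute tau * de. *)
Let image_close i (y : 'rV[R]_n) :
  (forall k, DD (PP i) ord0 k * ((cell_index (pt i) k)%:~R * mesh (PP i) k) <=
     ((y - shifted_normal j eta (ctr (PP i)) (nth p0 s1 (PP i)).2) *m GG (PP i)) ord0 k <
     DD (PP i) ord0 k * ((cell_index (pt i) k)%:~R * mesh (PP i) k) +
     DD (PP i) ord0 k * mesh (PP i) k) ->
  `|y - shifted_normal j eta (pt i).1 (pt i).2| <= 2 * (tau * de).
Proof.
set P := PP i; set o := shifted_normal _ _ _ _ => h.
have Ps : (P < size s1)%N by exact: PPs.
have [_ lin AE BG [D0 _ _]] := dataE Ps.
have GB : GG P *m BB P = 1%:M by exact: mulmx1C.
pose w := (y - o) *m GG P.
pose wd : 'rV[R]_n := \row_k (w ord0 k / DD P ord0 k).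
(* [v] is the preimage of [y - o] under [AA P], obtained by dividing by the diagonal and applying
   the inverse of the triangular factor. *)
pose v := wd *m (GG P)^T.
have vB : v *m (BB P)^T = wd by rewrite /v -mulmxA -trmx_mul BG trmx1 mulmx1.
have vA : v *m AA P = y - o.
  rewrite AE !mulmxA vB.
  have -> : wd *m diag_mx (DD P) = w.
    by apply/rowP => k; rewrite mul_mx_diag !mxE divfK// gt_eqF.
  by rewrite /w -mulmxA GB mulmx1.
pose vx := col' j ((pt i).1 - ctr P).
have hv k : (cell_index (pt i) k)%:~R * mesh P k <= (v *m (BB P)^T) ord0 k
    < (cell_index (pt i) k)%:~R * mesh P k + mesh P k.
  rewrite vB mxE ler_pdivlMr// ltr_pdivrMr// mulrDl ![_ * DD P ord0 k]mulrC.
  exact: h.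
have hvx k : (cell_index (pt i) k)%:~R * mesh P k <= (vx *m (BB P)^T) ord0 k
    < (cell_index (pt i) k)%:~R * mesh P k + mesh P k by exact: cell_itv.
have [_ dA] := small Ps (cell_quad Ps hv hvx).
have gc : good (nth p0 s1 P) by exact: ctr_good.
have cr : `|ctr P - ctr P| < r.
  by rewrite subrr normr0; apply: le_lt_trans nde; rewrite mulr_ge0// ltW.
have exp := shifted_normal_expansion eta tau0 lin (ctr_r (ptgood i)) cr (ptgood i) gc
  (erefl _).
rewrite -/vx -/o -/(AA P) in exp.
have vxde : `|vx| <= de by exact: ctr_close.
have {}exp := le_trans exp (ler_wpM2l (ltW tau0) vxde).
have -> : y - shifted_normal j eta (pt i).1 (pt i).2 =
  (v - vx) *m AA P - (shifted_normal j eta (pt i).1 (pt i).2 - o - vx *m AA P).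
  rewrite mulmxBl vA; apply/rowP => k.
  move: (vx *m _) (shifted_normal _ _ _ _) => a b; rewrite !mxE; ring.
apply: le_trans (ler_normB _ _) _; have := kade; lra.
Qed.

(** If image cells meet, the shifted normals differ by at most 4 * tau * de, so strong monotonicity
    puts the projections within de / 2. Their grid cubes are then adjacent, and equal parities force
    the same patch. *)
Let mult (y : 'rV[R]_n) (A : {set 'I_(size s)}) :
  (forall i, i \in A -> `|y - shifted_normal j eta (pt i).1 (pt i).2| <= 2 * (tau * de)) ->
  (forall i i', i \in A -> i' \in A -> PP i = PP i' -> i = i') ->
  (#|A| <= 2 ^ n)%N.
Proof.
move=> close sep.
pose par (i : 'I_(size s)) : {ffun 'I_n -> bool} :=
  [ffun k => odd `|patch_key j de (pt i) k|%N].
have -> : (2 ^ n)%N = #|{ffun 'I_n -> bool}| by rewrite card_ffun card_bool card_ord.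
rewrite -(card_in_imset (f := par)) ?max_card// => i i' iA i'A /ffunP pe.
apply: sep => //.
suff ke : patch_key j de (pt i) = patch_key j de (pt i') by rewrite /PP /patch_index ke.
have hb : `|shifted_normal j eta (pt i).1 (pt i).2 -
    shifted_normal j eta (pt i').1 (pt i').2| <= 4 * (tau * de).
  have -> : shifted_normal j eta (pt i).1 (pt i).2 -
    shifted_normal j eta (pt i').1 (pt i').2 =
    (y - shifted_normal j eta (pt i').1 (pt i').2) -
    (y - shifted_normal j eta (pt i).1 (pt i).2).
    by rewrite opprB [RHS]addrC addrA subrK.
  apply: le_trans (ler_normB _ _) _.
  by have := close i iA; have := close i' i'A; lra.
have := shifted_normal_monotone eta0 (ptgood i) (ptgood i') hb.
have -> : n%:R * (4 * (tau * de)) = eta * (de / 2).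
  have -> : n%:R * (4 * (tau * de)) = 4 * (n%:R * tau) * de by ring.
  by rewrite ntau; field.
rewrite ler_pM2l// => dle.
have dlt : `|col' j ((pt i).1 - (pt i').1)| < de by have := de0; lra.
apply/ffunP => k; apply: parity_inj; first exact: patch_key_neighbors.
by have := pe k; rewrite !ffunE.
Qed.

(** Shifted normals have entries at most 1 + 1 and image cells add at most 1/4, so all images lie in
    the cube of side 6. *)
Let image_sum : \sum_i \prod_k (DD (PP i) ord0 k * mesh (PP i) k) <= (2 ^ n)%:R * 6 ^+ n.
Proof.
have -> : (6 : R) = 2 * 3 by ring.
apply: (lower_cells_packing (G := fun i => GG (PP i))
  (o := fun i => shifted_normal j eta (ctr (PP i)) (nth p0 s1 (PP i)).2)
  (lo := fun i => \row_k (DD (PP i) ord0 k * ((cell_index (pt i) k)%:~R * mesh (PP i) k)))).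
- by move=> i k l lk; have [_ _ _ _ [_ tri _]] := dataE (PPs i); have [] := tri k l lk.
- by move=> i k; have [_ _ _ _ [_ _ diag]] := dataE (PPs i); have [] := diag k.
- move=> i k; have [_ _ _ _ [D0 _ _]] := dataE (PPs i).
  by rewrite mulr_ge0// ltW// mesh_gt0.
- by [].
- move=> i y h k.
  have := @image_close i y (fun k => _).
  have {}h l := h l.
  move=> /(_ _)/(le_trans (coord_le_norm _ k)) hc.
  have {}hc : `|(y - shifted_normal j eta (pt i).1 (pt i).2) ord0 k| <= 2 * (tau * de).
    by apply: hc => l; have := h l; rewrite mxE.
  have [[Kp _] _ nu1] := ptgood i.
  have h1 : `|shifted_normal j eta (pt i).1 (pt i).2 ord0 k| <= 2.
    rewrite /shifted_normal !mxE; apply: le_trans (ler_normD _ _) _.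
    rewrite normrM gtr0_norm//; have := Kbd Kp (lift j k); have := nu1 (lift j k); lra.
  have h2 : tau * de <= 1 / 8.
    rewrite -[1 / 8]mulr1 ler_pM ?(ltW tau0) ?(ltW de0)//; have := tau8; have := eta1; have := eta0; lra.
  have subE (a b : 'rV[R]_n) : (a - b) ord0 k = a ord0 k - b ord0 k by rewrite !mxE.
  by move: hc h1; rewrite subE !ler_norml; lra.
- move=> y A hA; apply: (mult (y := y)).
    by move=> i iA; apply: image_close => k; have := hA i iA k; rewrite mxE.
  move=> i i' iA i'A Pe; apply: (pt_inj Pe); apply/ffunP => k.
  have Ps := PPs i.
  have [_ _ _ _ [D0 _ _]] := dataE Ps.
  have b0 : 0 < DD (PP i) ord0 k * mesh (PP i) k by rewrite mulr_gt0// mesh_gt0.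
  pose w := ((y - shifted_normal j eta (ctr (PP i)) (nth p0 s1 (PP i)).2)
    *m GG (PP i)) ord0 k.
  apply: (@cell_unique _ _ _ w _ b0).
    by have := hA i iA k; rewrite -/w mxE mulrCA.
  by have := hA i' i'A k; rewrite -Pe -/w mxE mulrCA.
Qed.

(** Since the triangular factor has unit diagonal, [a i] is the square root of the determinant of
    the shifted curvature: the cell sum carries its inverse and the image sum carries it directly,
    as AM-GM requires. *)
Lemma cell_count (th : R) : 0 < th ->
  (size s)%:R <= (th * (12 ^+ n / Num.sqrt eps ^+ n) +
    ((size s1)%:R * (4 * de) ^+ n / Num.sqrt eps ^+ n) / th) / 2.
Proof.
move=> th0; pose q := Num.sqrt eps.
have q0 : 0 < q by rewrite sqrtr_gt0.
have qn0 : 0 < q ^+ n by rewrite exprn_gt0.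
pose a i := \prod_k Num.sqrt (DD (PP i) ord0 k).
have sD i k : 0 < Num.sqrt (DD (PP i) ord0 k).
  by have [_ _ _ _ [D0 _ _]] := dataE (PPs i); rewrite sqrtr_gt0.
have meshE i k : mesh (PP i) k = q / Num.sqrt (DD (PP i) ord0 k).
  by rewrite /mesh sqrtrM ?(ltW eps0)// sqrtrV//; have := sD i k; rewrite sqrtr_gt0 => /ltW.
have e1 i : \prod_k mesh (PP i) k = q ^+ n * (a i)^-1.
  rewrite (eq_bigr (fun k => q * (Num.sqrt (DD (PP i) ord0 k))^-1)) => [|k _]; last exact: meshE.
  by rewrite big_split/= prodr_const card_ord prodfV.
have e2 i : \prod_k (DD (PP i) ord0 k * mesh (PP i) k) = q ^+ n * a i.
  rewrite (eq_bigr (fun k => q * Num.sqrt (DD (PP i) ord0 k))) => [|k _].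
    by rewrite big_split/= prodr_const card_ord.
  have h := sD i k; have D0 : 0 <= DD (PP i) ord0 k by move: h; rewrite sqrtr_gt0 => /ltW.
  rewrite meshE -{1}(sqr_sqrtr D0) expr2 mulrCA -mulrA mulrA.
  by rewrite -!mulrA mulfV ?mulr1// gt_eqF.
have := @amgm_card R 'I_(size s) a th (12 ^+ n / q ^+ n)
  ((size s1)%:R * (4 * de) ^+ n / q ^+ n) _ th0; rewrite card_ord; apply.
- by move=> i; apply: prodr_gt0 => k _; exact: sD.
- rewrite ler_pdivlMr// mulr_suml.
  have := image_sum; rewrite (eq_bigr _ (fun i _ => e2 i)) => h.
  rewrite (eq_bigr (fun i => q ^+ n * a i)) => [|i _]; last by rewrite mulrC.
  apply: le_trans h _; rewrite natrX -exprMn.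
  by have -> : 2 * 6 = 12 :> R by ring.
- rewrite ler_pdivlMr// mulr_suml.
  have := mesh_sum; rewrite (eq_bigr _ (fun i _ => e1 i)) => h.
  by rewrite (eq_bigr (fun i => q ^+ n * (a i)^-1)) => [//|i _]; rewrite mulrC.
Qed.

End Bound.
End CellCount.

(** * Choice of parameters and construction of the polytope *)

Section Assembly.
Variables (R : realType) (n : nat).
Notation V := 'rV[R]_n.+1.

(** All parameters are fixed before [eps]: [eta] from the size of [K], [tau] from [eta], the radius
    [r] from [tau], the patch size from [r] and [t0]. The finitely many patches then give the
    threshold for [eps]. *)
Lemma class_cover (K : set V) (j : 'I_n.+1) (sg CS D t0 M : R) :
  (0 < n)%N -> (sg = 1 \/ sg = -1) -> Defs.convex_set K -> compact K -> C2_boundary K ->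
  (forall z, K z -> forall i, `|z ord0 i| <= M) -> 0 < D -> 0 < t0 ->
  volume (parallel_body K t0) - volume K <= t0 * (CS * D ^+ n) ->
  exists2 eps0, 0 < eps0 & forall eps, 0 < eps <= eps0 ->
  exists s : seq (V * V),
    [/\ {in s, forall p, unit_normal K j sg p.1 p.2},
        (size s)%:R <= (12 ^+ n + 4 ^+ n.+1 * CS) / 2 *
                       (Num.sqrt D ^+ n / Num.sqrt eps ^+ n) &
        forall x nu, unit_normal K j sg x nu -> exists2 p, p \in s &
          dot (p.1 - x) (p.2 - nu) <= n%:R * eps /\
          forall i, `|p.2 ord0 i - nu ord0 i| <= (2 * n.+1%:R)^-1].
Proof.
move=> n0 sg1 cK compK C2K KM D0 t00 vol.
have nR : 1 <= n%:R :> R by rewrite ler1n.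
have nR0 : 0 < n%:R :> R by rewrite ltr0n.
have M1 : 0 < `|M| + 1 by rewrite ltr_wpDl.
pose eta := (`|M| + 1)^-1.
have eta0 : 0 < eta by rewrite invr_gt0.
have eta1 : eta <= 1 by rewrite invf_le1// lerDr.
pose tau := eta / (8 * n%:R).
have n8 : 0 < 8 * n%:R :> R by rewrite mulr_gt0.
have tau0 : 0 < tau by rewrite divr_gt0.
have tauE : 8 * n%:R * tau = eta by rewrite /tau mulrC divfK// gt_eqF.
have [r r0 lin] := linearizes_uniform cK j sg1 compK C2K tau0.
pose de := Num.min 1 (Num.min (r / (2 * n%:R)) (t0 / (8 * n%:R))).
have n2 : 0 < 2 * n%:R :> R by rewrite mulr_gt0.
have de0 : 0 < de by rewrite !lt_min ltr01 !divr_gt0.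
have de1 : de <= 1 by rewrite ge_min lexx.
have nder : n%:R * de < r.
  have : de <= r / (2 * n%:R) by rewrite !ge_min lexx !orbT.
  rewrite ler_pdivlMr// => h; have : 2 * (n%:R * de) <= r by rewrite mulrA mulrC.
  by have := mulr_gt0 nR0 de0; lra.
have ndet : n%:R * de <= t0 / 8.
  have : de <= t0 / (8 * n%:R) by rewrite !ge_min lexx !orbT.
  rewrite ler_pdivlMr// => h; have : 8 * (n%:R * de) <= t0 by rewrite mulrA mulrC.
  by lra.
have Kbd z : K z -> forall i, eta * `|z ord0 i| <= 1.
  move=> Kz i; rewrite ler_pdivrMl// mulr1; apply: le_trans (KM z Kz i) _.
  by have := ler_norm M; lra.
have [s1 [s1g _ s1sz s1rep]] := patch_representatives j sg1 KM t00 de0 ndet vol.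
have s1cover p : unit_normal K j sg p.1 p.2 ->
    patch_key j de p \in map (patch_key j de) s1.
  by move=> /s1rep[p' p's <-]; exact: map_f.
have /choice[data dataP] (P : nat) : exists q, (P < size s1)%N ->
    patch_data K j sg eta tau r (nth (0, 0) s1 P).1 q.
  have [Ps|Ps] := ltnP P (size s1); last by exists (0, 0, 0, 0).
  have [[Kx _] _ _] := s1g _ (mem_nth (0, 0) Ps).
  by have [q hq] := patch_data_exists eta0 lin Kx; exists q.
(* The second bound compensates the factor 3 lost in [same_cell] when normals are compared. *)
pose ka := Num.min (tau * de) (6 * n.+1%:R)^-1.
have ka0 : 0 < ka by rewrite lt_min mulr_gt0//= invr_gt0 mulr_gt0.
have kade : ka <= tau * de by rewrite ge_min lexx.
have ka3 : 3 * ka <= (2 * n.+1%:R)^-1.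
  have : ka <= (6 * n.+1%:R)^-1 by rewrite ge_min lexx orbT.
  have -> : (2 * n.+1%:R)^-1 = 3 * (6 * n.+1%:R)^-1 :> R.
    by field; rewrite addrC natr1 pnatr_eq0.
  by rewrite ler_pM2l.
have /choice[ee eeP] (P : nat) : exists e, 0 < e /\ ((P < size s1)%N ->
    forall eps, 0 < eps <= e -> forall d : 'rV[R]_n,
    (d *m ((data P).1.1.1 + eta%:M) *m d^T) ord0 ord0 <= n%:R * eps ->
    `|d| <= ka /\ `|d *m ((data P).1.1.1 + eta%:M)| <= ka).
  have [Ps|Ps] := ltnP P (size s1); last by exists 1.
  have pM : psd (data P).1.1.1.
    by have := dataP P Ps; case: (data P) => [[[? ?] ?] ?] [].
  have [e e0 H] := small_cells n0 eta0 ka0 (fun d => psd_shift_ge eta d pM).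
  by exists e.
exists (\big[Num.min/1]_(P < size s1) ee P).
  by elim/big_ind: _ => // [u v u0 v0|P _]; [rewrite lt_min u0|have [] := eeP P].
move=> eps /andP[eps0 epsle].
have small P : (P < size s1)%N -> forall d : 'rV[R]_n,
    (d *m ((data P).1.1.1 + eta%:M) *m d^T) ord0 ord0 <= n%:R * eps ->
    `|d| <= ka /\ `|d *m ((data P).1.1.1 + eta%:M)| <= ka.
  move=> Ps; have [_ H] := eeP P; apply: H => //; rewrite eps0/=.
  by apply: le_trans epsle _; exact: (bigmin_le_cond _ (j := Ordinal Ps)).
(* This weight balances AM-GM: both terms become multiples of (D / eps)^(n/2). *)
pose q := Num.sqrt eps; pose th := Num.sqrt D ^+ n.
have th0 : 0 < th by rewrite exprn_gt0// sqrtr_gt0.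
have q0 : 0 < q ^+ n by rewrite exprn_gt0// sqrtr_gt0.
have th2 : th * th = D ^+ n by rewrite -exprMn -expr2 sqr_sqrtr// ltW.
have bound (s : seq (V * V)) : {in s, forall p, unit_normal K j sg p.1 p.2} ->
    uniq (map (cell_key j de eps s1 data) s) ->
    (size s)%:R <= (12 ^+ n + 4 ^+ n.+1 * CS) / 2 * (th / q ^+ n).
  move=> sg' su.
  have := cell_count n0 sg1 eta0 eta1 tauE de0 de1 nder eps0 Kbd s1g s1cover dataP kade
    small sg' su th0.
  move=> /le_trans; apply; rewrite -/q.
  have h : (size s1)%:R * (4 * de) ^+ n <= 4 ^+ n.+1 * CS * (th * th).
    rewrite exprMn mulrCA th2 exprS -!mulrA [4 * (4 ^+ n * _)]mulrCA ler_pM2l ?exprn_gt0//.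
  have -> : (12 ^+ n + 4 ^+ n.+1 * CS) / 2 * (th / q ^+ n) =
     (th * (12 ^+ n / q ^+ n) + (4 ^+ n.+1 * CS * (th * th)) / q ^+ n / th) / 2.
    by field; rewrite !gt_eqF.
  rewrite ler_pM2r ?invr_gt0// lerD2l ler_pM2r ?invr_gt0// ler_pM2r ?invr_gt0//.
have [s [gs us sz rep]] := finite_representatives bound.
exists s; split => // x nu un.
have [p ps kp] := rep (x, nu) un.
have [dle close] := same_cell n0 sg1 eta0 eta1 tauE de0 nder eps0 s1g s1cover dataP
  small (p' := (x, nu)) (gs p ps) un kp.
exists p => //; split => // i; apply: le_trans (close i) ka3.
Qed.

(** A minimiser of the squared distance exists by compactness; moving a small step from it towards
    [z] cannot decrease the distance, which gives the variational inequality. *)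
Lemma nearest_point (K : set V) (p : V) : Defs.convex_set K -> compact K -> K !=set0 ->
  exists2 x, K x & forall z, K z -> dot (z - x) (p - x) <= 0.
Proof.
move=> cK compK K0.
pose f (z : V) : R := \sum_i (p ord0 i - z ord0 i) * (p ord0 i - z ord0 i).
have fE z : f z = dot (p - z) (p - z) by apply: eq_bigr => i _; rewrite !mxE.
have cf : continuous f.
  pose g i (z : V) : R := (p ord0 i - z ord0 i) * (p ord0 i - z ord0 i).
  have cg i : continuous (g i).
    have h : continuous (fun z : V => p ord0 i - z ord0 i).
      move=> z; apply: (@continuousB _ _ _ (cst (p ord0 i)) (fun y : V => y ord0 i)).
        exact: cst_continuous.
      exact: coord_continuous.
    by move=> z; apply: (@continuousM _ _ (fun y : V => p ord0 i - y ord0 i)); exact: h.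
  have H (l : seq 'I_n.+1) : continuous (fun z => \sum_(i <- l) g i z).
    elim: l => [|i l IH] z.
      rewrite (_ : (fun _ => _) = cst 0); first exact: cst_continuous.
      by apply/funext => y; rewrite big_nil.
    rewrite (_ : (fun _ => _) = (fun y => g i y + \sum_(k <- l) g k y)).
      apply: (@continuousD _ _ _ (g i) (fun y => \sum_(k <- l) g k y)); first exact: cg.
      exact: IH.
    by apply/funext => y; rewrite big_cons.
  exact: H.
have [x] := compact_EVT_min K0 compK (continuous_subspaceT cf).
rewrite inE => Kx xmin; exists x => // z Kz; set v := z - x; set q := p - x.
apply/ler_addgt0Pr => e e0; rewrite add0r.
have v0 : 0 <= dot v v by exact: dot_ge0.
have v1 : 0 < dot v v + 1 by rewrite ltr_wpDl.
pose l := Num.min 1 (e / (dot v v + 1)).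
have l0 : 0 < l by rewrite lt_min ltr01 divr_gt0.
have l1 : l <= 1 by rewrite ge_min lexx.
have lv : l * dot v v <= e.
  apply: le_trans (_ : e / (dot v v + 1) * dot v v <= _).
    by rewrite ler_wpM2r// ge_min lexx orbT.
  by rewrite mulrAC ler_pdivrMr// ler_pM2l// lerDl.
have := xmin (l *: z + (1 - l) *: x); rewrite inE => /(_ (cK z x Kz Kx l (ltW l0) l1)).
rewrite !fE -/q.
have -> : p - (l *: z + (1 - l) *: x) = q - l *: v.
  by apply/rowP => i; rewrite /q /v !mxE; ring.
have -> (a b : V) : dot (a - l *: b) (a - l *: b) =
    dot a a + l * (l * dot b b - 2 * dot b a).
  by rewrite !dotBl !dotBr !dotZl !dotZr (dotC a b); ring.
by rewrite lerDl pmulr_rge0//; lra.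
Qed.

Lemma compact_coord_bounded (K : set V) : compact K -> K !=set0 ->
  exists M : R, forall z, K z -> forall i, `|z ord0 i| <= M.
Proof.
move=> compK K0.
have cN : continuous (fun z : V => `|z|) by exact: norm_continuous.
have [c _ H] := compact_EVT_max K0 compK (continuous_subspaceT cN).
exists `|c| => z Kz i; apply: le_trans (coord_le_norm _ _) _.
by apply: H; rewrite inE.
Qed.

End Assembly.

Theorem theorem2 (R : realType) (d : nat) (hd : (2 <= d)%N) :
  exists c : R, 0 < c /\
  forall K : set 'rV[R]_d, convex_body K -> C2_boundary K ->
  forall D : R, surface_diameter K D ->
  exists eps0 : R, 0 < eps0 /\
  forall eps : R, 0 < eps -> eps <= eps0 ->
  exists (P : set 'rV[R]_d) (m : nat),
    [/\ polytope_with_le_facets P m,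
        K `<=` P,
        (hausdorff_dist K P <= eps%:E)%E &
        m%:R <= (c * D / eps) `^ ((d.-1)%:R / 2)].
Proof.
case: d hd => // n; rewrite ltnS => n0 /=.
pose N : R := n.+1%:R.
have N0 : 0 < N by rewrite ltr0n.
have N1 : 1 <= N by rewrite ler1n.
pose CS : R := N * 4 ^+ n.+1 + 1.
have CS0 : 0 <= CS by rewrite addr_ge0// mulr_ge0 ?exprn_ge0// ltW.
pose C : R := (12 ^+ n + 4 ^+ n.+1 * CS) / 2.
have C0 : 1 <= C.
  rewrite /C ler_pdivlMr// mul1r.
  have h1 : 1 <= 12 ^+ n :> R by rewrite exprn_ege1// ler1n.
  have h2 : 1 <= 4 ^+ n.+1 * CS.
    by rewrite mulr_ege1 ?exprn_ege1 ?ler1n// lerDr mulr_ge0 ?exprn_ge0// ltW.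
  by rewrite -[2]/(1 + 1); lra.
(* There are 2N classes, each contributing at most C times the common power. *)
pose X := 2 * N * C.
have X1 : 1 <= X.
  by rewrite /X mulr_ege1// mulr_ege1// ler1n.
have X0 : 0 < X by lra.
have NN0 : 0 < 2 * N ^+ 2 by rewrite mulr_gt0// exprn_gt0.
exists (X ^+ 2 * (2 * N ^+ 2)); split; first by rewrite mulr_gt0// exprn_gt0.
move=> K [compK [cK intK]] C2K D hD.
have D0 : 0 < D by case: hD.
have K0 : K !=set0 by have [x hx] := intK; exists x; exact: interior_subset hx.
have [t0 [t00 vol]] := shell_quotient hD.
have {}vol : volume (parallel_body K t0) - volume K <= t0 * (CS * D ^+ n).
  by apply: vol; rewrite t00 lexx.
have [M KM] := compact_coord_bounded compK K0.
pose sg (b : bool) : R := if b then 1 else -1.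
have sg1 b : sg b = 1 \/ sg b = -1 by case: b; [left|right].
have /choice[ee eeP] (jb : 'I_n.+1 * bool) : exists e, 0 < e /\
    forall eps, 0 < eps <= e -> exists s : seq ('rV[R]_n.+1 * 'rV[R]_n.+1),
    [/\ {in s, forall p, unit_normal K jb.1 (sg jb.2) p.1 p.2},
        (size s)%:R <= C * (Num.sqrt D ^+ n / Num.sqrt eps ^+ n) &
        forall x nu, unit_normal K jb.1 (sg jb.2) x nu -> exists2 p, p \in s &
          dot (p.1 - x) (p.2 - nu) <= n%:R * eps /\
          forall i, `|p.2 ord0 i - nu ord0 i| <= (2 * n.+1%:R)^-1].
  have [e e0 H] := class_cover jb.1 n0 (sg1 jb.2) cK compK C2K KM D0 t00 vol.
  by exists e.
exists (\big[Num.min/1]_jb ee jb); split.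
  by elim/big_ind: _ => // [u v u0 v0|i _]; [rewrite lt_min u0|have [] := eeP i].
(* One factor N and the 2 come from bounding the largest coordinate of p - x by 2 * N * e1; the
   other N passes from that coordinate to the Euclidean norm. *)
move=> eps eps0 epsle; pose e1 := eps / (2 * N ^+ 2).
have e10 : 0 < e1 by rewrite divr_gt0.
have e1eps : e1 <= eps.
  by rewrite ler_pdivrMr// ler_pMr// mulr_ege1 ?ler1n// exprn_ege1.
have /choice[ss ssP] jb : exists s : seq ('rV[R]_n.+1 * 'rV[R]_n.+1),
    [/\ {in s, forall p, unit_normal K jb.1 (sg jb.2) p.1 p.2},
        (size s)%:R <= C * (Num.sqrt D ^+ n / Num.sqrt e1 ^+ n) &
        forall x nu, unit_normal K jb.1 (sg jb.2) x nu -> exists2 p, p \in s &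
          dot (p.1 - x) (p.2 - nu) <= n%:R * e1 /\
          forall i, `|p.2 ord0 i - nu ord0 i| <= (2 * n.+1%:R)^-1].
  have [_ H] := eeP jb; apply: H; rewrite e10/=; apply: le_trans e1eps _.
  by apply: le_trans epsle _; exact: bigmin_le_cond.
pose L := flatten [seq ss jb | jb <- enum {: 'I_n.+1 * bool}].
have LE p : p \in L -> exists jb, p \in ss jb.
  by move=> /flattenP[s /mapP[jb _ ->] ps]; exists jb.
have LI jb p : p \in ss jb -> p \in L.
  by move=> ps; apply/flattenP; exists (ss jb) => //; apply: map_f; rewrite mem_enum.
pose pt (k : 'I_(size L)) := nth (0, 0) L k.
pose P := halfspaces_inter (fun k => (pt k).2) (fun k => dot (pt k).2 (pt k).1).
have inP p x : P x -> p \in L -> dot (x - p.1) p.2 <= 0.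
  move=> Px pL; have iL : (index p L < size L)%N by rewrite index_mem.
  have := Px (Ordinal iL); rewrite /pt/= nth_index// -/(dot p.2 x) dotBl !(dotC _ p.2).
  by rewrite subr_le0.
have KP : K `<=` P.
  move=> z Kz k; rewrite -/(dot _ _) -subr_le0 -!(dotC _ (pt k).2) -dotBl.
  have [jb pjb] := LE (pt k) (mem_nth _ (ltn_ord k)).
  by have [gs _ _] := ssP jb; have [[_ h] _ _] := gs _ pjb; exact: h.
(* Besides the Hausdorff bound, this yields the boundedness of [P]. *)
have near p : P p -> exists2 x, K x & enorm (p - x) <= eps.
  move=> Pp; have [x Kx hx] := nearest_point p cK compK K0; exists x => //.
  set q := p - x in hx *.
  have [j _ hj] := @Order.TotalTheory.arg_maxP _ _ _ ord0 xpredT (fun i => `|q ord0 i|) isT.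
  have {}hj i : `|q ord0 i| <= `|q ord0 j| by exact: hj.
  have qs : enorm q <= N * `|q ord0 j|.
    apply: le_trans (enorm_le_sum q) _; apply: le_trans (ler_sum _ (fun i _ => hj i)) _.
    by rewrite sumr_const card_ord mulr_natl.
  have [qj0|qj0] := eqVneq `|q ord0 j| 0.
    by apply: le_trans qs _; rewrite qj0 mulr0 ltW.
  have qj : 0 < `|q ord0 j| by rewrite lt0r qj0 normr_ge0.
  pose b := 0 < q ord0 j; pose nu := `|q ord0 j|^-1 *: q.
  have qE : q = `|q ord0 j| *: nu by rewrite /nu scalerA divff// scale1r.
  have un : unit_normal K j (sg b) x nu.
    split.
    - split => // z Kz; rewrite /nu dotZr mulr_ge0_le0 ?invr_ge0//; exact: hx.
    - rewrite /nu mxE /sg /b; case: (ltgtP 0 (q ord0 j)) => h.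
      + by rewrite gtr0_norm// mulVf// gt_eqF.
      + by rewrite ltr0_norm// invrN mulNr mulVf// lt_eqF.
      + by move: qj; rewrite -h normr0 ltxx.
    - move=> i; rewrite /nu mxE normrM gtr0_norm ?invr_gt0// ler_pdivrMl// mulr1.
      exact: hj.
  have [gs _ rep] := ssP (j, b).
  have [[y mu] ys [/= dle close]] := rep x nu un.
  have [[Ky sy] _ _] := gs _ ys; have [_ _ nu1] := un.
  have Py := inP _ _ Pp (LI _ _ ys).
  have hxy : dot (y - x) nu <= 0 by rewrite /nu dotZr mulr_ge0_le0 ?invr_ge0//; exact: hx.
  (* The pairing of [nu] with itself is at least 1, and replacing one copy by [mu] changes it by at
     most (n+1) / (2 (n+1)). *)
  have nm : 1 / 2 <= dot nu mu.
    have -> : dot nu mu = dot nu nu + dot nu (mu - nu) by rewrite dotBr addrCA subrr addr0.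
    have h1 : 1 <= dot nu nu.
      rewrite /dot (bigD1 j)//=; have [_ nuj _] := un; rewrite nuj.
      rewrite (sg_sqr (sg1 b)).
      by rewrite lerDl sumr_ge0// => i _; rewrite -expr2 sqr_ge0.
    have h2 : `|dot nu (mu - nu)| <= n.+1%:R * (2 * n.+1%:R)^-1.
      apply: sum_norm_le => i; rewrite normrM -[leRHS]mul1r ler_pM//.
      by rewrite [(mu - nu) _ _]mxE [(- nu) _ _]mxE; exact: close.
    have h3 : n.+1%:R * (2 * n.+1%:R)^-1 = 1 / 2 :> R.
      by field; rewrite addrC natr1 pnatr_eq0.
    by move: h2; rewrite h3 ler_norml; lra.
  (* The left side is nonpositive because [p] satisfies the facet inequality at [y]. On the right,
     the pairing of [x - y] with [nu] is nonnegative by support at [x], and the one with [mu - nu]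
     is at least -n * e1, so the overshoot along coordinate [j] is O(e1). *)
  have E : dot (p - y) mu = `|q ord0 j| * dot nu mu + (dot (x - y) (mu - nu) + dot (x - y) nu).
    rewrite -dotZl -qE dotBr subrK -dotDl.
    by rewrite /q addrA subrK.
  have E2 : dot (x - y) (mu - nu) = - dot (y - x) (mu - nu) by rewrite -dotNl opprB.
  have E3 : dot (x - y) nu = - dot (y - x) nu by rewrite -dotNl opprB.
  have h4 : `|q ord0 j| * (1 / 2) <= n%:R * e1.
    apply: le_trans (_ : `|q ord0 j| * dot nu mu <= _); first by rewrite ler_pM2l.
    by move: Py; rewrite /= E E2 E3; lra.
  apply: le_trans qs _.
  have h5 : n%:R <= N by rewrite ler_nat.
  have h6 : `|q ord0 j| <= 2 * N * e1.
    have : n%:R * e1 <= N * e1 by rewrite ler_wpM2r// ltW.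
    by rewrite -mulrA; lra.
  have -> : eps = N * (2 * N * e1) by rewrite /e1; field; rewrite gt_eqF.
  by rewrite ler_pM2l.
exists P, (size L); split => //.
- exists (fun k => (pt k).2), (fun k => dot (pt k).2 (pt k).1); split => //.
  exists (N * `|M| + eps) => p /near[x Kx px].
  have := enormD x (p - x); rewrite addrC subrK => /le_trans; apply.
  rewrite lerD//; apply: le_trans (enorm_le_sum x) _.
  apply: le_trans (ler_sum _ (fun i _ => KM x Kx i)) _.
  by rewrite sumr_const card_ord -mulr_natl ler_wpM2l ?ler_norm// ltW.
- rewrite /hausdorff_dist ge_max; apply/andP; split.
    apply: ge_ereal_sup => _ [a Ka <-]; apply: ge_ereal_inf.
    exists (enorm (a - a))%:E; first by exists a => //; exact: KP.
    by rewrite lee_fin subrr -(scale0r 0) enormZ// mul0r ltW.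
  apply: ge_ereal_sup => _ [p Pp <-]; apply: ge_ereal_inf.
  have [x Kx px] := near p Pp.
  by exists (enorm (p - x))%:E; [exists x|rewrite lee_fin].
- pose y := X * (Num.sqrt D / Num.sqrt e1).
  have sq0 : 0 < Num.sqrt D / Num.sqrt e1 by rewrite divr_gt0// sqrtr_gt0.
  have y0 : 0 < y by rewrite mulr_gt0.
  have -> : X ^+ 2 * (2 * N ^+ 2) * D / eps = y ^+ 2.
    rewrite /y [in RHS]exprMn expr_div_n !sqr_sqrtr ?(ltW D0) ?(ltW e10)//.
    by rewrite /e1; field; rewrite !gt_eqF.
  have -> : (y ^+ 2) `^ (n%:R / 2) = y ^+ n.
    rewrite -powR_mulrn ?(ltW y0)// -powRrM mulrC divfK ?pnatr_eq0//.
    by rewrite powR_mulrn// ltW.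
  (* The count has one factor [X] while [y ^+ n] has [n] of them; n >= 1 and X >= 1 close the
     gap. *)
  apply: le_trans (_ : X * (Num.sqrt D / Num.sqrt e1) ^+ n <= _); last first.
    rewrite /y [leRHS]exprMn ler_wpM2r ?exprn_ge0 ?(ltW sq0)//.
    by rewrite -(prednK n0) exprS ler_peMr ?exprn_ege1// ltW.
  have szL : size L = (\sum_(jb : 'I_n.+1 * bool) size (ss jb))%N.
    by rewrite size_flatten /shape -map_comp sumnE big_map big_enum.
  rewrite szL natr_sum.
  have bnd jb : (size (ss jb))%:R <= C * (Num.sqrt D / Num.sqrt e1) ^+ n.
    by have [_ h _] := ssP jb; rewrite expr_div_n.
  apply: le_trans (ler_sum _ (fun jb _ => bnd jb)) _.
  rewrite sumr_const card_prod card_ord card_bool -mulr_natl natrM mulrA.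
  by rewrite /X [2 * N]mulrC.
Qed.
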